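(* Consider the model $Y_j^{(i)}=\mu^*(X_j^{(i)})+U^{(i)}(X_j^{(i)})+\xi_{ij}$, $i=1,\dots,n$, $j=1,\dots,m$. Let $\mathcal{P}_X$ be the class of sampling distributions satisfying Assumption S and $\mathcal{P}_Y$ the class of distributions of the noisy observations satisfying Assumption M (both in the context). Let $\epsilon\in(0,1)$ and suppose that $$\delta\sqrt{\log(1/\delta)}\lesssim n^{-\frac{2\alpha+3}{2\alpha+2}}m^{-\frac{8\alpha+9}{4\alpha+4}}\epsilon^{-\frac{1}{2\alpha+2}}.$$ Then $$\inf_{Q\in\mathcal{Q}_{\epsilon,\delta}}\inf_{\widetilde\mu}\sup_{P_X\in\mathcal{P}_X,P_Y\in\mathcal{P}_Y}\mathbb{E}_{P_X,P_Y,Q}\|\widetilde\mu-\mu^*\|_{L^2}^2\gtrsim(nm)^{-\frac{2\alpha}{2\alpha+1}}\vee(n^2m\epsilon^2)^{-\frac{\alpha}{\alpha+1}}\vee n^{-1}\vee(n\epsilon)^{-2},$$ where $\mathcal{Q}_{\epsilon,\delta}$ is the set of all mechanisms satisfying $(\epsilon,\delta)$-CDP and the inner infimum is over all privatized estimators $\widetilde\mu$ (i.e. measurable functions of the output of $Q$).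
   Context: Notation. $a\vee b=\max$. $a\lesssim b$ (equivalently $b\gtrsim a$) means $a\le Cb$ for an absolute constant $C>0$ (which may depend on the fixed constants $\alpha,C_\alpha,L,C_U,C_\xi$). The parameters $m,\epsilon,\delta$ may vary with $n$. $\|X\|_{\psi_2}=\inf\{t>0:\mathbb{E}\exp(X^2/t^2)\le2\}$. Sobolev space. $\phi_1=1$, $\phi_{2\ell}(t)=\sqrt2\cos(2\ell\pi t)$, $\phi_{2\ell+1}(t)=\sqrt2\sin(2\ell\pi t)$ is the Fourier basis of $L^2([0,1])$. For absolute constants $\alpha>1$, $C_\alpha>0$, $\mathcal{W}(\alpha,C_\alpha)$ is the set of $f=\sum_\ell\phi_\ell\langle f,\phi_\ell\rangle_{L^2}$ with $\sum_{\ell\ge1}\ell^{2\alpha}\langle f,\phi_\ell\rangle_{L^2}^2\le C_\alpha^2/\pi^{2\alpha}$. The fixed constants are such that the distribution classes below are non-empty. Model. $\mu^*:[0,1]\to\mathbb{R}$ is deterministic; $U^{(i)}$ are random functions on $[0,1]$ with $\mathbb{E}U^{(i)}(s)=0$ and common covariance function; $\xi_{ij}$ are mean-zero errors. Assumption S. $\{X_j^{(i)}\}$ are independently sampled from a density $f_X$ on $[0,1]$ with $f_X\in\mathcal{W}(\alpha,C_\alpha)$ and $0<1/L\le f_X(x)<L<\infty$ for all $x\in[0,1]$, $L>1$ an absolute constant. Assumption M. (a) $\mu^*\in\mathcal{W}(\alpha,C_\alpha)$. (b) $\{U^{(i)}\}_{i=1}^n$ are independent, $\|U^{(i)}(x)\|_{\psi_2}\le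 C_U$ for all $i$ and $x\in[0,1]$, $U^{(i)}\in\mathcal{W}(\alpha,C_\alpha)$ almost surely, and $\{U^{(i)}\}$ is independent of $\{X_j^{(i)}\}$. (c) $\{\xi_{ij}\}$ are independent with $\|\xi_{ij}\|_{\psi_2}\le C_\xi$, and independent of $\{U^{(i)}\}$ and $\{X_j^{(i)}\}$. Here $C_U,C_\xi>0$ are absolute constants. CDP. A data entry is one whole function, i.e. $\{(x_j^{(i)},y_j^{(i)})\}_{j=1}^m$ for one $i$; $D\sim D'$ if the datasets differ in at most one such entry. A mechanism $Q$ (conditional distribution of the released output given the data) is $(\epsilon,\delta)$-CDP if $Q(Z\in A\mid D)\le e^\epsilon Q(Z\in A\mid D')+\delta$ for all measurable $A$ and $D\sim D'$. The expectation is over both the data and $Q$.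
   Formalization: Two conditions are added: nε ≥ κ and 0 ≤ δ ≤ 1 − κ, for an arbitrary constant κ > 0 on which the constant in ≳ may depend; as stated the bound fails if nε → 0 (the risk is bounded while (nε)^{-2} → ∞) and if δ = 1 (privacy is void). *)

(* Defs.v *)
(* MathComp-Analysis *)
From HB Require Import structures.
From mathcomp Require Export all_boot all_order all_algebra.
From mathcomp Require Export all_classical all_reals all_analysis.

Set Implicit Arguments.
Unset Strict Implicit.
Unset Printing Implicit Defensive.

Export Order.TTheory GRing.Theory Num.Theory.
Export numFieldNormedType.Exports.

Local Open Scope classical_set_scope.
Local Open Scope ring_scope.

Section sobolev.
Context {R : realType}.
Local Notation leb := (@lebesgue_measure R).

(* Only the indices l >= 1 are used; 2l and 2l+1 share the frequency l. *)
Definition fourier (l : nat) (t : R) : R :=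
  if l == 1%N then 1
  else if odd l then Num.sqrt 2 * sin ((l./2).*2%:R * pi * t)
  else Num.sqrt 2 * cos ((l./2).*2%:R * pi * t).

Definition fourier_coef (f : R -> R) (l : nat) : R :=
  \int[leb]_(t in `[0, 1]) (f t * fourier l t).

Definition sql2norm (f : R -> R) : \bar R :=
  (\int[leb]_(t in `[0%R, 1%R]) ((f t) ^+ 2)%:E)%E.

(* Functions on [0, 1] are functions R -> R whose values outside [0, 1] are
   irrelevant. For alpha > 1 the Fourier series converges absolutely, so asking
   for it to converge to f at every point selects the continuous representative
   of the L^2 class; this is what gives a meaning to point evaluations. *)
Record sobolev (alpha Calpha : R) (f : R -> R) : Prop := Sobolev {
  sobolev_meas : measurable_fun (`[0, 1] : set R) f;
  sobolev_L2 : (sql2norm f < +oo)%E;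
  sobolev_series : forall t, 0 <= t <= 1 ->
    (\sum_(1 <= l < N) fourier_coef f l * fourier l t) @[N --> \oo] --> f t;
  sobolev_bound :
    (\sum_(1 <= l <oo) (l%:R `^ (2 * alpha) * fourier_coef f l ^+ 2)%:E
       <= (Calpha ^+ 2 / pi `^ (2 * alpha))%:E)%E }.

Record sampling_density (alpha Calpha L : R) (f : R -> R) : Prop :=
  SamplingDensity {
  density_sobolev : sobolev alpha Calpha f;
  density_bounds : forall t, 0 <= t <= 1 -> L^-1 <= f t < L;
  density_mass : (\int[leb]_(t in `[0%R, 1%R]) (f t)%:E = 1)%E }.

End sobolev.

Section probability_notions.
Context {R : realType} {d : measure_display} {T : measurableType d}.
Variable P : probability T R.
Implicit Types F G : set (T -> R).

Definition psi2_norm (X : T -> R) : \bar R :=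
  ereal_inf [set t%:E | t in [set t : R | 0 < t /\
    (\int[P]_w (expR (X w ^+ 2 / t ^+ 2))%:E <= 2%:E)%E]].

Definition sigma_gen F : set (set T) :=
  <<s [set A | exists2 f, F f & exists2 B, measurable B & A = f @^-1` B] >>.

Definition mutually_indep (I : finType) (F : I -> set (T -> R)) : Prop :=
  forall (J : {set I}) (A : I -> set T),
    (forall i, i \in J -> sigma_gen (F i) (A i)) ->
    P (\bigcap_(i in [set` J]) A i) = (\prod_(i in J) P (A i))%E.

Definition indep2 F G : Prop := forall A B,
  sigma_gen F A -> sigma_gen G B -> P (A `&` B) = (P A * P B)%E.

End probability_notions.

Section model.
Context {R : realType} {d : measure_display} {T : measurableType d}.
Variables (P : probability T R) (n m : nat).
Implicit Types (X xi : 'I_n -> 'I_m -> {RV P >-> R}) (U : 'I_n -> R -> T -> R).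
Local Notation leb := (@lebesgue_measure R).

Definition vars_of X : set (T -> R) :=
  [set V | exists i j, V = X i j :> (T -> R)].

Definition path_vars U i : set (T -> R) := [set U i s | s in `[0, 1]].

Definition paths_vars U : set (T -> R) := [set V | exists i, path_vars U i V].

Record assumptionS (alpha Calpha L : R) X : Prop := AssumptionS {
  S_range : forall i j w, 0 <= X i j w <= 1;
  S_indep : mutually_indep P
    (fun ij : 'I_n * 'I_m => [set (X ij.1 ij.2 : T -> R)]);
  S_density : exists2 f, sampling_density alpha Calpha L f &
    forall i j A, measurable A ->
      P (X i j @^-1` A) = (\int[leb]_(t in A `&` `[0%R, 1%R]) (f t)%:E)%E }.

(* Joint measurability of each U^(i) makes Y = mu(X) + U(X) + xi a random
   variable. *)
Record assumptionM (alpha Calpha CU Cxi : R) X (mu : R -> R) U xi : Prop :=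
  AssumptionM {
  M_mean : sobolev alpha Calpha mu;
  M_U_meas : forall i,
    measurable_fun ((`[0, 1] : set R) `*` [set: T]) (fun p : R * T => U i p.1 p.2);
  M_U_centered : forall i s, 0 <= s <= 1 -> ('E_P[U i s] = 0)%E;
  M_U_cov : forall i k s t, 0 <= s <= 1 -> 0 <= t <= 1 ->
    covariance P (U i s) (U i t) = covariance P (U k s) (U k t);
  M_U_indep : mutually_indep P (path_vars U);
  M_U_psi2 : forall i s, 0 <= s <= 1 -> (psi2_norm P (U i s) <= CU%:E)%E;
  M_U_sobolev : forall i,
    \forall w \ae P, sobolev alpha Calpha (fun s => U i s w);
  M_U_X : indep2 P (paths_vars U) (vars_of X);
  M_xi_centered : forall i j, ('E_P[xi i j] = 0)%E;
  M_xi_indep : mutually_indep P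
    (fun ij : 'I_n * 'I_m => [set (xi ij.1 ij.2 : T -> R)]);
  M_xi_psi2 : forall i j, (psi2_norm P (xi i j) <= Cxi%:E)%E;
  M_xi_UX : indep2 P (vars_of xi) (paths_vars U `|` vars_of X) }.

Definition response X (mu : R -> R) U xi i j (w : T) : R :=
  mu (X i j w) + U i (X i j w) w + xi i j w.

Definition data X (mu : R -> R) U xi (w : T) : n.-tuple (m.-tuple (R * R)) :=
  [tuple [tuple (X i j w, response X mu U xi i j w) | j < m] | i < n].

End model.

Section minimax.
Context {R : realType}.
Local Notation dataset n m := (n.-tuple (m.-tuple (R * R)%type)).
Local Notation leb := (@lebesgue_measure R).

(* Design points of actual datasets lie in [0, 1]. *)
Definition valid_dataset n m (D : dataset n m) : Prop :=
  forall i j, 0 <= (tnth (tnth D i) j).1 <= 1.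

Definition adjacent n m (D D' : dataset n m) : Prop :=
  (#|[set i : 'I_n | tnth D i != tnth D' i]%SET| <= 1)%N.

Definition is_CDP n m (eps delta : R) d (Z : measurableType d)
    (Q : R.-pker (dataset n m) ~> Z) : Prop :=
  forall D D' : dataset n m, valid_dataset D -> valid_dataset D' ->
    adjacent D D' -> forall A, measurable A ->
    (Q D A <= (expR eps)%:E * Q D' A + delta%:E)%E.

(* An estimator is a measurable function of the output with values in functions
   on [0, 1], presented as a jointly measurable function. *)
Definition estimator d (Z : measurableType d) : set (Z -> R -> R) :=
  [set mut | measurable_fun ([set: Z] `*` (`[0, 1] : set R))
               (fun p : Z * R => mut p.1 p.2)].

Definition risk n m d (T : measurableType d) (P : probability T R)
    (D : T -> dataset n m) (mu : R -> R)
    dZ (Z : measurableType dZ) (Q : R.-pker (dataset n m) ~> Z)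
    (mut : Z -> R -> R) : \bar R :=
  (\int[P]_w \int[Q (D w)]_z sql2norm (fun t => (mut z t - mu t)%R))%E.

Section constants.
Variables (alpha Calpha L CU Cxi : R) (n m : nat).

Definition worst_risk dZ (Z : measurableType dZ)
    (Q : R.-pker (dataset n m) ~> Z) (mut : Z -> R -> R) : \bar R :=
  ereal_sup [set r | exists (d : measure_display) (T : measurableType d)
    (P : probability T R) (X : 'I_n -> 'I_m -> {RV P >-> R}) (mu : R -> R)
    (U : 'I_n -> R -> T -> R) (xi : 'I_n -> 'I_m -> {RV P >-> R}),
    [/\ assumptionS alpha Calpha L X,
        assumptionM alpha Calpha CU Cxi X mu U xi &
        r = risk P (data X mu U xi) mu Q mut]].

Definition minimax_risk (eps delta : R) : \bar R :=
  ereal_inf [set r | exists (dZ : measure_display) (Z : measurableType dZ)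
    (Q : R.-pker (dataset n m) ~> Z), is_CDP eps delta Q /\
    r = ereal_inf [set worst_risk Q mut | mut in @estimator dZ Z]].

End constants.

End minimax.

(* Main.v *)
Require Import Defs.
From HB Require Import structures.
From mathcomp Require Import measurable_realfun ring lra.

(** The minimax risk is bounded below by four separate terms, each produced by
    its own family of distributions inside the class; the smallest of the four
    constants then serves for their maximum. In all of them the design is
    uniform, the density 1 being admissible as soon as the class contains any
    density at all (sobolev_radius).

    The terms 1/n and 1/(n eps)^2 come from the random functions U alone. Take
    no noise and let each U^(i) + mu be constant in space, equal to b or -b with
    a bias of sign sg = s or -s, so that mu = sg * b. Then the m observations of
    a user carry a single bit. Without privacy the two laws of the n bits are
    compared in chi-square distance, which is small when n s^2 is
    (mean_answer_chi2). With privacy both laws are realised on one probability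
    space where each bit changes with probability s, and the mechanism is
    followed along the datasets that interpolate between the two, one user at a
    time (mean_answer_privacy); this is harmless when n s eps is small.

    The two other terms come from Gaussian noise, with U = 0 and
    mu = sum_(l < K) th_l phi_(l+1) for th in the cube [-a, a]^K. An estimator
    yields, by projection on the Fourier basis, coefficients M_l
    (estimator_coefficients). Put the uniform prior on th and the weight
    w_l = a^2 - th_l^2, which vanishes at the ends of [-a, a]. With S_l the
    derivative of the log-likelihood in th_l, integration by parts in th_l gives
    E[M_l w_l S_l] = E[2 th_l M_l] (score_by_parts); as
    2 th M >= th^2 - (M - th)^2, a risk at most r forces

      K a^2 / 3 - r <= sum_l E[M_l w_l S_l]        (trace_lower).

    So an accurate estimator must be correlated with the score, and it remains
    to show that it cannot be. Trivially the right-hand side is at most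
    K a^3 sqrt(n m) up to a constant (nonprivate_lower). Under privacy, split
    the score over the users. The part of user i is centered and independent of
    the output computed on the dataset where user i is replaced by a constant
    entry, hence uncorrelated with it; the replacement changes expectations by a
    factor exp eps and an additive error delta (dp_Rintegral), and since the
    functions phi_l are orthonormal the absolute correlation that the factor
    multiplies is only of order a^3 sqrt(K m), not K a^3 sqrt m
    (contrast_abs_le, private_lower). Taking
    a^2 of order K^(-2 alpha - 1) and K = (n m)^(1/(2 alpha + 1)), respectively
    K = (n^2 m eps^2)^(1/(2 alpha + 2)), gives the two rates; the condition on
    delta makes n delta sqrt m bounded (delta_small), so that the additive error
    is negligible. *)

Set Implicit Arguments.
Unset Strict Implicit.
Unset Printing Implicit Defensive.

Local Open Scope classical_set_scope.
Local Open Scope ring_scope.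

(** * Product probability spaces *)

Section transfer_law.
Context d d' (T : measurableType d) (T' : measurableType d') (R : realType).
Variables (P : {measure set T -> \bar R}) (P' : {measure set T' -> \bar R}).
Variable phi : T -> T'.
Hypothesis mphi : measurable_fun setT phi.
Hypothesis law : forall A, measurable A -> P (phi @^-1` A) = P' A.

(** Change of variables with the law of phi given by its values on measurable
    sets, so that P' may carry any measure structure. *)
Lemma ge0_integral_law (f : T' -> \bar R) : measurable_fun setT f ->
  (forall y, 0 <= f y)%E -> (\int[P]_x f (phi x) = \int[P']_y f y)%E.
Proof.
move=> mf f0.
have := ge0_integral_pushforward mphi P (D := setT) (f := f) measurableT mf.
rewrite preimage_setT => <- //.
by apply: eq_measure_integral => A mA _; exact: law.
Qed.

Lemma integral_law (f : T' -> \bar R) : measurable_fun setT f ->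
  (\int[P]_x f (phi x) = \int[P']_y f y)%E.
Proof.
move=> mf; rewrite integralE [RHS]integralE.
rewrite -(ge0_integral_law (f := f^\+%E)) //; last exact: measurable_funepos.
rewrite -(ge0_integral_law (f := f^\-%E)) //; last exact: measurable_funeneg.
by congr (_ - _)%E; apply: eq_integral => x _; rewrite (funepos_comp, funeneg_comp).
Qed.

Lemma integrable_law (f : T' -> \bar R) : measurable_fun setT f ->
  P.-integrable setT (f \o phi) <-> P'.-integrable setT f.
Proof.
move=> mf.
have h : (\int[P]_x `|f (phi x)| = \int[P']_y `|f y|)%E.
  rewrite (ge0_integral_law (f := fun y => `|f y|%E)) //.
  exact: measurableT_comp.
split=> /integrableP[_ fi]; apply/integrableP; split=> //.
- by rewrite -h.
- exact: measurableT_comp.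
- by move: fi; rewrite -h.
Qed.

End transfer_law.

Notation tup R J := (#|J|.-tuple R).

Section product_space.
Context {R : realType} (J : finType).

(** A point of a product indexed by J is stored as a tuple, since tuples carry the
    product sigma-algebra; co and mk pass from positions to labels and back. *)
Definition co (t : tup R J) (j : J) : R := tnth t (enum_rank j).
Definition mk (f : J -> R) : tup R J := [tuple f (enum_val i) | i < #|J|].

Lemma coK f j : co (mk f) j = f j.
Proof. by rewrite /co tnth_mktuple enum_rankK. Qed.

Lemma co_inj t t' : co t =1 co t' -> t = t'.
Proof.
move=> h; apply: eq_from_tnth => i.
by have := h (enum_val i); rewrite /co enum_valK.
Qed.

Lemma measurable_co j : measurable_fun setT (fun t : tup R J => co t j).
Proof. exact: measurable_tnth. Qed.

Lemma measurable_mk d (T : measurableType d) (f : T -> J -> R) :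
  (forall j, measurable_fun setT (fun x => f x j)) ->
  measurable_fun setT (fun x => mk (f x)).
Proof.
move=> mf; apply/measurable_fun_tnthP => i.
by apply: eq_measurable_fun (mf (enum_val i)) => x _ /=; rewrite tnth_mktuple.
Qed.

Definition rect (A : J -> set R) : set (tup R J) := [set t | forall j, A j (co t j)].

Lemma measurable_rect A : (forall j, measurable (A j)) -> measurable (rect A).
Proof.
move=> mA.
have -> : rect A = \bigcap_(j in [set: J]) ((fun t : tup R J => co t j) @^-1` A j).
  by apply/seteqP; split=> t h j //=; exact: h.
apply: fin_bigcap_measurable => [|j _]; first exact: finite_finset.
by rewrite -[X in measurable X]setTI; exact: measurable_co.
Qed.

Lemma rect_generates : @measurable _ (tup R J) =
  <<s [set B | exists2 A, (forall j, measurable (A j)) & B = rect A] >>.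
Proof.
apply/seteqP; split; last first.
  apply: smallest_sub; first exact: sigma_algebra_measurable.
  by move=> _ [A mA ->]; exact: measurable_rect.
apply: smallest_sub; first exact: smallest_sigma_algebra.
move=> B; rewrite -bigcup_seq /= => -[i _ [C mC <-]]; apply: sub_sigma_algebra.
exists (fun j => if j == enum_val i then C else setT).
  by move=> j; case: ifP.
apply/seteqP; split=> t /=; rewrite /rect /=.
  move=> [_ Ct] j; case: eqP => // ->; by rewrite /co enum_valK.
by move=> /(_ (enum_val i)); rewrite eqxx /co enum_valK.
Qed.

(** Rectangles are stable under intersection and generate the product
    sigma-algebra. *)
Lemma rect_unique (m1 m2 : {measure set (tup R J) -> \bar R}) :
  (m1 setT < +oo)%E ->
  (forall A, (forall j, measurable (A j)) -> m1 (rect A) = m2 (rect A)) ->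
  forall B, measurable B -> m1 B = m2 B.
Proof.
move=> m1T m12 B mB.
have rT : rect (fun=> setT) = setT by apply/seteqP; split.
apply: (measure_unique [set B | exists2 A, (forall j, measurable (A j)) & B = rect A]
  (fun=> setT) rect_generates) => //.
- move=> _ _ [A mA ->] [A' mA' ->]; exists (fun j => A j `&` A' j).
    by move=> j; exact: measurableI.
  apply/seteqP; split=> t /=.
    by move=> [h h'] j; split; [exact: h|exact: h'].
  by move=> h; split=> j; have [] := h j.
- by move=> _; exists (fun=> setT).
- by rewrite bigcup_const //; exists 0%N.
- by move=> _ [A mA ->]; exact: m12.
Qed.

End product_space.

Lemma pushforward_prob d d' (T : measurableType d) (T' : measurableType d')
    (R : realType) (P : probability T R) (f : T -> T') :
  measurable_fun setT f ->
  exists P' : probability T' R, forall A, P' A = P (f @^-1` A).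
Proof.
move=> mf.
pose g : {mfun T >-> T'} := HB.pack f (isMeasurableFun.Build _ _ _ _ f mf).
by exists (distribution P g).
Qed.

Lemma tuple_product (R : realType) N (p : nat -> probability R R) :
  exists P : probability (N.-tuple R) R,
    forall A : nat -> set R, (forall i, measurable (A i)) ->
    P [set t | forall i : 'I_N, A i (tnth t i)] = (\prod_(i < N) p i (A i))%E.
Proof.
elim: N p => [|N IH] p.
  exists (\d_([tuple] : 0.-tuple R) : probability _ R) => A mA.
  by rewrite big_ord0 /= diracE mem_set //; case.
have [P' hP'] := IH (fun i => p i.+1).
pose f (x : R * N.-tuple R) : N.+1.-tuple R := [tuple of x.1 :: x.2].
have mf : measurable_fun setT f by apply: measurable_cons.
have [P hP] := pushforward_prob (p 0%N \x P')%E mf.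
exists P => A mA; rewrite hP big_ord_recl /=.
have -> : f @^-1` [set t | forall i : 'I_N.+1, A i (tnth t i)] =
    A 0%N `*` [set t | forall i : 'I_N, A i.+1 (tnth t i)].
  apply/seteqP; split=> -[x t] /=.
    move=> h; split; first exact: (h ord0).
    by move=> i; have := h (lift ord0 i); rewrite tnthS.
  move=> [h0 h] i; have [->|[j ->]] : i = ord0 \/ exists j, i = lift ord0 j.
  - by case: (unliftP ord0 i) => [j ->|->]; [right; exists j|left].
  - exact: h0.
  - by rewrite tnthS; exact: h.
rewrite product_measure1E //.
  by have /= -> := hP' (fun i => A i.+1) (fun i => mA i.+1).
have -> : [set t | forall i : 'I_N, A i.+1 (tnth t i)] =
  \bigcap_(i in [set: 'I_N]) ((fun t : N.-tuple R => tnth t i) @^-1` A i.+1).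
  by apply/seteqP; split=> t h j //=; exact: h.
apply: fin_bigcap_measurable => [|j _]; first exact: finite_finset.
by rewrite -[X in measurable X]setTI; exact: measurable_tnth.
Qed.

Section product_probability.
Context {R : realType} (J : finType).

Lemma ex_prodP (p : J -> probability R R) :
  exists P : probability (tup R J) R,
    forall A : J -> set R, (forall j, measurable (A j)) ->
    P (rect A) = (\prod_j p j (A j))%E.
Proof.
have [J0|/card_gt0P[j0 _]] := posnP #|J|.
  have [P hP] := tuple_product #|J| (fun=> \d_(0 : R)).
  exists P => A mA; rewrite big_pred0; last first.
    by move=> j; have := fintype0 j J0.
  have <- : [set t : tup R J | forall i : 'I_#|J|, setT (tnth t i)] = rect A.
    by apply/seteqP; split=> t //= _ j; have := fintype0 j J0.
  by rewrite (hP (fun=> setT)) // big1 // => i _; rewrite probability_setT.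
pose e i : J := nth j0 (enum J) i.
have eE (i : 'I_#|J|) : e i = enum_val i by rewrite /e (enum_val_nth j0).
have [P hP] := tuple_product #|J| (fun i => p (e i)).
exists P => A mA.
have -> : rect A = [set t | forall i : 'I_#|J|, A (e i) (tnth t i)].
  apply/seteqP; split=> t h => [i|j] /=.
    by have := h (enum_val i); rewrite eE /co enum_valK.
  by have := h (enum_rank j); rewrite eE enum_rankK.
rewrite (hP (fun i => A (e i))) // [RHS](reindex _ (onW_bij _ (enum_val_bij J))) /=.
by apply: eq_bigr => i _; rewrite eE.
Qed.

Definition prodP (p : J -> probability R R) : probability (tup R J) R :=
  projT1 (cid (ex_prodP p)).

Lemma prodP_rect p A : (forall j, measurable (A j)) ->
  prodP p (rect A) = (\prod_j p j (A j))%E.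
Proof. exact: (projT2 (cid (ex_prodP p))). Qed.

Variable p : J -> probability R R.
Local Notation P := (prodP p).

Lemma prodP_unique d (T : measurableType d) (Q : probability T R)
    (phi : T -> tup R J) : measurable_fun setT phi ->
  (forall A, (forall j, measurable (A j)) ->
    Q (phi @^-1` rect A) = (\prod_j p j (A j))%E) ->
  forall B, measurable B -> Q (phi @^-1` B) = P B.
Proof.
move=> mphi hQ B mB; have [Q' hQ'] := pushforward_prob Q mphi.
transitivity (Q' B); first exact/esym/hQ'.
apply: rect_unique mB => [|A mA].
  by apply: (@le_lt_trans _ _ 1%E); [exact: probability_le1|exact: ltry].
transitivity (Q (phi @^-1` rect A)); first exact: hQ'.
by rewrite hQ //; exact/esym/prodP_rect.
Qed.

(** Resampling of the coordinates in A; together with the law of merge it plays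
    the part of Fubini's theorem for a splitting of the index set. *)
Definition merge (A : pred J) (t s : tup R J) : tup R J :=
  mk (fun j => if A j then co s j else co t j).

Lemma mergeE A t s j : co (merge A t s) j = if A j then co s j else co t j.
Proof. by rewrite coK. Qed.

Lemma measurable_merge A :
  measurable_fun setT (fun ts : tup R J * tup R J => merge A ts.1 ts.2).
Proof.
apply: (@measurable_mk _ _ _ _ (fun ts j => if A j then co ts.2 j else co ts.1 j)).
by move=> j /=; case: (A j); exact: (measurableT_comp (measurable_co j)).
Qed.

(** Both sides have the same value on a rectangle, whose preimage is a product of
    two rectangles. *)
Lemma merge_law A B : measurable B ->
  (P \x P)%E ((fun ts => merge A ts.1 ts.2) @^-1` B) = P B.
Proof.
apply: prodP_unique; first exact: measurable_merge.
move=> C mC.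
pose C1 j := if A j then setT else C j.
pose C2 j := if A j then C j else setT.
have mC1 j : measurable (C1 j) by rewrite /C1; case: ifP.
have mC2 j : measurable (C2 j) by rewrite /C2; case: ifP.
rewrite (_ : _ @^-1` _ = rect C1 `*` rect C2).
  transitivity (P (rect C1) * P (rect C2))%E.
    by apply: product_measure1E; exact: measurable_rect.
  rewrite !prodP_rect // -big_split /=; apply: eq_bigr => j _.
  by rewrite /C1 /C2; case: ifP; rewrite probability_setT ?mul1e ?mule1.
apply/seteqP; split=> -[t s] /=.
  move=> h; split=> j; have := h j; rewrite mergeE /C1 /C2; case: ifP => //.
by move=> [h1 h2] j; have := h1 j; have := h2 j; rewrite mergeE /C1 /C2; case: ifP.
Qed.

Lemma ge0_integral_merge A (F : tup R J -> \bar R) : measurable_fun setT F ->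
  (forall t, 0 <= F t)%E ->
  (\int[P]_t F t = \int[P]_t \int[P]_s F (merge A t s))%E.
Proof.
move=> mF F0.
have mFm : measurable_fun setT (fun ts : tup R J * tup R J => F (merge A ts.1 ts.2)).
  by apply: measurableT_comp => //; exact: measurable_merge.
by rewrite -(ge0_integral_law (measurable_merge A) (@merge_law A) mF F0) fubini_tonelli1.
Qed.

Lemma marginal_law j B : measurable B ->
  P ((fun t => co t j) @^-1` B) = p j B.
Proof.
move=> mB; rewrite (_ : _ @^-1` _ = rect (fun k => if k == j then B else setT)).
  rewrite prodP_rect; last by move=> k; case: ifP.
  rewrite (bigD1 j) //= eqxx big1 ?mule1 // => k /negbTE ->.
  by rewrite probability_setT.
apply/seteqP; split=> t /=; last by move=> /(_ j); rewrite eqxx.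
by move=> Bt k; case: eqP => // ->.
Qed.

Lemma ge0_integral_co j (F : R -> \bar R) : measurable_fun setT F ->
  (forall u, 0 <= F u)%E -> (\int[P]_t F (co t j) = \int[p j]_u F u)%E.
Proof.
move=> mF F0; apply: ge0_integral_law => //; first exact: measurable_co.
by move=> B mB; exact: marginal_law.
Qed.

Definition upd (t : tup R J) j (u : R) : tup R J :=
  mk (fun k => if k == j then u else co t k).

Lemma updE t j u k : co (upd t j u) k = if k == j then u else co t k.
Proof. by rewrite coK. Qed.

Lemma measurable_upd j :
  measurable_fun setT (fun tu : tup R J * R => upd tu.1 j tu.2).
Proof.
apply: (@measurable_mk _ _ _ _ (fun tu k => if k == j then tu.2 else co tu.1 k)).
move=> k /=; case: (k == j); first exact: measurable_snd.
exact: (measurableT_comp (measurable_co k) measurable_fst).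
Qed.

Lemma upd_law j B : measurable B ->
  (P \x p j)%E ((fun tu => upd tu.1 j tu.2) @^-1` B) = P B.
Proof.
apply: prodP_unique; first exact: measurable_upd.
move=> C mC.
pose C1 k := if k == j then setT else C k.
have mC1 k : measurable (C1 k) by rewrite /C1; case: ifP.
rewrite (_ : _ @^-1` _ = rect C1 `*` C j).
  transitivity (P (rect C1) * p j (C j))%E.
    by apply: product_measure1E => //; exact: measurable_rect.
  rewrite prodP_rect // (bigD1 j) //= [RHS](bigD1 j) //= /C1 eqxx.
  rewrite probability_setT mul1e muleC; congr (_ * _)%E.
  by apply: eq_bigr => k /negbTE ->.
apply/seteqP; split=> -[t u] /=.
  move=> h; split; last by have := h j; rewrite updE eqxx.
  by move=> k; have := h k; rewrite updE /C1; case: ifP.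
move=> [h1 h2] k; rewrite updE; case: eqP => [->//|/eqP/negbTE kj].
by have := h1 k; rewrite /C1 kj.
Qed.

Lemma ge0_integral_upd j (F : tup R J -> \bar R) : measurable_fun setT F ->
  (forall t, 0 <= F t)%E ->
  (\int[P]_t F t = \int[P]_t \int[p j]_u F (upd t j u))%E.
Proof.
move=> mF F0.
have mFm : measurable_fun setT (fun tu : tup R J * R => F (upd tu.1 j tu.2)).
  by apply: measurableT_comp => //; exact: measurable_upd.
by rewrite -(ge0_integral_law (measurable_upd j) (@upd_law j) mF F0) fubini_tonelli1.
Qed.

Lemma integral_upd j (F : tup R J -> \bar R) : P.-integrable setT F ->
  (\int[P]_t F t = \int[P]_t \int[p j]_u F (upd t j u))%E.
Proof.
move=> iF; have mF := measurable_int _ iF.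
have iFm := (integrable_law (measurable_upd j) (@upd_law j) mF).2 iF.
by rewrite -(integral_law (measurable_upd j) (@upd_law j) mF)
  -(integral12_prod_meas1 iFm).
Qed.

End product_probability.

Section independence.
Context {R : realType} (J : finType) (p : J -> probability R R).
Local Notation P := (prodP p).

(** Dependence on part of the coordinates replaces sigma-algebras in all the
    independence statements. *)
Definition dep_on (A : pred J) (V : Type) (f : tup R J -> V) : Prop :=
  forall t s, (forall j, A j -> co t j = co s j) -> f t = f s.

Lemma dep_onS (A B : pred J) V (f : tup R J -> V) :
  (forall j, A j -> B j) -> dep_on A f -> dep_on B f.
Proof. by move=> AB fA t s ts; apply: fA => j /AB; exact: ts. Qed.

Lemma indep_dep_on (A : pred J) (B C : set (tup R J)) :
  measurable B -> measurable C -> dep_on A B -> dep_on (predC A) C ->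
  P (B `&` C) = (P B * P C)%E.
Proof.
move=> mB mC dB dC; rewrite -(merge_law p A); last exact: measurableI.
rewrite (_ : _ @^-1` _ = C `*` B).
  by rewrite muleC; apply: product_measure1E.
apply/seteqP; split=> -[t s] /=.
  move=> [Bm Cm]; split.
    by rewrite -(dC (merge A t s)) // => j /negbTE Aj; rewrite mergeE Aj.
  by rewrite -(dB (merge A t s)) // => j Aj; rewrite mergeE Aj.
move=> [Ct Bs]; split.
  by rewrite (dB _ s) // => j Aj; rewrite mergeE Aj.
by rewrite (dC _ t) // => j /negbTE Aj; rewrite mergeE Aj.
Qed.

(** The sets that are measurable and depend on A only form a sigma-algebra. *)
Lemma sigma_gen_dep_on (A : pred J) (F : set (tup R J -> R)) :
  (forall f, F f -> measurable_fun setT f /\ dep_on A f) ->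
  forall B, sigma_gen F B -> measurable B /\ dep_on A B.
Proof.
move=> hF; suff: sigma_gen F `<=` [set B | measurable B /\ dep_on A B] by [].
apply: smallest_sub => [|X [f Ff [Y mY ->]]].
  split; first by split.
    by move=> X [mX dX]; split; [rewrite setTD; exact: measurableC|move=> t s ts;
      rewrite setTD /setC /= (dX t s)].
  move=> X hX; split; first by apply: bigcupT_measurable => i; have [] := hX i.
  move=> t s ts; apply/propext; split=> -[i _ Xi]; exists i => //.
    by rewrite -((hX i).2 t s).
  by rewrite ((hX i).2 t s).
have [mf df] := hF f Ff; split; first by rewrite -[X in measurable X]setTI; exact: mf.
by move=> t s ts; rewrite /preimage /= (df t s).
Qed.

(** Families are independent when they read disjoint blocks of coordinates; lab
    names the block of each coordinate, None meaning that no family reads it. *)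
Lemma mutually_indep_prodP (I : finType) (lab : J -> option I)
    (F : I -> set (tup R J -> R)) :
  (forall i f, F i f ->
    measurable_fun setT f /\ dep_on (fun j => lab j == Some i) f) ->
  mutually_indep P F.
Proof.
move=> hF K A hA.
have hA' i : i \in K -> measurable (A i) /\ dep_on (fun j => lab j == Some i) (A i).
  by move=> iK; apply: sigma_gen_dep_on (hF i) _ (hA i iK).
have -> : \bigcap_(i in [set` K]) A i = \bigcap_(i in [set` enum K]) A i.
  by apply/seteqP; split=> t h i /= iK; apply: h; rewrite /= ?mem_enum // -mem_enum.
rewrite -big_enum /=.
have : {in enum K, forall i, i \in K} by move=> i; rewrite mem_enum.
have := enum_uniq K; elim: (enum K) => [|i s IH] /=.
  by move=> _ _; rewrite big_nil set_nil bigcap_set0 probability_setT.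
move=> /andP[nis us] sK.
have iK : i \in K by apply: sK; rewrite mem_head.
have {}sK : {in s, forall i, i \in K} by move=> k ks; apply: sK; rewrite in_cons ks orbT.
have -> : \bigcap_(k in [set` i :: s]) A k = A i `&` \bigcap_(k in [set` s]) A k.
  apply/seteqP; split=> t /=.
    by move=> h; split=> [|k /= ks]; apply: h; rewrite /= in_cons ?eqxx ?ks ?orbT.
  by move=> [h0 h] k /=; rewrite in_cons => /orP[/eqP->//|]; exact: h.
rewrite big_cons -IH //.
apply: (indep_dep_on (A := fun j => lab j == Some i)); [by have [] := hA' i iK| |by have [] := hA' i iK|].
  apply: fin_bigcap_measurable => [|k /= ks]; first exact: finite_seq.
  by have [] := hA' k (sK k ks).
move=> t s' ts; apply/propext; split=> h k /= ks.
  have [_ d] := hA' k (sK k ks); rewrite -(d t s'); first exact: h.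
  move=> j /eqP ljk; apply: ts; rewrite /= ljk; apply: contra nis => /eqP[<-].
  exact: ks.
have [_ d] := hA' k (sK k ks); rewrite (d t s'); first exact: h.
move=> j /eqP ljk; apply: ts; rewrite /= ljk; apply: contra nis => /eqP[<-].
exact: ks.
Qed.

Lemma indep2_prodP (A : pred J) (F G : set (tup R J -> R)) :
  (forall f, F f -> measurable_fun setT f /\ dep_on A f) ->
  (forall g, G g -> measurable_fun setT g /\ dep_on (predC A) g) ->
  indep2 P F G.
Proof.
move=> hF hG B C /(sigma_gen_dep_on hF)[mB dB] /(sigma_gen_dep_on hG)[mC dC].
exact: indep_dep_on dB dC.
Qed.

End independence.

(** * Densities, Lebesgue measure and Gaussian noise *)

Section density.
Local Open Scope ereal_scope.
Context d (T : measurableType d) (R : realType).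

Lemma ge0_integral_density (nu : {finite_measure set T -> \bar R})
    (mu : {sigma_finite_measure set T -> \bar R}) (g : T -> R) :
  measurable_fun setT g -> (forall x, (0 <= g x)%R) ->
  (forall A, measurable A -> nu A = \int[mu]_(x in A) (g x)%:E) ->
  forall f : T -> \bar R, measurable_fun setT f -> (forall x, 0 <= f x) ->
  \int[nu]_x f x = \int[mu]_x (f x * (g x)%:E).
Proof.
move=> mg g0 nuE f mf f0.
have mgE : measurable_fun setT (EFin \o g) by exact/measurable_EFinP.
have numu : nu `<< mu.
  apply/null_content_dominatesP => A mA A0; rewrite nuE //.
  apply: null_set_integral => //; exact: measurable_funTS.
rewrite -(Radon_Nikodym_SigmaFinite.change_of_variables numu) //.
have mRN := measurable_int _ (Radon_Nikodym_SigmaFinite.f_integrable numu).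
apply: ae_eq_integral => //; [exact: emeasurable_funM|exact: emeasurable_funM|].
apply: ae_eqe_mul2l; apply: integral_ae_eq => //.
  exact: Radon_Nikodym_SigmaFinite.f_integrable.
by move=> A _ mA; rewrite -nuE //; exact/esym/Radon_Nikodym_SigmaFinite.f_integral.
Qed.

End density.

Section lebesgue_affine.
Context {R : realType}.
Local Notation leb := (@lebesgue_measure R).

(** Lebesgue measure is determined by its values on half-open intervals. *)
Lemma lebesgue_measure_invariant (f : R -> R) : measurable_fun setT f ->
  (forall a b, leb (f @^-1` `]a, b]) = leb (`]a, b] : set R)) ->
  forall A, measurable A -> leb (f @^-1` A) = leb A.
Proof.
move=> mf h A mA; symmetry.
pose mu' : {measure set (measurableTypeR R) -> \bar R} :=
  measure_function_pushforward__canonical__measure_function_Measure leb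
    (T2 := measurableTypeR R) (f := f) mf.
apply: (lebesgue_measure_unique (mu := mu')) mA.
by move=> _ [[a b] _ <-]; rewrite /mu' /= /pushforward h.
Qed.

Lemma ge0_integral_invariant (f : R -> R) (h : R -> \bar R) :
  measurable_fun setT f ->
  (forall a b, leb (f @^-1` `]a, b]) = leb (`]a, b] : set R)) ->
  measurable_fun setT h -> (forall x, 0 <= h x)%E ->
  (\int[leb]_x h (f x) = \int[leb]_x h x)%E.
Proof.
move=> mf fE mh h0.
apply: (@ge0_integral_law _ _ (measurableTypeR R) (measurableTypeR R) _ leb leb) => //.
exact: lebesgue_measure_invariant.
Qed.

Lemma lebesgue_measure_shift (v a b : R) :
  leb ((fun x : R => x + v) @^-1` `]a, b]) = leb (`]a, b] : set R).
Proof.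
have -> : (fun x => x + v) @^-1` `]a, b]%classic = `]a - v, b - v]%classic.
  by apply/seteqP; split=> x /=; rewrite !in_itv /= ltrBlDr lerBrDr.
rewrite !lebesgue_measure_itv /= !lte_fin ltrBlDr subrK; case: ifP => // _.
by rewrite -!EFinD; congr EFin; ring.
Qed.

Lemma lebesgue_measure_opp (a b : R) :
  leb ((fun x : R => - x) @^-1` `]a, b]) = leb (`]a, b] : set R).
Proof.
have -> : (fun x : R => - x) @^-1` `]a, b]%classic = `[- b, - a[%classic.
  by apply/seteqP; split=> x /=; rewrite !in_itv /= ltrNr lerNl andbC.
rewrite !lebesgue_measure_itv /= !lte_fin ltrN2; case: ifP => // _.
by rewrite -!EFinD; congr EFin; ring.
Qed.

End lebesgue_affine.

Section real_probability.
Context {R : realType}.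
Let idR : measurableTypeR R -> R := idfun.
HB.instance Definition _ :=
  @isMeasurableFun.Build _ _ _ _ idR (@measurable_id _ _ setT).

(** The distributions of the library live on measurableTypeR R, whose sigma-algebra
    is that of R under another structure; this transports them to R. *)
Definition real_prob (Q : probability (measurableTypeR R) R) : probability R R :=
  distribution Q idR.

Lemma integral_real_prob Q (f : R -> \bar R) : measurable_fun setT f ->
  (\int[real_prob Q]_x f x = \int[Q]_x f x)%E.
Proof.
by move=> mf; rewrite -(integral_law (P := Q) (phi := idR) _ _ mf).
Qed.

End real_probability.

Section normal_noise.
Context {R : realType}.
Variable s : R.
Hypothesis s0 : 0 < s.
Local Notation leb := (@lebesgue_measure R).
Local Notation N := (real_prob (normal_prob 0 s)).
Let sn0 : s != 0. Proof. by rewrite gt_eqF. Qed.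

Lemma ge0_integral_normal (f : R -> \bar R) : measurable_fun setT f ->
  (forall x, 0 <= f x)%E ->
  (\int[N]_x f x = \int[leb]_x (f x * (normal_pdf 0 s x)%:E))%E.
Proof.
move=> mf f0; rewrite integral_real_prob //; apply: ge0_integral_density => //.
- exact: measurable_normal_pdf.
- by move=> x; exact: normal_pdf_ge0.
Qed.

(** Cameron-Martin formula in dimension one: translating the variable multiplies
    the density by an explicit exponential. *)
Lemma ge0_integral_normal_shift v (f : R -> \bar R) : measurable_fun setT f ->
  (forall x, 0 <= f x)%E ->
  (\int[N]_x f (x + v)%R =
   \int[N]_x (f x * (expR (v * x / s ^+ 2 - v ^+ 2 / (s ^+ 2 *+ 2)))%:E))%E.
Proof.
move=> mf f0.
have mD : measurable_fun setT (fun x : R => x + v) by exact: measurable_funD.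
have mpdf := measurable_normal_pdf 0 s.
have mE : measurable_fun setT
    (fun x : R => expR (v * x / s ^+ 2 - v ^+ 2 / (s ^+ 2 *+ 2))).
  apply: measurableT_comp => //; apply: measurable_funB => //.
  by apply: measurable_funM => //; exact: measurable_funM.
rewrite !ge0_integral_normal //; last 3 first.
- by apply: emeasurable_funM => //; exact/measurable_EFinP.
- by move=> x; rewrite mule_ge0 // lee_fin expR_ge0.
- exact: measurableT_comp.
pose h x := (f x * (normal_pdf 0 s (x - v))%:E)%E.
transitivity (\int[leb]_x h (x + v)%R)%E.
  by apply: eq_integral => x _; rewrite /h addrK.
rewrite (ge0_integral_invariant mD); first last.
- by move=> x; rewrite mule_ge0 // lee_fin normal_pdf_ge0.
- apply: emeasurable_funM => //; apply/measurable_EFinP; apply: measurableT_comp => //.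
  exact: measurable_funB.
- by move=> a b; exact: lebesgue_measure_shift.
apply: eq_integral => x _; rewrite /h -muleA -EFinM; congr (_ * _%:E)%E.
rewrite !normal_pdfE // mulrCA -expRD; congr (_ * expR _).
by field; rewrite ?sn0.
Qed.

Lemma normal_symmetric (A : set R) : measurable A -> N ((fun x : R => - x) @^-1` A) = N A.
Proof.
move=> mA.
have mN : measurable_fun setT (fun x : R => - x) by exact: measurableT_comp.
have mpdf := measurable_normal_pdf 0 s.
have mNA : measurable ((fun x : R => - x) @^-1` A).
  by rewrite -[X in measurable X]setTI; exact: mN.
have NE (B : set R) : measurable B ->
    N B = (\int[leb]_x ((\1_B x)%:E * (normal_pdf 0 s x)%:E))%E.
  move=> mB; rewrite -ge0_integral_normal ?integral_indic ?setIT //.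
  exact/measurable_EFinP.
rewrite !NE //.
rewrite -[RHS](ge0_integral_invariant mN); first last.
- by move=> x; rewrite mule_ge0 // lee_fin normal_pdf_ge0.
- by apply: emeasurable_funM; exact/measurable_EFinP.
- by move=> a b; exact: lebesgue_measure_opp.
apply: eq_integral => x _; congr (_ * _%:E)%E.
by rewrite !normal_pdfE // /normal_fun !subr0 sqrrN.
Qed.

(** The exponential turns the density of scale s into twice that of scale 2 s. *)
Lemma integral_expR_sqr_normal :
  (\int[N]_x (expR (3 * x ^+ 2 / (8 * s ^+ 2)))%:E = 2%:E)%E.
Proof.
have mE : measurable_fun setT (fun x : R => expR (3 * x ^+ 2 / (8 * s ^+ 2))).
  by apply: measurableT_comp => //; apply: measurable_funM => //; exact: measurable_funM.
rewrite ge0_integral_normal; [|exact/measurable_EFinP|by move=> x; rewrite lee_fin expR_ge0].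
have s2 : 2 * s != 0 by rewrite mulf_neq0 // pnatr_eq0.
transitivity (\int[leb]_x (2%:E * (normal_pdf 0 (2 * s) x)%:E))%E.
  apply: eq_integral => x _; rewrite -!EFinM !normal_pdfE //; congr EFin.
  have -> : normal_peak s = 2 * normal_peak (2 * s).
    rewrite /normal_peak (_ : (2 * s) ^+ 2 * pi *+ 2 = 2 ^+ 2 * (s ^+ 2 * pi *+ 2)); last by ring.
    rewrite sqrtrM ?sqr_ge0 // sqrtr_sqr ger0_norm // invfM mulVKf //.
  have <- : expR (3 * x ^+ 2 / (8 * s ^+ 2)) * normal_fun 0 s x = normal_fun 0 (2 * s) x.
    by rewrite -expRD; congr expR; rewrite !subr0; field.
  by ring.
rewrite ge0_integralZl ?integral_normal_pdf ?mule1 //.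
- by apply/measurable_EFinP; exact: measurable_normal_pdf.
- by move=> x _; rewrite lee_fin normal_pdf_ge0.
Qed.

(** As u <= exp u, the exponential moment also controls the variance. *)
Lemma integral_sqr_normal_le :
  (\int[N]_x (x ^+ 2)%:E <= (6 * s ^+ 2)%:E)%E.
Proof.
have s2 : 0 < s ^+ 2 by rewrite exprn_gt0.
apply: (@le_trans _ _ (\int[N]_x ((3 * s ^+ 2)%:E * (expR (3 * x ^+ 2 / (8 * s ^+ 2)))%:E))%E).
  apply: ge0_le_integral => //.
  - by move=> x _; rewrite lee_fin sqr_ge0.
  - exact/measurable_EFinP.
  - apply/measurable_EFinP; apply: measurable_funM => //.
    by apply: measurableT_comp => //; apply: measurable_funM => //; exact: measurable_funM.
  - move=> x _; rewrite -EFinM lee_fin.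
    have h := expR_ge1Dx (3 * x ^+ 2 / (8 * s ^+ 2)).
    apply: (@le_trans _ _ (3 * s ^+ 2 * (3 * x ^+ 2 / (8 * s ^+ 2)))).
      have -> : 3 * s ^+ 2 * (3 * x ^+ 2 / (8 * s ^+ 2)) = 9 / 8 * x ^+ 2 by field.
      by rewrite ler_peMl ?sqr_ge0 //; lra.
    by rewrite ler_pM2l ?mulr_gt0 //; lra.
rewrite ge0_integralZl //.
- rewrite integral_expR_sqr_normal -EFinM lee_fin; lra.
- apply/measurable_EFinP; apply: measurableT_comp => //; apply: measurable_funM => //.
  exact: measurable_funM.
- by rewrite lee_fin mulr_ge0 // ltW.
Qed.

End normal_noise.

(** * Expectations of real functions and privacy *)

Notation rint P f := (integrable P setT (EFin \o f)).

Section real_integrable.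
Context d (T : measurableType d) (R : realType) (P : {measure set T -> \bar R}).
Implicit Types f g : T -> R.

Lemma rintP f : rint P f <->
  measurable_fun setT f /\ (\int[P]_x `|f x|%:E < +oo)%E.
Proof.
split=> [/integrableP[/measurable_EFinP mf fi]|[mf fi]]; first by split.
by apply/integrableP; split => //; exact/measurable_EFinP.
Qed.

Lemma rint_meas f : rint P f -> measurable_fun setT f.
Proof. by move=> /rintP[]. Qed.

Lemma rint_le f g : measurable_fun setT f -> rint P g ->
  (forall x, `|f x| <= g x) -> rint P f.
Proof.
move=> mf ig fg; apply: (le_integrable measurableT (g := EFin \o g)) => //.
  exact/measurable_EFinP.
by move=> x _ /=; rewrite lee_fin (le_trans (fg x)) // ler_norm.
Qed.

Lemma rintZ k f : rint P f -> rint P (fun x => k * f x).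
Proof. by move=> fi; exact: (integrableZl measurableT k fi). Qed.

Lemma rintD f g : rint P f -> rint P g -> rint P (fun x => f x + g x).
Proof. by move=> fi gi; exact: (integrableD measurableT fi gi). Qed.

Lemma rintB f g : rint P f -> rint P g -> rint P (fun x => f x - g x).
Proof. by move=> fi gi; exact: (integrableB measurableT fi gi). Qed.

Lemma rint_norm f : rint P f -> rint P (fun x => `|f x|).
Proof.
move=> fi; apply: rint_le (integrable_abse fi) _.
  exact/measurableT_comp/rint_meas.
by move=> x; rewrite normr_id.
Qed.

Lemma rint_sum I (r : seq I) (Q : pred I) (f : I -> T -> R) :
  (forall i, Q i -> rint P (f i)) -> rint P (fun x => \sum_(i <- r | Q i) f i x).
Proof.
move=> fi; elim: r => [|i r IH].
  under [X in rint P X]eq_fun do rewrite big_nil.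
  exact: integrable0.
under [X in rint P X]eq_fun do rewrite big_cons.
have [Qi|//] := boolP (Q i); apply: rintD => //; exact: fi.
Qed.

Lemma Rintegral_sum I (r : seq I) (Q : pred I) (f : I -> T -> R) :
  (forall i, Q i -> rint P (f i)) ->
  \int[P]_x (\sum_(i <- r | Q i) f i x) = \sum_(i <- r | Q i) \int[P]_x f i x.
Proof.
move=> fi; elim: r => [|i r IH].
  under eq_Rintegral do rewrite big_nil.
  by rewrite big_nil Rintegral_cst // mul0r.
under eq_Rintegral do rewrite big_cons.
rewrite big_cons; have [Qi|//] := boolP (Q i).
by rewrite RintegralD ?IH //; [exact: fi|exact: rint_sum].
Qed.

Lemma fineK_Rintegral f : rint P f ->
  ((\int[P]_x f x)%:E = \int[P]_x (f x)%:E)%E.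
Proof. by move=> fi; rewrite /Rintegral fineK //; exact: integrable_fin_num. Qed.

End real_integrable.

Section bounded_expectation.
Context d (T : measurableType d) (R : realType) (P : probability T R).

Lemma integrable_bounded (f : T -> R) (B : R) : measurable_fun setT f ->
  (forall x, `|f x| <= B) -> rint P f.
Proof.
move=> mf fB; apply: (le_integrable measurableT (g := EFin \o cst B)).
- exact/measurable_EFinP.
- by move=> x _ /=; rewrite lee_fin (le_trans (fB x)) // ler_norm.
- exact: finite_measure_integrable_cst.
Qed.

Lemma Rintegral_prob_cst (c : R) : \int[P]_x c = c.
Proof.
rewrite Rintegral_cst //; transitivity (c * fine 1%E); last by rewrite mulr1.
by congr (_ * fine _); exact: probability_setT.
Qed.

Lemma integral_prob_cst (c : R) : (\int[P]_x c%:E = c%:E)%E.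
Proof.
rewrite integral_cst //; transitivity (c%:E * 1)%E; last by rewrite mule1.
by congr (_ * _)%E; exact: probability_setT.
Qed.

Lemma Rintegral_norm_le (f : T -> R) (B : R) : measurable_fun setT f ->
  (forall x, `|f x| <= B) -> `|\int[P]_x f x| <= B.
Proof.
move=> mf fB; apply: (le_trans (le_normr_Rintegral _ _)) => //.
  exact: integrable_bounded fB.
rewrite -[leRHS](Rintegral_prob_cst B); apply: le_Rintegral => //.
  by apply: (integrable_bounded (B := B)); [exact: measurableT_comp|move=> x; rewrite normr_id].
by apply: (integrable_bounded (B := `|B|)).
Qed.

End bounded_expectation.
Arguments integrable_bounded {d T R P f B}.

(** Adding the bound B makes the integrand nonnegative, which reduces the claim to
    the Tonelli theorem. *)
Lemma measurable_Rintegral_param d d' (W : measurableType d) (Z : measurableType d')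
    (R : realType) (P : probability Z R) (f : W * Z -> R) (B : R) :
  measurable_fun setT f -> (forall wz, `|f wz| <= B) ->
  measurable_fun setT (fun w => \int[P]_z f (w, z)).
Proof.
move=> mf fB.
have mfw w : measurable_fun setT (fun z => f (w, z)).
  exact: (measurableT_comp mf (pair1_measurable w)).
rewrite (_ : (fun w => _) = (fun w => fine (\int[P]_z (f (w, z) + B)%:E)%E - B)).
  apply: measurable_funB => //; apply: measurableT_comp => //.
  apply: (measurable_fun_fubini_tonelli_F (fun wz => (f wz + B)%:E)).
    by apply/measurable_EFinP; exact: measurable_funD.
  by move=> wz; rewrite lee_fin; have := fB wz; rewrite ler_norml => /andP[]; rewrite lerNl; lra.
apply/funext => w; rewrite -[fine _]/(\int[P]_z (f (w, z) + B)).
rewrite RintegralD //; last 2 first.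
- exact: integrable_bounded (mfw w) (fun z => fB (w, z)).
- exact: (integrable_bounded (B := `|B|)).
by rewrite Rintegral_prob_cst addrK.
Qed.

Section differential_privacy.
Context d (Z : measurableType d) (R : realType).
Local Notation leb := (@lebesgue_measure R).

Let integral_indic_itv (b : bool) (r : R) : 0 <= r ->
  (\int[leb]_t (\1_([set` Interval (BLeft 0%R) (BSide b r)] : set (measurableTypeR R)) t)%:E
    = r%:E)%E.
Proof.
move=> r0.
transitivity (leb ([set` Interval (BLeft 0%R) (BSide b r)] : set R)).
  by rewrite integral_indic // setIT.
rewrite lebesgue_measure_itv /= lte_fin oppr0 adde0.
by move: r0; rewrite le_eqVlt => /predU1P[<-|->//]; rewrite ltxx.
Qed.

(** Layer cake formula: the privacy inequality applies to each level set of f, and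
    the levels above B are empty, whence the factor B of delta. *)
Lemma dp_ge0_integral (q1 q2 : probability Z R) (c delta B : R) (f : Z -> R) :
  0 <= c -> 0 <= delta -> 0 <= B ->
  (forall A, measurable A -> (q1 A <= c%:E * q2 A + delta%:E)%E) ->
  measurable_fun setT f -> (forall z, 0 <= f z <= B) ->
  (\int[q1]_z (f z)%:E <= c%:E * \int[q2]_z (f z)%:E + (delta * B)%:E)%E.
Proof.
move=> c0 d0 B0 q12 mf fB.
pose S := [set zt : Z * measurableTypeR R | 0 <= zt.2 < f zt.1].
have mS : measurable S.
  have -> : S = [set zt | (0 <= zt.2) && (zt.2 < f zt.1)] by [].
  rewrite -[X in measurable X]setTI.
  apply: (@measurable_and _ _ setT (fun zt : Z * measurableTypeR R => 0 <= zt.2)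
    (fun zt => zt.2 < f zt.1)) => //.
  - by apply: measurable_fun_ler => //; exact: measurable_snd.
  - apply: measurable_fun_ltr; first exact: measurable_snd.
    exact: (measurableT_comp mf measurable_fst).
pose F (zt : Z * measurableTypeR R) := (\1_S zt)%:E : \bar R.
have mF : measurable_fun setT F by exact/measurable_EFinP/measurable_indic.
have F0 zt : (0 <= F zt)%E by rewrite lee_fin.
pose St (t : measurableTypeR R) : set Z := [set z | (0 <= t < f z)%R].
have FE z t : F (z, t) = (\1_(St t) z)%:E by [].
have mSt t : measurable (St t).
  have -> : St t = ysection S t by apply/seteqP; split=> z; rewrite ysectionP.
  exact: measurable_ysection.
have G (q : probability Z R) t : (\int[q]_z F (z, t) = q (St t))%E.
  transitivity (\int[q]_z (\1_(St t) z)%:E)%E; first exact: eq_integral.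
  by rewrite integral_indic // setIT.
have mq (q : probability Z R) : measurable_fun setT (fun t => q (St t)).
  rewrite (_ : (fun t => _) = (fun t => \int[q]_z F (z, t))%E).
    exact: measurable_fun_fubini_tonelli_G.
  by apply/funext => t; rewrite G.
have layer (q : probability Z R) :
    (\int[q]_z (f z)%:E = \int[leb]_t q (St t))%E.
  under [RHS]eq_integral do rewrite -G.
  rewrite -fubini_tonelli //; apply: eq_integral => z _.
  transitivity (\int[leb]_t (\1_(`[0, f z[%classic : set (measurableTypeR R)) t)%:E)%E; last first.
    by apply: eq_integral => t _; rewrite FE !indicE; congr ((_ : bool)%:R%:E).
  by rewrite integral_indic_itv //; have /andP[] := fB z.
have mI : measurable (`[0, B]%classic : set (measurableTypeR R)) by [].
rewrite !layer.
apply: (@le_trans _ _ (\int[leb]_t (c%:E * q2 (St t) + delta%:E * (\1_(`[0, B]%classic : set (measurableTypeR R)) t)%:E))%E).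
  apply: ge0_le_integral => //.
  - apply: emeasurable_funD; first by apply: emeasurable_funM => //; exact: mq.
    by apply: emeasurable_funM => //; exact/measurable_EFinP/measurable_indic.
  - move=> t _; have [tB|tB] := boolP (t \in (`[0, B]%classic : set (measurableTypeR R))).
      rewrite indicE tB mule1; exact: q12.
    rewrite [St t](_ : _ = set0) ?measure0.
      by rewrite mule0 add0e mule_ge0 // lee_fin.
    apply/seteqP; split=> z //= /andP[t0 tf]; move/negP: tB; apply.
    by rewrite inE /= in_itv /= t0 /= (le_trans (ltW tf)) //; have /andP[] := fB z.
rewrite ge0_integralD //.
- rewrite ge0_integralZl // ge0_integralZl ?integral_indic_itv //.
  exact/measurable_EFinP/measurable_indic.
- by move=> t _; rewrite mule_ge0 // lee_fin.
- by apply: emeasurable_funM => //; exact: mq.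
- by move=> t _; rewrite mule_ge0 // lee_fin.
- by apply: emeasurable_funM => //; exact/measurable_EFinP/measurable_indic.
Qed.

(** The positive part of f is compared in one direction and the negative part in
    the other, so privacy is needed both ways; the multiplicative error then
    only weighs the mean of the absolute value of f. *)
Lemma dp_Rintegral (q1 q2 : probability Z R) (c delta B : R) (f : Z -> R) :
  1 <= c -> 0 <= delta -> 0 <= B ->
  (forall A, measurable A -> (q1 A <= c%:E * q2 A + delta%:E)%E) ->
  (forall A, measurable A -> (q2 A <= c%:E * q1 A + delta%:E)%E) ->
  measurable_fun setT f -> (forall z, `|f z| <= B) ->
  \int[q1]_z f z <=
    \int[q2]_z f z + (c - 1) * \int[q2]_z `|f z| + 2 * (delta * B).
Proof.
move=> c1 d0 B0 q12 q21 mf fB; have c0 : 0 <= c by apply: le_trans c1.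
pose fp z : R := Num.max (f z) 0; pose fn z : R := Num.max (- f z) 0.
have mfp : measurable_fun setT fp by exact: measurable_maxr.
have mfn : measurable_fun setT fn.
  by apply: measurable_maxr => //; exact: measurableT_comp.
have fpB z : 0 <= fp z <= B.
  by have := fB z; rewrite /fp ler_norml => /andP[_ h]; rewrite le_max lexx orbT ge_max h.
have fnB z : 0 <= fn z <= B.
  by have := fB z; rewrite /fn ler_norml lerNl => /andP[h _];
    rewrite le_max lexx orbT ge_max h.
have fE z : f z = fp z - fn z by rewrite /fp /fn; case: (leP (f z) 0); case: (leP (- f z) 0) => *; lra.
have nfE z : `|f z| = fp z + fn z.
  rewrite /fp /fn; case: (leP (f z) 0) => h; [rewrite ler0_norm //|rewrite gtr0_norm //];
  by case: (leP (- f z) 0) => *; lra.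
have ip (q : probability Z R) : rint q fp.
  by apply: (integrable_bounded (B := B)) => // z; have /andP[? ?] := fpB z; rewrite ger0_norm.
have iN (q : probability Z R) : rint q fn.
  by apply: (integrable_bounded (B := B)) => // z; have /andP[? ?] := fnB z; rewrite ger0_norm.
have dp (g : Z -> R) (qa qb : probability Z R) : measurable_fun setT g ->
    (forall z, 0 <= g z <= B) -> rint qa g -> rint qb g ->
    (forall A, measurable A -> (qa A <= c%:E * qb A + delta%:E)%E) ->
    \int[qa]_z g z <= c * \int[qb]_z g z + delta * B.
  move=> mg gB iga igb qab; rewrite -lee_fin EFinD EFinM !fineK_Rintegral //.
  exact: dp_ge0_integral.
under eq_Rintegral do rewrite fE.
under [X in _ <= X + _ + _]eq_Rintegral do rewrite fE.
under [X in _ <= _ + _ * X + _]eq_Rintegral do rewrite nfE.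
have EB (q : probability Z R) : \int[q]_z (fp z - fn z) = \int[q]_z fp z - \int[q]_z fn z.
  exact: (RintegralB measurableT (ip q) (iN q)).
have ED : \int[q2]_z (fp z + fn z) = \int[q2]_z fp z + \int[q2]_z fn z.
  exact: (RintegralD measurableT (ip q2) (iN q2)).
rewrite !EB ED.
have h1 := dp _ _ _ mfp fpB (ip q1) (ip q2) q12.
have h2 := dp _ _ _ mfn fnB (iN q2) (iN q1) q21.
have p2 : 0 <= \int[q2]_z fn z by apply: Rintegral_ge0 => z _; have /andP[] := fnB z.
have dB : 0 <= delta * B by exact: mulr_ge0.
set x := \int[q1]_z fn z in h2 *; set y := \int[q2]_z fn z in h2 p2 *.
set u := \int[q1]_z fp z in h1 *; set v := \int[q2]_z fp z in h1 *.
have : 0 <= x - (2 - c) * y + delta * B.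
  rewrite -(pmulr_rge0 _ (lt_le_trans ltr01 c1)).
  have : 0 <= y * (c - 1) ^+ 2 + (c - 1) * (delta * B).
    by rewrite addr_ge0 // mulr_ge0 ?sqr_ge0 // subr_ge0.
  by move=> h; apply: (le_trans h); nra.
by nra.
Qed.

End differential_privacy.

Section kernel_probability.
Context d d' (X : measurableType d) (Z : measurableType d') (R : realType).
Variables (Q : R.-pker X ~> Z) (x : X).

(** One value of a probability kernel, as a probability measure in its own right. *)
Definition kprob : set Z -> \bar R := fun A => Q x A.

Let kprob0 : kprob set0 = 0%E. Proof. exact: measure0. Qed.
Let kprob_ge0 A : (0 <= kprob A)%E. Proof. exact: measure_ge0. Qed.
Let kprob_sigma_additive : semi_sigma_additive kprob.
Proof. exact: measure_semi_sigma_additive. Qed.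
HB.instance Definition _ :=
  isMeasure.Build _ _ _ kprob kprob0 kprob_ge0 kprob_sigma_additive.

Let kprobT : kprob setT = 1%E. Proof. exact: prob_kernel. Qed.
HB.instance Definition _ := Measure_isProbability.Build _ _ _ kprob kprobT.

End kernel_probability.

Section kernel_expectation.
Context d d' (X : measurableType d) (Z : measurableType d') (R : realType).
Variable Q : R.-pker X ~> Z.
Context d0 (W : measurableType d0) (phi : W -> X).
Hypothesis mphi : measurable_fun setT phi.

(** Pulling the kernel back along phi makes the theorems on integrals of kernels
    available; the proof of measurability of phi is an argument so that the
    instances below can be found. *)
Definition kpull := let _ := mphi in fun w => (Q (phi w) : {measure set Z -> \bar R}).

Let measurable_kpull U : measurable U -> measurable_fun setT (kpull ^~ U).
Proof. by move=> mU; apply: (measurableT_comp (measurable_kernel Q U mU)). Qed.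

HB.instance Definition _ := isKernel.Build _ _ _ _ _ kpull measurable_kpull.

Let prob_kpull w : kpull w setT = 1%E.
Proof. exact: prob_kernel. Qed.

HB.instance Definition _ := Kernel_isProbability.Build _ _ _ _ _ kpull prob_kpull.

Lemma measurable_kernel_integral (f : W -> Z -> \bar R) :
  measurable_fun setT (fun wz : W * Z => f wz.1 wz.2) ->
  (forall w z, 0 <= f w z)%E ->
  measurable_fun setT (fun w => \int[kprob Q (phi w)]_z f w z)%E.
Proof.
move=> mf f0.
exact: (measurable_fun_integral_finite_kernel (fun wz => f wz.1 wz.2) kpull).
Qed.

Lemma measurable_kernel_Rintegral (f : W -> Z -> R) (B : R) :
  measurable_fun setT (fun wz : W * Z => f wz.1 wz.2) ->
  (forall w z, `|f w z| <= B) ->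
  measurable_fun setT (fun w => \int[kprob Q (phi w)]_z f w z).
Proof.
move=> mf fB.
have mfw w : measurable_fun setT (f w).
  exact: (measurableT_comp mf (pair1_measurable w)).
rewrite (_ : (fun w => _) = (fun w => fine (\int[kprob Q (phi w)]_z (f w z + B)%:E)%E - B)).
  apply: measurable_funB => //; apply: measurableT_comp => //.
  apply: measurable_kernel_integral.
    by apply/measurable_EFinP; exact: measurable_funD.
  by move=> w z; rewrite lee_fin; have := fB w z; rewrite ler_norml => /andP[]; rewrite lerNl; lra.
apply/funext => w; rewrite -[fine _]/(\int[kprob Q (phi w)]_z (f w z + B)).
rewrite RintegralD //; last 2 first.
- exact: integrable_bounded (mfw w) (fB w).
- exact: (integrable_bounded (B := `|B|)).
by rewrite Rintegral_prob_cst addrK.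
Qed.

End kernel_expectation.

(** * The Fourier basis and Sobolev classes *)

Section uniform_law.
Context {R : realType}.
Local Notation leb := (@lebesgue_measure R).
Variables (a b : R).
Hypothesis ab : a < b.

Definition unif : probability R R := real_prob (uniform_prob ab).

Lemma integral_unif_ge0 (f : R -> \bar R) : measurable_fun setT f ->
  (forall x, 0 <= f x)%E ->
  (\int[unif]_x f x = (b - a)^-1%:E * \int[leb]_(x in `[a, b]) f x)%E.
Proof. by move=> mf f0; rewrite integral_real_prob // integral_uniform. Qed.

Lemma integral_unif (f : R -> \bar R) : measurable_fun setT f ->
  leb.-integrable `[a, b] f ->
  (\int[unif]_x f x = (b - a)^-1%:E * \int[leb]_(x in `[a, b]) f x)%E.
Proof.
move=> mf fi; rewrite integralE [in RHS]integralE.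
rewrite !integral_unif_ge0 //; [|exact: measurable_funeneg|exact: measurable_funepos].
rewrite [RHS]muleBr //; exact: (integrable_add_def _ fi).
Qed.

End uniform_law.

Section ftc.
Context {R : realType}.
Local Notation leb := (@lebesgue_measure R).

(** The second fundamental theorem of calculus for a primitive given on the whole
    line, where the conditions at the end points are automatic. *)
Lemma integral_derive (a b : R) (F f : R -> R) : a < b ->
  (forall x : R, is_derive x 1 F (f x)) -> continuous f ->
  (\int[leb]_(x in `[a, b]) (f x)%:E = (F b - F a)%:E)%E.
Proof.
move=> ab dF cf.
have cF : continuous F.
  move=> x; apply: differentiable_continuous; apply/derivable1_diffP.
  exact: (@ex_derive _ _ _ _ _ _ _ (dF x)).
rewrite (continuous_FTC2 (F := F)) //.
- exact: continuous_subspaceT.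
- split; first by move=> x _; exact: (@ex_derive _ _ _ _ _ _ _ (dF x)).
  + exact/cvg_at_right_filter/cF.
  + exact/cvg_at_left_filter/cF.
- by move=> x _; rewrite derive1E; exact: (@derive_val _ _ _ _ _ _ _ (dF x)).
Qed.

Lemma is_derive_lin (w x : R) : is_derive x 1 (fun t : R => w * t) w.
Proof.
have := is_deriveZ (w : R) (is_derive_id x (1 : R)).
by rewrite /GRing.scale /= mulr1.
Qed.

Lemma integral_sin_cos (k : int) : k != 0 ->
  (\int[leb]_(x in `[0%R, 1%R]) (cos (k%:~R * (pi *+ 2) * x))%:E = 0)%E /\
  (\int[leb]_(x in `[0%R, 1%R]) (sin (k%:~R * (pi *+ 2) * x))%:E = 0)%E.
Proof.
move=> k0; set w : R := k%:~R * (pi *+ 2).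
have w0 : w != 0.
  by rewrite mulf_neq0 ?intr_eq0 // mulrn_eq0 /= gt_eqF ?pi_gt0.
have per (f : R -> R) : periodic f (pi *+ 2) -> f w = f 0.
  move=> pf; have pn := periodicn pf.
  rewrite /w; case: (k) => n.
    by rewrite -(pn n 0) add0r; congr f; rewrite /= mulr_natl.
  rewrite -(pn n.+1); congr f; rewrite NegzE mulrNz mulNr.
  by rewrite -[n.+1%:~R]/(n.+1%:R) mulr_natl addNr.
have [S C] : sin w = 0 /\ cos w = 1.
  by rewrite (per sin) ?(per cos) ?sin0 ?cos0 //; [exact: cosD2pi|exact: sinD2pi].
have cl : continuous (fun x : R => w * x) by apply: mulrl_continuous.
have dS (x : R) : is_derive x 1 (fun x => w^-1 * sin (w * x)) (cos (w * x)).
  have := is_derive1_comp (is_derive_sin (w * x)) (is_derive_lin w x).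
  by move=> /(is_deriveZ w^-1); rewrite /GRing.scale /= mulrCA mulVf // mulr1.
have dC (x : R) : is_derive x 1 (fun x => - w^-1 * cos (w * x)) (sin (w * x)).
  have := is_derive1_comp (is_derive_cos (w * x)) (is_derive_lin w x).
  move=> /(is_deriveZ (- w^-1)); rewrite /GRing.scale /=.
  by rewrite (_ : - w^-1 * (- sin (w * x) * w) = sin (w * x)) //; field.
split.
- rewrite (integral_derive ltr01 dS).
    by rewrite mulr1 mulr0 S sin0 subrr.
  by move=> x; apply: continuous_comp; [exact: cl|exact: continuous_cos].
- rewrite (integral_derive ltr01 dC).
    by rewrite mulr1 mulr0 C cos0 subrr.
  by move=> x; apply: continuous_comp; [exact: cl|exact: continuous_sin].
Qed.

End ftc.

Section fourier_basis.
Context {R : realType}.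
Local Notation leb := (@lebesgue_measure R).
Local Notation U01 := (@unif R 0 1 ltr01).
Implicit Types (l : nat) (t : R).

Lemma fourierE l (t : R) : (1 < l)%N ->
  fourier l t = Num.sqrt 2 * (if odd l then sin ((l./2)%:Z%:~R * (pi *+ 2) * t)
                                       else cos ((l./2)%:Z%:~R * (pi *+ 2) * t)).
Proof.
move=> l1; rewrite /fourier gtn_eqF // -[(l./2)%:Z%:~R]/((l./2)%:R).
have -> : (l./2).*2%:R * pi * t = (l./2)%:R * (pi *+ 2) * t.
  by rewrite -muln2 natrM; ring.
by case: ifP.
Qed.

Lemma continuous_fourier l : continuous (fourier l : R -> R).
Proof.
have [->|[->|l1]] : l = 0%N \/ l = 1%N \/ (1 < l)%N.
  by case: l => [|[|l]]; [left|right; left|right; right].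
- move=> x; rewrite /fourier /=; apply: cvgM; first exact: cvg_cst.
  apply: continuous_comp; last exact: continuous_cos.
  exact: mulrl_continuous.
- by move=> x; apply: cvg_cst.
- move=> x.
  rewrite (_ : fourier l = fun t => Num.sqrt 2 * (if odd l then sin ((l./2)%:Z%:~R * (pi *+ 2) * t)
                                       else cos ((l./2)%:Z%:~R * (pi *+ 2) * t))); last first.
    by apply/funext => t; rewrite fourierE.
  apply: cvgM; first exact: cvg_cst.
  case: (odd l); apply: continuous_comp; [exact: mulrl_continuous|exact: continuous_sin|
    exact: mulrl_continuous|exact: continuous_cos].
Qed.

Lemma fourier_le l (t : R) : `|fourier l t| <= 2.
Proof.
have s2 : Num.sqrt 2 <= 2 :> R.
  by rewrite -{2}(ger0_norm (ler0n R 2)) -sqrtr_sqr ler_wsqrtr //; lra.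
rewrite /fourier; case: ifP => _; first by rewrite normr1; lra.
have s0 := sqrtr_ge0 (2 : R).
by case: ifP => _; rewrite normrM (ger0_norm s0) -[leRHS]mulr1 ler_pM //
  ler_norml ?sin_geN1 ?sin_le1 ?cos_geN1 ?cos_le1.
Qed.

Lemma measurable_fourier l : measurable_fun setT (fourier l : R -> R).
Proof. exact: (@continuous_measurable_fun R (fourier l) (@continuous_fourier l)). Qed.

Lemma Rintegral01_cst (c : R) : \int[leb]_(x in `[0, 1]) c = c.
Proof.
have leb01 : leb (`[0, 1]%classic : set R) = 1%E.
  by rewrite lebesgue_measure_itv /= lte01 oppr0 adde0.
rewrite Rintegral_cst //; transitivity (c * fine 1%E); last by rewrite mulr1.
by congr (_ * fine _); exact: leb01.
Qed.

Lemma integral_trig (k : int) :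
  \int[leb]_(x in `[0, 1]) (cos (k%:~R * (pi *+ 2) * x)) = (k == 0)%:R /\
  \int[leb]_(x in `[0, 1]) (sin (k%:~R * (pi *+ 2) * x)) = 0.
Proof.
have [->|k0] := eqVneq k 0; last first.
  by have [c s] := integral_sin_cos (R := R) k0; rewrite /Rintegral c s.
split.
  under eq_Rintegral do rewrite !mul0r cos0.
  by rewrite Rintegral01_cst.
under eq_Rintegral do rewrite !mul0r sin0.
by rewrite Rintegral01_cst.
Qed.

Lemma integrable01 (f : R -> R) : continuous f ->
  leb.-integrable `[0, 1] (EFin \o f).
Proof.
move=> cf; apply: continuous_compact_integrable; first exact: segment_compact.
exact: continuous_subspaceT.
Qed.

Let cosz (k : int) x : R := cos (k%:~R * (pi *+ 2) * x).
Let sinz (k : int) x : R := sin (k%:~R * (pi *+ 2) * x).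

Let i_cosz k : leb.-integrable `[0, 1] (EFin \o cosz k).
Proof.
apply: integrable01 => x; apply: continuous_comp; last exact: continuous_cos.
exact: mulrl_continuous.
Qed.

Let i_sinz k : leb.-integrable `[0, 1] (EFin \o sinz k).
Proof.
apply: integrable01 => x; apply: continuous_comp; last exact: continuous_sin.
exact: mulrl_continuous.
Qed.

Let sqrt2 : Num.sqrt 2 * Num.sqrt 2 = 2 :> R.
Proof. by rewrite -expr2 sqr_sqrtr. Qed.

Let half_trig l : (1 < l)%N ->
  \int[leb]_(x in `[0, 1]) fourier l x = 0.
Proof.
move=> l1.
have k0 : (l./2)%:Z != 0 by rewrite eqz_nat -lt0n half_gt0.
under eq_Rintegral do rewrite fourierE //.
have [c s] := integral_trig (l./2)%:Z.
by case: (odd l); rewrite RintegralZl ?s ?c ?(negbTE k0) ?mulr0 //; [exact: i_sinz|exact: i_cosz].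
Qed.

Let two_trig l l' : (1 < l)%N -> (1 < l')%N ->
  \int[leb]_(x in `[0, 1]) (fourier l x * fourier l' x) = (l == l')%:R.
Proof.
move=> l1 l1'; set k := (l./2)%:Z; set k' := (l'./2)%:Z.
have lE : (l == l') = (odd l == odd l') && (k - k' == 0).
  rewrite subr_eq0 eqz_nat; apply/eqP/andP => [->//|[/eqP o /eqP h]].
  by rewrite -(odd_double_half l) -(odd_double_half l') o h.
have kk : (k + k' == 0) = false.
  by rewrite -PoszD eqz_nat addn_eq0; apply/negbTE; rewrite negb_and -!lt0n half_gt0 l1.
have [c1 s1] := integral_trig (k - k'); have [c2 s2] := integral_trig (k + k').
have D (x : R) : (k - k')%:~R * (pi *+ 2) * x = k%:~R * (pi *+ 2) * x - k'%:~R * (pi *+ 2) * x.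
  by rewrite rmorphB /= !mulrBl.
have A (x : R) : (k + k')%:~R * (pi *+ 2) * x = k%:~R * (pi *+ 2) * x + k'%:~R * (pi *+ 2) * x.
  by rewrite rmorphD /= !mulrDl.
rewrite kk in c2.
rewrite lE; case ol : (odd l); case ol' : (odd l') => /=.
- transitivity (\int[leb]_(x in `[0, 1]) (cosz (k - k') x - cosz (k + k') x)).
    apply: eq_Rintegral => x _; rewrite !fourierE // ol ol' /cosz D A cosB cosD.
    by rewrite mulrACA sqrt2 -/k -/k'; ring.
  by rewrite RintegralB // c1 c2 subr0.
- transitivity (\int[leb]_(x in `[0, 1]) (sinz (k - k') x + sinz (k + k') x)).
    apply: eq_Rintegral => x _; rewrite !fourierE // ol ol' /sinz D A sinB sinD.
    by rewrite mulrACA sqrt2 -/k -/k'; ring.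
  by rewrite RintegralD // s1 s2 addr0.
- transitivity (\int[leb]_(x in `[0, 1]) (sinz (k + k') x - sinz (k - k') x)).
    apply: eq_Rintegral => x _; rewrite !fourierE // ol ol' /sinz D A sinB sinD.
    by rewrite mulrACA sqrt2 -/k -/k'; ring.
  by rewrite RintegralB // s1 s2 subr0.
- transitivity (\int[leb]_(x in `[0, 1]) (cosz (k - k') x + cosz (k + k') x)).
    apply: eq_Rintegral => x _; rewrite !fourierE // ol ol' /cosz D A cosB cosD.
    by rewrite mulrACA sqrt2 -/k -/k'; ring.
  by rewrite RintegralD // c1 c2 addr0.
Qed.

(** Product-to-sum formulas reduce the products to trigonometric functions of
    nonzero integer frequency, whose integrals over a period vanish. *)
Lemma fourier_orthonormal l l' : (0 < l)%N -> (0 < l')%N ->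
  \int[leb]_(x in `[0, 1]) (fourier l x * fourier l' x) = (l == l')%:R.
Proof.
case: l => [//|[|l]] _; case: l' => [//|[|l']] _.
- under eq_Rintegral do rewrite mulr1.
  by rewrite Rintegral01_cst.
- by under eq_Rintegral do rewrite mul1r; rewrite half_trig.
- by under eq_Rintegral do rewrite mulr1; rewrite half_trig.
- exact: two_trig.
Qed.

Lemma unif01E (f : R -> R) : measurable_fun setT f ->
  leb.-integrable `[0, 1] (EFin \o f) ->
  \int[U01]_x f x = \int[leb]_(x in `[0, 1]) f x.
Proof.
move=> mf fi; rewrite /Rintegral integral_unif //; last exact/measurable_EFinP.
by rewrite subr0 invr1 mul1e.
Qed.

Lemma unif01_fourier l l' : \int[U01]_x (fourier l.+1 x * fourier l'.+1 x) = (l == l')%:R.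
Proof.
rewrite unif01E ?fourier_orthonormal //.
  by apply: measurable_funM; exact: measurable_fourier.
by apply: integrable01 => x; apply: cvgM; exact: continuous_fourier.
Qed.

End fourier_basis.

Section trigonometric_polynomials.
Context {R : realType}.
Local Notation leb := (@lebesgue_measure R).
Local Notation U01 := (@unif R 0 1 ltr01).

Definition trig K (th : 'I_K -> R) (x : R) : R :=
  \sum_(l < K) th l * fourier l.+1 x.

Lemma continuous_trig K (th : 'I_K -> R) : continuous (trig th).
Proof.
rewrite /trig; elim: (index_enum _) => [|l s IH] x.
  rewrite (_ : (fun x => _) = fun=> 0); first exact: cvg_cst.
  by apply/funext => y; rewrite big_nil.
rewrite (_ : (fun x => _) =
    fun x => th l * fourier l.+1 x + \sum_(l <- s) th l * fourier l.+1 x).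
  by apply: cvgD; [apply: cvgM; [exact: cvg_cst|exact: continuous_fourier]|exact: IH].
by apply/funext => y; rewrite big_cons.
Qed.

Lemma measurable_trig K (th : 'I_K -> R) : measurable_fun setT (trig th).
Proof. exact: (@continuous_measurable_fun R (trig th) (@continuous_trig K th)). Qed.

Lemma trig_le K (th : 'I_K -> R) (a x : R) : (forall l, `|th l| <= a) ->
  `|trig th x| <= a * 2 * K%:R.
Proof.
move=> tha; apply: (le_trans (ler_norm_sum _ _ _)).
apply: (@le_trans _ _ (\sum_(l < K) a * 2)); last first.
  by rewrite sumr_const card_ord [leRHS]mulr_natr lexx.
by apply: ler_sum => l _; rewrite normrM ler_pM ?fourier_le.
Qed.

Lemma fourier_coef_trig K (th : 'I_K -> R) l : (0 < l)%N ->
  fourier_coef (trig th) l = \sum_(k < K) th k * (k.+1 == l)%:R.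
Proof.
move=> l0; rewrite /fourier_coef.
rewrite -unif01E; last 2 first.
- by apply: measurable_funM; [exact: measurable_trig|exact: measurable_fourier].
- by apply: integrable01 => x; apply: cvgM; [exact: continuous_trig|exact: continuous_fourier].
have mff (k : 'I_K) : measurable_fun setT (fun x : R => fourier k.+1 x * fourier l x).
  by apply: measurable_funM; exact: measurable_fourier.
have iffk (k : 'I_K) : rint U01 (fun x => fourier k.+1 x * fourier l x).
  apply: (integrable_bounded (B := 2 * 2)) => // x.
  by rewrite normrM ler_pM ?fourier_le.
transitivity (\int[U01]_x \sum_(k < K) (th k * (fourier k.+1 x * fourier l x))).
  by apply: eq_Rintegral => x _; rewrite big_distrl /=; apply: eq_bigr => k _; rewrite mulrA.
rewrite Rintegral_sum; last by move=> k _; exact: rintZ.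
apply: eq_bigr => k _; rewrite RintegralZl //.
by rewrite -(prednK l0) unif01_fourier eqSS.
Qed.

(** A trigonometric polynomial is its own Fourier series, which terminates. *)
Lemma sobolev_trig alpha Calpha K (th : 'I_K -> R) :
  \sum_(k < K) k.+1%:R `^ (2 * alpha) * th k ^+ 2 <= Calpha ^+ 2 / pi `^ (2 * alpha) ->
  sobolev alpha Calpha (trig th).
Proof.
move=> bnd; split.
- by apply: measurable_funTS; exact: measurable_trig.
- rewrite /sql2norm; apply: integrable_lty => //.
  apply: (integrable01 (f := fun t => trig th t ^+ 2)) => x.
  by under eq_fun do rewrite expr2; apply: cvgM; exact: continuous_trig.
- move=> t t01.
  (* beyond K the partial sums are constant *)
  apply: cvg_near_cst; exists K.+1 => // N /= KN.
  under eq_big_nat => l /andP[l0 _] do rewrite fourier_coef_trig // big_distrl /=.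
  rewrite exchange_big /=; apply: eq_bigr => k _.
  rewrite (bigD1_seq k.+1) /=; last exact: iota_uniq.
    rewrite eqxx mulr1 big1_seq ?addr0 // => l /andP[lk _].
    by rewrite eq_sym (negbTE lk) mulr0 mul0r.
  by rewrite mem_index_iota /= (leq_ltn_trans (ltn_ord k) KN).
- apply: lime_le; first by apply: is_cvg_nneseries => n _ _; rewrite lee_fin mulr_ge0 ?sqr_ge0 ?powR_ge0.
  apply: nearW => N; rewrite sumEFin lee_fin; apply: le_trans bnd.
  have sq l : (\sum_(k < K) th k * (k.+1 == l)%:R) ^+ 2 = \sum_(k < K) th k ^+ 2 * (k.+1 == l)%:R.
    have [k0 /eqP k0l|no] := pickP (fun k : 'I_K => k.+1 == l).
      have z (k : 'I_K) : k != k0 -> (k.+1 == l) = false.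
        by rewrite -k0l eqSS => /negbTE.
      rewrite (bigD1 k0) // [RHS](bigD1 k0) //= k0l eqxx !mulr1.
      by rewrite !big1 ?addr0 // => k /z ->; rewrite mulr0.
    by rewrite !big1 ?expr0n // => k _; rewrite no mulr0.
  under eq_big_nat => l /andP[l0 _] do rewrite fourier_coef_trig // sq big_distrr /=.
  rewrite exchange_big /=; apply: ler_sum => k _.
  have [kN|kN] := boolP (k.+1 \in index_iota 1 N).
    rewrite (bigD1_seq k.+1) ?iota_uniq //= eqxx mulr1 big1_seq ?addr0 // => l /andP[lk _].
    by rewrite eq_sym (negbTE lk) !mulr0.
  apply: (@le_trans _ _ 0); last by rewrite mulr_ge0 ?powR_ge0 ?sqr_ge0.
  rewrite big1_seq // => l /= lN.
  by case: eqP => [kl|_]; [rewrite kl lN in kN|rewrite !mulr0].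
Qed.

(** A density has first Fourier coefficient 1, and this coefficient alone enters
    the Sobolev sum with weight 1; so the ellipsoid contains the constant 1. *)
Lemma sobolev_radius alpha Calpha L (f : R -> R) :
  sampling_density alpha Calpha L f -> 1 <= Calpha ^+ 2 / pi `^ (2 * alpha).
Proof.
case=> -[_ _ _ fb] _ mass.
have c1 : fourier_coef f 1 = 1.
  by rewrite /fourier_coef /fourier eqxx; under eq_Rintegral do rewrite mulr1;
    rewrite /Rintegral mass.
rewrite -lee_fin; apply: le_trans fb.
apply: le_trans (nneseries_lim_ge 2 _); last first.
  by move=> l _ _; rewrite lee_fin mulr_ge0 ?sqr_ge0 ?powR_ge0.
by rewrite big_nat1 c1 powR1 expr1n mulr1.
Qed.

Lemma sampling_density_cst1 alpha Calpha L : 1 < L ->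
  1 <= Calpha ^+ 2 / pi `^ (2 * alpha) ->
  sampling_density alpha Calpha L (fun=> 1 : R).
Proof.
move=> L1 hC; split.
- have -> : (fun=> 1 : R) = trig (fun _ : 'I_1 => 1).
    by apply/funext => x; rewrite /trig big_ord1 mul1r.
  by apply: sobolev_trig; rewrite big_ord1 powR1 expr1n mulr1.
- by move=> t _; rewrite L1 andbT invf_le1 ?(lt_trans ltr01) // ltW.
- have leb01 : leb (`[0, 1]%classic : set R) = 1%E.
    by rewrite lebesgue_measure_itv /= lte01 oppr0 adde0.
  by rewrite integral_cst // mul1e; exact: leb01.
Qed.

Lemma sobolev_cst alpha Calpha (c : R) : 1 <= Calpha ^+ 2 / pi `^ (2 * alpha) ->
  `|c| <= 1 -> sobolev alpha Calpha (fun=> c : R).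
Proof.
move=> hC c1; have -> : (fun=> c : R) = trig (fun _ : 'I_1 => c).
  by apply/funext => x; rewrite /trig big_ord1 mulr1.
apply: sobolev_trig; rewrite big_ord1 powR1 mul1r (le_trans _ hC) //.
by rewrite -(real_normK (num_real c)) expr_le1.
Qed.

(** The K frequencies contribute at most K ^ (2 alpha) * a ^ 2 each. *)
Lemma sobolev_trig_bounded alpha Calpha K (th : 'I_K -> R) (a : R) :
  1 <= Calpha ^+ 2 / pi `^ (2 * alpha) -> 0 <= alpha -> (0 < K)%N ->
  K%:R `^ (2 * alpha + 1) * a ^+ 2 <= 1 -> (forall l, `|th l| <= a) ->
  sobolev alpha Calpha (trig th).
Proof.
move=> hC al0 K0 hK tha; apply: sobolev_trig; apply: (le_trans _ hC); apply: (le_trans _ hK).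
apply: (@le_trans _ _ (\sum_(k < K) K%:R `^ (2 * alpha) * a ^+ 2)).
  apply: ler_sum => k _; rewrite ler_pM ?powR_ge0 ?sqr_ge0 //.
    by rewrite ge0_ler_powR ?nnegrE ?mulr_ge0 // ler_nat.
  by rewrite -(real_normK (num_real (th k))) lerXn2r // nnegrE // (le_trans _ (tha k)).
rewrite sumr_const card_ord powRD; last by rewrite pnatr_eq0 -lt0n K0 implybT.
rewrite powRr1 // -[leLHS]mulr_natr mulrAC lexx //.
Qed.

End trigonometric_polynomials.

Section projection_of_estimators.
Context {R : realType}.
Local Notation leb := (@lebesgue_measure R).
Local Notation U01 := (@unif R 0 1 ltr01).

Definition clip (a : R) (x : R) : R := Num.max (- a) (Num.min x a).

Lemma clip_le a x : 0 <= a -> `|clip a x| <= a.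
Proof.
move=> a0; rewrite /clip ler_norml le_max lexx /= ge_max ge_min lexx orbT andbT.
by rewrite (le_trans _ a0) // oppr_le0.
Qed.

Lemma clip_id a x : `|x| <= a -> clip a x = x.
Proof. by rewrite ler_norml /clip => /andP[h1 h2]; rewrite min_l // max_r. Qed.

Lemma measurable_clip a : measurable_fun setT (clip a).
Proof. by apply: measurable_maxr => //; exact: measurable_minr. Qed.

Lemma clip_dist a x y : `|y| <= a -> (clip a x - y) ^+ 2 <= (x - y) ^+ 2.
Proof.
rewrite ler_norml => /andP[h1 h2]; rewrite /clip.
case: (leP x a) => xa; [case: (leP (- a) x) => ax //; nra|].
by rewrite max_r; [nra|lra].
Qed.

Lemma sum_delta K (v : 'I_K -> R) (l : 'I_K) :
  \sum_(k < K) v k * (nat_of_ord k == nat_of_ord l)%:R = v l.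
Proof.
rewrite (bigD1 l) //= eqxx mulr1 big1 ?addr0 // => k kl.
by rewrite (_ : (_ == _) = false) ?mulr0 //; apply: negbTE.
Qed.

Lemma Rintegral_trig_mul K (u v : 'I_K -> R) :
  \int[U01]_x (trig v x * trig u x) = \sum_l u l * v l.
Proof.
have iff (l k : 'I_K) : rint U01 (fun x => fourier k.+1 x * fourier l.+1 x).
  apply: (integrable_bounded (B := 2 * 2)).
    by apply: measurable_funM; exact: measurable_fourier.
  by move=> x; rewrite normrM ler_pM // fourier_le.
have iffk (l k : 'I_K) : rint U01 (fun x => v k * (fourier k.+1 x * fourier l.+1 x)).
  exact: rintZ.
have ifl (l : 'I_K) : rint U01 (fun x => \sum_(k < K) v k * (fourier k.+1 x * fourier l.+1 x)).
  by apply: rint_sum => k _; exact: iffk.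
transitivity (\int[U01]_x (\sum_(l < K) u l * (\sum_(k < K) v k * (fourier k.+1 x * fourier l.+1 x)))).
  apply: eq_Rintegral => x _; rewrite big_distrr /=; apply: eq_bigr => l _.
  by rewrite mulrCA big_distrl /=; congr (_ * _); apply: eq_bigr => k _; rewrite mulrA.
rewrite Rintegral_sum => [|l _]; last exact: rintZ.
apply: eq_bigr => l _; rewrite RintegralZl //; congr (_ * _); rewrite Rintegral_sum //.
rewrite (eq_bigr (fun k : 'I_K => v k * (nat_of_ord k == nat_of_ord l)%:R)); last first.
  by move=> k _; rewrite RintegralZl // unif01_fourier.
exact: sum_delta.
Qed.

(** Expanding the square at the Fourier coefficients c of g and at th, the
    difference of the two quadratic forms is the sum of squares on the left. *)
Lemma bessel K (g : R -> R) (B : R) (th : 'I_K -> R) :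
  measurable_fun setT g -> (forall x, `|g x| <= B) ->
  \sum_(l < K) (\int[U01]_x (g x * fourier l.+1 x) - th l) ^+ 2 <=
  \int[U01]_x ((g x - trig th x) ^+ 2).
Proof.
move=> mg gB; pose c (l : 'I_K) := \int[U01]_x (g x * fourier l.+1 x).
have mf l := measurable_fourier (R := R) l.
have mt (u : 'I_K -> R) := measurable_trig u.
have bt (u : 'I_K -> R) : exists A : R, forall x, `|trig u x| <= A.
  exists ((\sum_l `|u l|) * 2 * K%:R) => x; apply: trig_le => l.
  by rewrite (bigD1 l) //= lerDl sumr_ge0.
have i0 (h : R -> R) : measurable_fun setT h -> (exists A : R, forall x, `|h x| <= A) -> rint U01 h.
  by move=> mh [A hA]; exact: integrable_bounded mh hA.
have bM (h k : R -> R) : (exists A : R, forall x, `|h x| <= A) -> (exists A : R, forall x, `|k x| <= A) ->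
    exists A : R, forall x, `|h x * k x| <= A.
  by move=> [A hA] [A' hA']; exists (A * A') => x; rewrite normrM ler_pM.
have bg : exists A : R, forall x, `|g x| <= A by exists B.
have bf l : exists A : R, forall x : R, `|fourier l x| <= A by exists 2 => x; exact: fourier_le.
have mM (h k : R -> R) : measurable_fun setT h -> measurable_fun setT k ->
    measurable_fun setT (fun x => h x * k x) by exact: measurable_funM.
have gt (u : 'I_K -> R) : \int[U01]_x (g x * trig u x) = \sum_l u l * c l.
  transitivity (\int[U01]_x (\sum_(l < K) u l * (g x * fourier l.+1 x))).
    by apply: eq_Rintegral => x _; rewrite big_distrr /=; apply: eq_bigr => l _; ring.
  rewrite Rintegral_sum => [|l _]; last by apply/rintZ/i0; [exact: mM|exact: bM].
  by apply: eq_bigr => l _; rewrite RintegralZl //; apply: i0; [exact: mM|exact: bM].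
have igt (u : 'I_K -> R) : rint U01 (fun x => g x * trig u x) by apply: i0; [exact: mM|exact: bM].
have itt (u v : 'I_K -> R) : rint U01 (fun x => trig v x * trig u x) by apply: i0; [exact: mM|exact: bM].
have igg : rint U01 (fun x => g x * g x) by apply: i0; [exact: mM|exact: bM].
have expand (u : 'I_K -> R) : \int[U01]_x ((g x - trig u x) ^+ 2) =
    \int[U01]_x (g x * g x) - 2 * \sum_l u l * c l + \sum_l u l * u l.
  transitivity (\int[U01]_x ((g x * g x - 2 * (g x * trig u x)) + trig u x * trig u x)).
    by apply: eq_Rintegral => x _; ring.
  rewrite RintegralD //; last by apply: rintB => //; exact: rintZ.
  by rewrite RintegralB // ?RintegralZl // ?gt ?Rintegral_trig_mul //; exact: rintZ.
have : 0 <= \int[U01]_x ((g x - trig c x) ^+ 2).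
  by apply: Rintegral_ge0 => x _; exact: sqr_ge0.
rewrite !expand -subr_ge0 => h; rewrite -subr_ge0; apply: (le_trans h).
rewrite le_eqVlt; apply/orP; left; apply/eqP.
rewrite (_ : \sum_(l < K) (_ - _) ^+ 2 =
    \sum_l c l * c l - 2 * (\sum_l th l * c l) + \sum_l th l * th l).
  by ring.
rewrite big_distrr -sumrB -big_split /=; apply: eq_bigr => l _; rewrite -/(c l); ring.
Qed.

(** The values of the estimator are clipped to the range of the curves before
    taking Fourier coefficients, which are clipped again: clipping towards a
    convex set that contains the target only reduces the error, and makes the
    coefficients bounded for estimators that need not be square integrable. *)
Lemma estimator_coefficients dZ (Z : measurableType dZ) (mut : Z -> R -> R) K (a : R) :
  estimator mut -> 0 <= a ->
  exists M : 'I_K -> Z -> R,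
    [/\ forall l, measurable_fun setT (M l), forall l z, `|M l z| <= a &
     forall th : 'I_K -> R, (forall l, `|th l| <= a) -> forall z,
      ((\sum_l (M l z - th l) ^+ 2)%:E <= sql2norm (fun t => (mut z t - trig th t)%R))%E].
Proof.
move=> mmut a0.
pose D : set (Z * R) := [set: Z] `*` `[0, 1]%classic.
have mD : measurable D by exact: measurableX.
pose g (zx : Z * R) := clip (a * 2 * K%:R) (((fun p : Z * R => mut p.1 p.2) \_ D) zx).
have B0 : 0 <= a * 2 * K%:R by rewrite !mulr_ge0.
have mg : measurable_fun setT g.
  apply: measurableT_comp; first exact: measurable_clip.
  by apply/(measurable_restrictT _ mD).
have gB zx : `|g zx| <= a * 2 * K%:R by exact: clip_le.
have mgz z : measurable_fun setT (fun x => g (z, x)).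
  exact: (measurableT_comp mg (pair1_measurable z)).
pose c (l : 'I_K) z := \int[U01]_x (g (z, x) * fourier l.+1 x).
have mc l : measurable_fun setT (c l).
  apply: (@measurable_Rintegral_param _ _ _ _ _ U01
    (fun zx => g zx * fourier l.+1 zx.2) (a * 2 * K%:R * 2)).
    apply: measurable_funM => //.
    exact: (measurableT_comp (measurable_fourier l.+1) measurable_snd).
  by move=> zx; rewrite normrM ler_pM ?fourier_le.
exists (fun l z => clip a (c l z)); split.
- by move=> l; apply: measurableT_comp => //; exact: measurable_clip.
- by move=> l z; exact: clip_le.
move=> th tha z.
apply: (@le_trans _ _ (\int[U01]_x ((g (z, x) - trig th x) ^+ 2))%:E).
  rewrite lee_fin; apply: le_trans (bessel th (mgz z) (fun x => gB (z, x))).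
  by apply: ler_sum => l _; exact: clip_dist.
have mgt : measurable_fun setT (fun x => (g (z, x) - trig th x) ^+ 2).
  by apply: measurable_funX; apply: measurable_funB => //; exact: measurable_trig.
rewrite fineK_Rintegral; last first.
  apply: (integrable_bounded (B := (a * 2 * K%:R + a * 2 * K%:R) ^+ 2)) => // x.
  rewrite normrX lerXn2r ?nnegrE ?addr_ge0 // (le_trans (ler_normB _ _)) // lerD //.
  exact: trig_le.
rewrite integral_unif_ge0; [|exact/measurable_EFinP|by move=> x; rewrite lee_fin sqr_ge0].
rewrite subr0 invr1 mul1e /sql2norm; apply: ge0_le_integral => //.
- by move=> x _; rewrite lee_fin sqr_ge0.
- by apply/measurable_EFinP; apply: measurable_funTS.
- apply/measurable_EFinP; apply: measurable_funX; apply: measurable_funB; last first.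
    by apply: measurable_funTS; exact: measurable_trig.
  have mgp : measurable_fun setT (fun x => ((fun p : Z * R => mut p.1 p.2) \_ D) (z, x)).
    apply: (measurableT_comp _ (pair1_measurable z)).
    by apply/(measurable_restrictT _ mD).
  apply: eq_measurable_fun (measurable_funTS mgp) => x x01.
  by rewrite patchE mem_set //=; split => //; rewrite inE in x01.
- move=> x x01; rewrite lee_fin /g patchE mem_set //=; apply: clip_dist.
  exact: trig_le.
Qed.

End projection_of_estimators.

(** * From the risk to Fourier coefficients, and the model on product spaces *)

Section random_variables.
Context d d' (T : measurableType d) (T' : measurableType d').

Definition mfun_of (f : T -> T') (mf : measurable_fun setT f) : {mfun T >-> T'} :=
  HB.pack f (isMeasurableFun.Build _ _ _ _ f mf).

End random_variables.

Section product_expectation.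
Context {R : realType} (J : finType) (p : J -> probability R R).
Local Notation P := (prodP p).

(** The expectation is computed on merge A t s, where f reads s and g reads t. *)
Lemma Rintegral_indep (A : pred J) (f g : tup R J -> R) (B C : R) :
  measurable_fun setT f -> measurable_fun setT g ->
  (forall t, `|f t| <= B) -> (forall t, `|g t| <= C) ->
  dep_on A f -> dep_on (predC A) g ->
  \int[P]_t (f t * g t) = (\int[P]_t f t) * (\int[P]_t g t).
Proof.
move=> mf mg fB gC df dg.
have if_ := integrable_bounded (P := P) mf fB.
have ig := integrable_bounded (P := P) mg gC.
have ifg : rint P (fun t => f t * g t).
  apply: (integrable_bounded (B := B * C)); first exact: measurable_funM.
  by move=> t; rewrite normrM ler_pM.
have fgm t s : f (merge A t s) * g (merge A t s) = f s * g t.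
  congr (_ * _); first by apply: df => j Aj; rewrite mergeE Aj.
  by apply: dg => j /negbTE Aj; rewrite mergeE Aj.
have mm := measurable_merge (R := R) A.
have i2 : (P \x P)%E.-integrable setT (EFin \o (fun ts => f ts.2 * g ts.1)).
  apply: (integrable_bounded (P := (P \x P)%E) (B := B * C)).
    apply: measurable_funM; first exact: (measurableT_comp mf measurable_snd).
    exact: (measurableT_comp mg measurable_fst).
  by move=> t; rewrite normrM ler_pM.
rewrite {1}/Rintegral.
rewrite -(integral_law mm (@merge_law _ _ p A)); last exact: measurable_int ifg.
under eq_integral do rewrite fgm.
rewrite -(integral12_prod_meas1 i2) /fubini_F /=.
transitivity (fine (\int[P]_t ((g t)%:E * (\int[P]_s f s)%:E))%E).
  congr fine; apply: eq_integral => t _; rewrite fineK_Rintegral //.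
  transitivity (\int[P]_s ((f s)%:E * (g t)%:E))%E; first exact: eq_integral.
  by rewrite integralZr // muleC.
by rewrite integralZr // -fineK_Rintegral // mulrC.
Qed.

Lemma Rintegral_co j (F : R -> R) : measurable_fun setT F ->
  \int[P]_t F (co t j) = \int[p j]_u F u.
Proof.
move=> mF; congr fine.
apply: (integral_law (P := P) (P' := p j) (measurable_co j) _ (f := EFin \o F)).
  by move=> B mB; exact: marginal_law.
exact/measurable_EFinP.
Qed.

End product_expectation.

Section reduction.
Context {R : realType}.
Local Notation leb := (@lebesgue_measure R).

Lemma measurable_sql2norm dZ (Z : measurableType dZ) (mut : Z -> R -> R) (mu : R -> R) :
  estimator mut -> measurable_fun setT mu ->
  measurable_fun setT (fun z => sql2norm (fun t => (mut z t - mu t)%R)).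
Proof.
move=> mmut mmu.
pose D : set (Z * measurableTypeR R) := [set: Z] `*` `[0, 1]%classic.
have mD : measurable D by exact: measurableX.
pose F : Z * measurableTypeR R -> \bar R :=
  (fun p : Z * measurableTypeR R => ((mut p.1 p.2 - mu p.2) ^+ 2)%:E) \_ D.
have mF : measurable_fun setT F.
  apply/(measurable_restrictT _ mD)/measurable_EFinP.
  apply: measurable_funX; apply: measurable_funB; first exact: mmut.
  by apply: measurable_funTS; exact: (measurableT_comp mmu measurable_snd).
have F0 p : (0 <= F p)%E.
  by rewrite /F patchE; case: ifP => // _; rewrite lee_fin sqr_ge0.
have := measurable_fun_fubini_tonelli_F (m2 := leb) F mF F0.
apply: eq_measurable_fun => z _; rewrite /sql2norm /fubini_F [RHS]integral_mkcond.
apply: eq_integral => t _; rewrite /F !patchE.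
by rewrite in_setX /= in_setT.
Qed.

Variables (n m : nat).
Local Notation dataset := (n.-tuple (m.-tuple (R * R)%type)).

(** From here on the estimator is replaced by finitely many bounded real
    statistics of the output. *)
Lemma risk_trig_ge dZ (Z : measurableType dZ) (Q : R.-pker dataset ~> Z)
    (mut : Z -> R -> R) d (T : measurableType d) (P : probability T R) (D : T -> dataset)
    K (th : 'I_K -> R) (a r : R) (M : 'I_K -> Z -> R) :
  estimator mut -> measurable_fun setT D ->
  (forall l, measurable_fun setT (M l)) -> (forall l z, `|M l z| <= a) ->
  (forall l, `|th l| <= a) ->
  (forall z, ((\sum_l (M l z - th l) ^+ 2)%:E <=
    sql2norm (fun t => (mut z t - trig th t)%R))%E) ->
  (risk P D (trig th) Q mut <= r%:E)%E ->
  \int[P]_t \int[kprob Q (D t)]_z (\sum_l (M l z - th l) ^+ 2) <= r.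
Proof.
move=> mmut mD mM Ma tha Mth.
pose f z := \sum_l (M l z - th l) ^+ 2.
have mf : measurable_fun setT f.
  by apply: measurable_sum => l; apply: measurable_funX; exact: measurable_funB.
have fB z : `|f z| <= \sum_(l < K) (a + a) ^+ 2.
  apply: (le_trans (ler_norm_sum _ _ _)); apply: ler_sum => l _.
  by rewrite normrX lerXn2r ?nnegrE ?(le_trans _ (lerD (Ma l z) (tha l))) ?addr_ge0 // ler_normB.
have f0 z : 0 <= f z by apply: sumr_ge0 => l _; exact: sqr_ge0.
have mmf : measurable_fun setT (fun wz : T * Z => f wz.2).
  exact: (measurableT_comp mf measurable_snd).
have mQf : measurable_fun setT (fun t => \int[kprob Q (D t)]_z f z).
  exact: (measurable_kernel_Rintegral Q mD (f := fun _ z => f z) mmf (fun _ z => fB z)).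
have QfB t : `|\int[kprob Q (D t)]_z f z| <= \sum_(l < K) (a + a) ^+ 2.
  exact: Rintegral_norm_le.
move=> hr; rewrite -lee_fin; apply: le_trans hr.
rewrite fineK_Rintegral; last exact: integrable_bounded mQf QfB.
have mS := measurable_sql2norm mmut (measurable_trig th).
have mSS : measurable_fun setT (fun wz : T * Z =>
    sql2norm (fun t => (mut wz.2 t - trig th t)%R)).
  exact: (measurableT_comp mS measurable_snd).
have S0 z : (0 <= sql2norm (fun t => (mut z t - trig th t)%R))%E.
  by apply: integral_ge0 => t _; rewrite lee_fin sqr_ge0.
apply: ge0_le_integral => //.
- by move=> t _; rewrite lee_fin; apply: Rintegral_ge0 => z _; exact: f0.
- exact/measurable_EFinP.
- exact: (measurable_kernel_integral Q mD (f := fun _ z => sql2norm (fun t => (mut z t - trig th t)%R)) mSS).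
- move=> t _; rewrite fineK_Rintegral; last exact: integrable_bounded mf fB.
  apply: ge0_le_integral => //.
  + by move=> z _; rewrite lee_fin f0.
  + exact/measurable_EFinP.
Qed.

End reduction.

Section model_assumptions.
Context {R : realType}.
Local Notation leb := (@lebesgue_measure R).
Local Notation U01 := (@unif R 0 1 ltr01).

(** Design points must lie in [0, 1] for every outcome, while a uniform variable
    does so only almost surely. *)
Definition clip01 (x : R) : R := Num.max 0 (Num.min x 1).

Lemma clip01_itv x : 0 <= clip01 x <= 1.
Proof. by rewrite /clip01 le_max lexx ge_max ler01 ge_min lexx orbT. Qed.

Lemma clip01_id x : 0 <= x <= 1 -> clip01 x = x.
Proof. by move=> /andP[x0 x1]; rewrite /clip01 min_l // max_r. Qed.

Lemma measurable_clip01 : measurable_fun setT clip01.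
Proof. by apply: measurable_maxr => //; exact: measurable_minr. Qed.

Lemma unif01_set (B : set R) : measurable B ->
  U01 B = (\int[leb]_(t in B `&` `[0%R, 1%R]) 1%:E)%E.
Proof.
move=> mB.
transitivity (\int[leb]_(x in B) (uniform_pdf 0 1 x)%:E)%E; first by [].
rewrite integral_uniform_pdf.
apply: eq_integral => x; rewrite inE /= => -[_]; rewrite in_itv /= => x01.
by rewrite /uniform_pdf x01 subr0 invr1.
Qed.

Section product.
Variables (J : finType) (p : J -> probability R R) (n m : nat).
Variable pos : 'I_n * 'I_m -> J.
Hypothesis pos_inj : injective pos.
Hypothesis p_pos : forall ij, p (pos ij) = U01.
Local Notation P := (prodP p).

Lemma measurable_design j : measurable_fun setT (fun t : tup R J => clip01 (co t j)).
Proof. by apply: measurableT_comp; [exact: measurable_clip01|exact: measurable_co]. Qed.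

Definition design i j : {RV P >-> R} := mfun_of (measurable_design (pos (i, j))).

Lemma assumptionS_design alpha Calpha L : sampling_density alpha Calpha L (fun=> 1 : R) ->
  assumptionS alpha Calpha L design.
Proof.
move=> hf; split.
- by move=> i j w; exact: clip01_itv.
- pose lab j := [pick ij | pos ij == j].
  have labE ij : lab (pos ij) = Some ij.
    rewrite /lab; case: pickP => [ij' /eqP/pos_inj ->//|/(_ ij)].
    by rewrite eqxx.
  apply: (@mutually_indep_prodP _ _ _ _ lab) => -[i j] f /= ->; split.
    exact: measurable_design.
  by move=> t s ts; rewrite /design /= /mfun_of /=; congr clip01; apply: ts; rewrite labE.
- exists (fun=> 1) => // i j A mA.
  have mcA : measurable (clip01 @^-1` A).
    by rewrite -[X in measurable X]setTI; exact: measurable_clip01.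
  transitivity (U01 (clip01 @^-1` A)); first by rewrite -(p_pos (i, j)); exact: marginal_law.
  rewrite unif01_set //; congr (integral leb _ _).
  apply/seteqP; split=> x /= [Ax x01]; split=> //; move: Ax; rewrite clip01_id //;
    by move: x01; rewrite in_itv.
Qed.

End product.

Lemma psi2_norm_le d (T : measurableType d) (P : probability T R) (X : T -> R) (C : R) : 0 < C ->
  (\int[P]_w (expR (X w ^+ 2 / C ^+ 2))%:E <= 2%:E)%E -> (psi2_norm P X <= C%:E)%E.
Proof. by move=> C0 h; apply: ereal_inf_lbound; exists C. Qed.

Lemma expR_half : expR (2^-1) <= 2 :> R.
Proof.
have := expR_ge1Dx (- 2^-1 : R); rewrite expRN => h.
have e0 := expR_gt0 (2^-1 : R).
have : 2^-1 * expR 2^-1 <= 1 :> R.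
  by rewrite -ler_pdivlMr // div1r; apply: le_trans h; lra.
lra.
Qed.

(** A variable bounded by B has psi_2 norm at most sqrt 2 * B, because
    exp (1/2) <= 2. *)
Lemma psi2_norm_bounded d (T : measurableType d) (P : probability T R) (X : T -> R) (B C : R) :
  measurable_fun setT X -> 0 < C -> (forall w, `|X w| <= B) -> 2 * B ^+ 2 <= C ^+ 2 ->
  (psi2_norm P X <= C%:E)%E.
Proof.
move=> mX C0 XB BC; apply: psi2_norm_le => //.
rewrite -(integral_prob_cst P 2); apply: ge0_le_integral => //.
- apply/measurable_EFinP; apply: measurableT_comp => //; apply: measurable_funM => //.
  exact: measurable_funX.
- move=> w _; rewrite lee_fin (le_trans _ expR_half) // ler_expR ler_pdivrMr ?exprn_gt0 //.
  have : X w ^+ 2 <= B ^+ 2.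
    by rewrite -(real_normK (num_real (X w))) lerXn2r // nnegrE (le_trans _ (XB w)).
  lra.
Qed.

Lemma psi2_norm0 d (T : measurableType d) (P : probability T R) (X : T -> R) (C : R) : 0 < C ->
  (forall w, X w = 0) -> (psi2_norm P X <= C%:E)%E.
Proof.
move=> C0 X0; have -> : X = cst 0 by apply/funext.
apply: (@psi2_norm_bounded _ _ P _ 0) => // [w|]; first by rewrite normr0.
by rewrite expr0n mulr0 sqr_ge0.
Qed.

Lemma worst_risk_ge alpha Calpha L CU Cxi n m dZ (Z : measurableType dZ)
    (Q : R.-pker (n.-tuple (m.-tuple (R * R)%type)) ~> Z) mut
    d (T : measurableType d) (P : probability T R) (X : 'I_n -> 'I_m -> {RV P >-> R}) mu
    (U : 'I_n -> R -> T -> R) (xi : 'I_n -> 'I_m -> {RV P >-> R}) r :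
  assumptionS alpha Calpha L X -> assumptionM alpha Calpha CU Cxi X mu U xi ->
  (worst_risk alpha Calpha L CU Cxi Q mut <= r)%E ->
  (risk P (data X mu U xi) mu Q mut <= r)%E.
Proof.
move=> hS hM; apply: le_trans; apply: ereal_sup_ubound.
by exists d, T, P, X, mu, U, xi; split.
Qed.

End model_assumptions.

(** * Two-point bounds from random functions *)

Section expectation_of_coordinates.
Context {R : realType} (J : finType) (p : J -> probability R R).
Local Notation P := (prodP p).

Lemma expectation_co j (F : R -> R) : measurable_fun setT F ->
  ('E_P[fun t => F (co t j)] = \int[p j]_u (F u)%:E)%E.
Proof.
move=> mF; rewrite unlock.
apply: (integral_law (P := P) (P' := p j) (measurable_co j) _ (f := EFin \o F)).
  by move=> B mB; exact: marginal_law.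
exact/measurable_EFinP.
Qed.

Lemma covariance_co j (F : R -> R) : measurable_fun setT F ->
  covariance P (fun t => F (co t j)) (fun t => F (co t j)) =
  (\int[p j]_u ((F u - fine (\int[p j]_v (F v)%:E)) ^+ 2)%:E)%E.
Proof.
move=> mF; rewrite covariance.unlock expectation_co //.
rewrite -(expectation_co j (F := fun u => (F u - fine (\int[p j]_v (F v)%:E)%E) ^+ 2)).
  by congr expectation; apply/funext => t /=; rewrite expr2.
by apply: measurable_funX; exact: measurable_funB.
Qed.

End expectation_of_coordinates.

(** One uniform variable for each design point and one for the bit of each user. *)
Definition two_point_index (n m : nat) : finType := ('I_n * 'I_m + 'I_n)%type.

Section two_point.
Context {R : realType} (n m : nat) (b : R).
Local Notation leb := (@lebesgue_measure R).
Local Notation U01 := (@unif R 0 1 ltr01).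
Hypothesis b_gt0 : 0 < b.
Local Notation J := (two_point_index n m).
Local Notation P := (prodP (fun _ : J => U01)).
Local Notation T := (tup R J).
Local Notation dataset := (n.-tuple (m.-tuple (R * R)%type)).

(** The bits for both signs are read from the same uniform variable, which couples
    the two distributions so that a bit changes with probability s only. *)
Definition bit (sg : R) (t : T) (i : 'I_n) : bool := co t (inr i) < (1 + sg) / 2.
Definition bits sg t : {ffun 'I_n -> bool} := [ffun i => bit sg t i].
Definition height (v : bool) : R := if v then b else - b.
Definition two_point_data (t : T) (w : {ffun 'I_n -> bool}) : dataset :=
  [tuple [tuple (clip01 (co t (inl (i, j))), height (w i)) | j < m] | i < n].

Lemma unif01_lt (c : R) : 0 <= c <= 1 -> U01 [set u | u < c] = c%:E.
Proof.
move=> /andP[c0 c1]; rewrite unif01_set; last first.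
  by rewrite (_ : [set u | _] = `]-oo, c[%classic).
rewrite (_ : _ `&` _ = `[0, c[%classic); last first.
  apply/seteqP; split=> u /=; rewrite !in_itv /=.
    by move=> [uc /andP[-> _]].
  by move=> /andP[u0 uc]; split => //; rewrite u0 (le_trans (ltW uc)).
have : leb (`[0, c[%classic : set R) = c%:E.
  rewrite lebesgue_measure_itv /= lte_fin oppr0 adde0.
  by move: c0; rewrite le_eqVlt => /predU1P[<-|->//]; rewrite ltxx.
by rewrite integral_cst //= mul1e.
Qed.

Lemma measurable_lt_bool (c x y : R) :
  measurable_fun setT (fun u : R => if u < c then x else y).
Proof. by apply: measurable_fun_if => //; exact: measurable_fun_ltr. Qed.

Lemma measurable_indic_lt (c : R) : measurable_fun setT (fun u : R => ((u < c)%R)%:R : R).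
Proof.
rewrite (_ : (fun u => _) = fun u : R => if u < c then 1 else 0 : R).
  exact: (measurable_lt_bool _ _ _).
by apply/funext => u; case: ifP.
Qed.

Lemma Rintegral_unif01_lt (c : R) : 0 <= c <= 1 -> \int[U01]_u ((u < c)%R)%:R = c.
Proof.
move=> c01; rewrite /Rintegral -[RHS]/(fine c%:E) -(unif01_lt c01); congr fine.
rewrite -(setIT [set u | u < c]) -integral_indic //; last first.
  by rewrite (_ : [set u | _] = `]-oo, c[%classic).
by apply: eq_integral => u _; rewrite indicE mem_setE.
Qed.

Section one_sign.
Variables (sg : R).
Hypothesis sg01 : -1 <= sg <= 1.
Let c01 : 0 <= (1 + sg) / 2 <= 1.
Proof. by move: sg01 => /andP[h1 h2]; apply/andP; split; lra. Qed.

Let F (u : R) : R := height (u < (1 + sg) / 2) - sg * b.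
Let mF : measurable_fun setT F.
Proof. by apply: measurable_funB => //; exact: (measurable_lt_bool _ _ _). Qed.

Let FB u : `|F u| <= 2 * b.
Proof.
have /andP[h1 h2] : - b <= sg * b <= b.
  move: sg01 => /andP[h1 h2].
  have e1 := ler_wpM2r (ltW b_gt0) h1; have e2 := ler_wpM2r (ltW b_gt0) h2.
  by apply/andP; split; lra.
have b0 := b_gt0; rewrite /F /height ler_norml; case: ifP => _; apply/andP; split; lra.
Qed.

Let EF : \int[U01]_u F u = 0.
Proof.
transitivity (\int[U01]_u (2 * b * ((u < (1 + sg) / 2)%R)%:R - (b + sg * b))).
  by apply: eq_Rintegral => u _; rewrite /F /height; case: (u < _)%R => /=; ring.
have i1 : rint U01 (fun u => ((u < (1 + sg) / 2)%R)%:R).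
  apply: (integrable_bounded (B := 1)); first exact: measurable_indic_lt.
  by move=> u; case: (u < _)%R; rewrite ?normr1 ?normr0.
rewrite RintegralB //; last 2 first.
- exact: rintZ.
- exact: (integrable_bounded (B := `|b + sg * b|)).
by rewrite RintegralZl // Rintegral_unif01_lt // Rintegral_prob_cst; field.
Qed.

Let U (i : 'I_n) (x : R) (t : T) : R := F (co t (inr i)).
Let mU i x : measurable_fun setT (U i x).
Proof. exact: (measurableT_comp mF (measurable_co _)). Qed.
Let X := @design R J (fun _ => U01) n m (fun ij => inl ij).
Let xi (i : 'I_n) (j : 'I_m) : {RV P >-> R} := mfun_of (@measurable_cst _ _ T R setT 0).
Let mu : R -> R := trig (fun _ : 'I_1 => sg * b).

Lemma two_point_data_eq t : data X mu U xi t = two_point_data t (bits sg t).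
Proof.
apply: eq_from_tnth => i; rewrite !tnth_mktuple; apply: eq_from_tnth => j.
rewrite !tnth_mktuple; congr pair; rewrite /response /U /F /mu /trig big_ord1 mulr1 ffunE.
by rewrite /xi /= /mfun_of /= addr0 addrC subrK.
Qed.

Lemma measurable_two_point_data : measurable_fun setT (fun t => two_point_data t (bits sg t)).
Proof.
apply/measurable_fun_tnthP => i; apply/measurable_fun_tnthP => j.
rewrite (_ : _ \o _ = fun t => (clip01 (co t (inl (i, j))), height (bit sg t i))).
  apply: measurable_fun_pair; first exact: measurable_design.
  exact: (measurableT_comp (measurable_lt_bool _ _ _) (measurable_co (inr i))).
by apply/funext => t /=; rewrite !tnth_mktuple ffunE.
Qed.

(** The random function of user i is the constant difference between the height
    of its bit and the mean sg * b, so its covariance is constant as well. *)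
Lemma two_point_assumptions (alpha Calpha L CU Cxi : R) :
  0 <= alpha -> 1 < L -> 0 < CU -> 0 < Cxi -> 1 <= Calpha ^+ 2 / pi `^ (2 * alpha) ->
  2 * b <= 1 -> 2 * (2 * b) ^+ 2 <= CU ^+ 2 ->
  assumptionS alpha Calpha L X /\ assumptionM alpha Calpha CU Cxi X mu U xi.
Proof.
move=> al0 L1 CU0 Cxi0 hC b1 bCU; split.
  apply: assumptionS_design => //; first by move=> x y [].
  exact: sampling_density_cst1.
have sb : `|sg * b| <= 1.
  have b0 := b_gt0; rewrite normrM (gtr0_norm b0).
  have : `|sg| * b <= 1 * b by rewrite ler_pM2r // ler_norml.
  lra.
split.
- apply: (sobolev_trig_bounded (a := 1)) => //.
  by rewrite powR1 expr1n mulr1.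
- by move=> i; apply: measurable_funTS; exact: (measurableT_comp (mU i 0) measurable_snd).
- move=> i x _; rewrite (expectation_co (fun=> U01) (inr i) mF).
  by rewrite -fineK_Rintegral ?EF //; exact: integrable_bounded mF FB.
- move=> i k x y _ _; transitivity (\int[U01]_u ((F u - fine (\int[U01]_v (F v)%:E)) ^+ 2)%:E)%E.
    exact: (covariance_co (fun=> U01) (inr i) mF).
  by symmetry; exact: (covariance_co (fun=> U01) (inr k) mF).
- apply: (@mutually_indep_prodP _ _ _ _ (fun j : J => if j is inr i then Some i else None)).
  move=> i f [x _ <-]; split; first exact: (mU i 0).
  by move=> t t' tt'; rewrite /U tt'.
- move=> i x _; apply: (@psi2_norm_bounded _ _ _ _ _ (2 * b)) => //.
  by move=> w; exact: FB.
- move=> i; apply: aeW => w; apply: sobolev_cst => //.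
  exact: le_trans (FB _) b1.
- apply: (@indep2_prodP _ _ _ (fun j : J => if j is inr i then true else false)).
    by move=> f [i [x _ <-]]; split; [exact: mU|move=> t t' tt'; rewrite /U tt'].
  move=> f [i [j ->]]; split; first exact: measurable_design.
  by move=> t t' tt'; rewrite /X /design /= /mfun_of /= tt'.
- by move=> i j; rewrite unlock integral0_eq.
- apply: (@mutually_indep_prodP _ _ _ _ (fun j : J => None)) => ij f ->; split.
    exact: measurable_cst.
  by [].
- by move=> i j; apply: psi2_norm0.
- apply: (@indep2_prodP _ _ _ pred0).
    by move=> f [i [j ->]]; split; [exact: measurable_cst|by []].
  have all (f : T -> R) : dep_on (predC pred0) f.
    by move=> t t' tt'; rewrite (co_inj (t := t) (t' := t')) // => j; exact: tt'.
  move=> f [[i [x _ <-]]|[i [j ->]]]; split => //.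
Qed.

End one_sign.
End two_point.

Lemma half_itv {R : realFieldType} (x : R) : -1 <= x <= 1 -> 0 <= (1 + x) / 2 <= 1.
Proof. by move=> /andP[h1 h2]; apply/andP; split; lra. Qed.

Lemma young {R : realFieldType} (N y : R) : 0 < N -> y <= 2^-1 * (N^-1 + N * y ^+ 2).
Proof.
move=> N0; have -> : y = N^-1 * (N * y) by field; lra.
have -> : N^-1 + N * (N^-1 * (N * y)) ^+ 2 = N^-1 * (1 + (N * y) ^+ 2) by field; lra.
rewrite [leRHS]mulrCA ler_pM2l ?invr_gt0 //; have := sqr_ge0 (1 - N * y); lra.
Qed.

Section two_point_risk.
Context {R : realType} (n m : nat) (b s : R).
Local Notation U01 := (@unif R 0 1 ltr01).
Hypotheses (b_gt0 : 0 < b) (s_gt0 : 0 < s) (s_le1 : s <= 1).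
Local Notation J := (two_point_index n m).
Local Notation P := (prodP (fun _ : J => U01)).
Local Notation T := (tup R J).
Local Notation dataset := (n.-tuple (m.-tuple (R * R)%type)).
Context dZ (Z : measurableType dZ) (Q : R.-pker dataset ~> Z).
Local Notation dat := (two_point_data b).

Section bounded_test.
Variables (M : Z -> R) (th : R).
Hypotheses (mM : measurable_fun setT M) (Mth : forall z, `|M z| <= th).

Definition answer (D : dataset) : R := \int[kprob Q D]_z M z.
Definition mean_answer (sg : R) : R := \int[P]_t answer (dat t (bits sg t)).

Lemma answer_le D : `|answer D| <= th.
Proof. exact: Rintegral_norm_le. Qed.

Lemma measurable_answer d0 (W : measurableType d0) (D : W -> dataset) :
  measurable_fun setT D -> measurable_fun setT (fun t => answer (D t)).
Proof.
move=> mD.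
apply: (measurable_kernel_Rintegral Q mD (f := fun _ z => M z) _ (fun _ z => Mth z)).
exact: (measurableT_comp mM measurable_snd).
Qed.

Lemma measurable_two_point_data_cst w : measurable_fun setT (fun t : T => dat t w).
Proof.
apply/measurable_fun_tnthP => i; apply/measurable_fun_tnthP => j.
rewrite (_ : _ \o _ = fun t : T => (clip01 (co t (inl (i, j))), height b (w i))).
  by apply: measurable_fun_pair => //; exact: measurable_design.
by apply/funext => t /=; rewrite !tnth_mktuple.
Qed.

(** Integrates (M - x)^2 >= x (x - M) - x^2 / 4, which is linear in M. *)
Lemma mean_answer_risk (sg r : R) :
  \int[P]_t \int[kprob Q (dat t (bits sg t))]_z (M z - sg * b) ^+ 2 <= r ->
  3 / 4 * (sg * b) ^+ 2 - sg * b * mean_answer sg <= r.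
Proof.
apply: le_trans; set x := sg * b.
have mD : measurable_fun setT (fun t : T => dat t (bits sg t)).
  exact: measurable_two_point_data.
have mf : measurable_fun setT (fun z => (M z - x) ^+ 2).
  by apply: measurable_funX; exact: measurable_funB.
have fB z : `|(M z - x) ^+ 2| <= (th + `|x|) ^+ 2.
  rewrite normrX lerXn2r ?nnegrE //; first by rewrite addr_ge0 // (le_trans _ (Mth z)).
  by rewrite (le_trans (ler_normB _ _)) // lerD2r.
have mg := measurable_answer mD.
have ig : rint P (fun t => answer (dat t (bits sg t))).
  by apply: (integrable_bounded mg) => t; exact: answer_le.
have -> : 3 / 4 * x ^+ 2 - x * mean_answer sg =
    \int[P]_t (3 / 4 * x ^+ 2 - x * answer (dat t (bits sg t))).
  rewrite RintegralB //; last exact: rintZ.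
    by rewrite Rintegral_prob_cst RintegralZl.
  exact: (integrable_bounded (B := `|3 / 4 * x ^+ 2|)).
apply: le_Rintegral => //.
- apply: rintB; last exact: rintZ.
  exact: (integrable_bounded (B := `|3 / 4 * x ^+ 2|)).
- apply: (integrable_bounded (B := (th + `|x|) ^+ 2)).
    apply: (measurable_kernel_Rintegral Q mD (f := fun _ z => (M z - x) ^+ 2) _ (fun _ z => fB z)).
    exact: (measurableT_comp mf measurable_snd).
  by move=> t; exact: Rintegral_norm_le.
move=> t _; rewrite /answer.
set q := kprob Q _.
have iM : rint q M := integrable_bounded mM Mth.
have -> : 3 / 4 * x ^+ 2 - x * \int[q]_z M z = \int[q]_z (3 / 4 * x ^+ 2 - x * M z).
  rewrite RintegralB //; last exact: rintZ.
    by rewrite Rintegral_prob_cst RintegralZl.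
  exact: (integrable_bounded (B := `|3 / 4 * x ^+ 2|)).
apply: le_Rintegral => //.
- apply: rintB; last exact: rintZ.
  exact: (integrable_bounded (B := `|3 / 4 * x ^+ 2|)).
- exact: integrable_bounded mf fB.
move=> z _; have := sqr_ge0 (2^-1 * x - M z); nra.
Qed.

Definition bit_weight (sg : R) (v : bool) : R := (1 + (if v then sg else - sg)) / 2.

Lemma bits_prob (sg : R) (w : {ffun 'I_n -> bool}) : -1 <= sg <= 1 ->
  \int[P]_t ((bits sg t == w)%:R : R) = \prod_i bit_weight sg (w i).
Proof.
move=> /andP[h1 h2].
have c01 : 0 <= (1 + sg) / 2 <= 1 by apply/andP; split; lra.
pose c := (1 + sg) / 2.
pose A (j : J) : set R := if j is inr i then [set u | (u < c)%R = w i] else setT.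
have mlt : measurable [set u : R | u < c].
  by rewrite (_ : [set u | _] = `]-oo, c[%classic).
have mge : measurable [set u : R | (u < c)%R = false].
  rewrite (_ : [set u | _] = ~` [set u : R | u < c]); first exact: measurableC.
  by apply/seteqP; split=> u /=; [move=> ->|move/negP/negbTE].
have mA j : measurable (A j).
  by case: j => [ij|i] /=; [exact: measurableT|case: (w i)].
have mR : measurable (rect A) by exact: measurable_rect.
have -> : \int[P]_t ((bits sg t == w)%:R : R) = fine (P (rect A)).
  rewrite /Rintegral -[rect A]setIT -integral_indic //; congr fine.
  apply: eq_integral => t _; rewrite indicE; congr ((nat_of_bool _)%:R%:E).
  apply/idP/idP => [/eqP tw|]; last first.
    rewrite inE => tA; apply/eqP/ffunP => i; rewrite ffunE; exact: (tA (inr i)).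
  by rewrite inE => -[ij|i] //=; rewrite -tw ffunE.
rewrite prodP_rect // big_sumType /= [X in (X * _)%E]big1 ?mul1e; last first.
  by move=> ij _; exact: probability_setT.
have wE i : U01 (A (inr i)) = (bit_weight sg (w i))%:E.
  rewrite /= /bit_weight; case: (w i); first by rewrite unif01_lt.
  rewrite (_ : [set u | _] = ~` [set u : R | u < c]); last first.
    by apply/seteqP; split=> u /=; [move=> ->|move/negP/negbTE].
  transitivity (1 - U01 [set u : R | (u < c)%R])%E; first exact: probability_setC.
  by rewrite unif01_lt // -EFinB; congr (_%:E); rewrite /c; field.
by rewrite (eq_bigr _ (fun i _ => wE i)) prodEFin.
Qed.
(** The left-hand side is the chi-square type distance of the two laws of the bits
    relative to the uniform law; the sums over bit vectors factor into products
    over the users. *)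
Lemma sum_bit_weight_sqr :
  \sum_(w : {ffun 'I_n -> bool}) 2 ^+ n *
    (\prod_i bit_weight s (w i) - \prod_i bit_weight (- s) (w i)) ^+ 2 =
  2 * ((1 + s ^+ 2) ^+ n - (1 - s ^+ 2) ^+ n).
Proof.
have dist (F : bool -> R) : \sum_(w : {ffun 'I_n -> bool}) \prod_i F (w i) =
    (F true + F false) ^+ n.
  rewrite -(bigA_distr_bigA (fun _ : 'I_n => F)) prodr_const card_ord.
  by congr (_ ^+ n); rewrite big_bool.
transitivity (\sum_(w : {ffun 'I_n -> bool})
  (\prod_i (2 * bit_weight s (w i) ^+ 2) + \prod_i (2 * bit_weight (- s) (w i) ^+ 2) -
   2 * \prod_i (2 * (bit_weight s (w i) * bit_weight (- s) (w i))))).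
  apply: eq_bigr => w _; rewrite !big_split /= !prodr_const card_ord.
  by ring.
rewrite sumrB big_split /= -mulr_sumr.
rewrite (dist (fun v => 2 * bit_weight s v ^+ 2)).
rewrite (dist (fun v => 2 * bit_weight (- s) v ^+ 2)).
rewrite (dist (fun v => 2 * (bit_weight s v * bit_weight (- s) v))).
rewrite /bit_weight !opprK.
have -> : 2 * ((1 + s) / 2) ^+ 2 + 2 * ((1 + - s) / 2) ^+ 2 = 1 + s ^+ 2 by field.
have -> : 2 * ((1 + - s) / 2) ^+ 2 + 2 * ((1 + s) / 2) ^+ 2 = 1 + s ^+ 2 by field.
have -> : 2 * ((1 + s) / 2 * ((1 + - s) / 2)) + 2 * ((1 + - s) / 2 * ((1 + s) / 2)) = 1 - s ^+ 2.
  by field.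
ring.
Qed.

(** Given the bits, the answer depends on the design only, and the design is
    independent of the bits. *)
Lemma mean_answer_sum (sg : R) : -1 <= sg <= 1 ->
  mean_answer sg = \sum_w (\int[P]_t answer (dat t w)) * \prod_i bit_weight sg (w i).
Proof.
move=> sg01.
pose A (j : J) := if j is inl _ then true else false.
have mb w : measurable_fun setT (fun t : T => (bits sg t == w)%:R : R).
  rewrite (_ : (fun t => _) = fun t : T => \prod_i
      (if ((co t (inr i) < (1 + sg) / 2)%R == w i) then 1 else 0)).
    apply: measurable_prod => i _.
    have -> : (fun t : T => if ((co t (inr i) < (1 + sg) / 2)%R == w i) then 1 else 0 : R) =
        (fun u : R => if (u < (1 + sg) / 2)%R then (if w i then 1 else 0) else (if w i then 0 else 1))
          \o (fun t => co t (inr i)).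
      by apply/funext => t /=; case: (_ < _)%R; case: (w i).
    by apply: measurableT_comp; [exact: measurable_lt_bool|exact: measurable_co].
  apply/funext => t; have [<-|] := eqVneq.
    by rewrite big1 // => i _; rewrite ffunE eqxx.
  move=> /eqP nw; have [i ni] : exists i, bit sg t i != w i.
    apply/existsP; apply: contra_notT nw => /existsPn h; apply/ffunP => i.
    by rewrite ffunE; apply/eqP; move: (h i); rewrite negbK.
  by rewrite (bigD1 i) //= (negbTE ni) mul0r.
have b1 (t : T) w : `|(bits sg t == w)%:R : R| <= 1 by case: (_ == _); rewrite ?normr0 ?normr1.
have ma w := measurable_answer (measurable_two_point_data_cst w).
transitivity (\int[P]_t \sum_w (answer (dat t w) * (bits sg t == w)%:R)).
  apply: eq_Rintegral => t _; rewrite (bigD1 (bits sg t)) //= eqxx mulr1 big1 ?addr0 //.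
  by move=> w /negbTE; rewrite eq_sym => ->; rewrite mulr0.
rewrite Rintegral_sum; last first.
  move=> w _; apply: (integrable_bounded (B := th * 1)); first exact: measurable_funM.
  by move=> t; rewrite normrM ler_pM // answer_le.
apply: eq_bigr => w _; rewrite -bits_prob //.
apply: (@Rintegral_indep _ _ _ A _ _ th 1) => //.
- by move=> t; exact: answer_le.
- move=> t t' tt'; congr answer; apply: eq_from_tnth => i; rewrite !tnth_mktuple.
  by apply: eq_from_tnth => j; rewrite !tnth_mktuple tt'.
- move=> t t' tt'; congr ((_ == _)%:R); apply/ffunP => i; rewrite !ffunE /bit.
  by rewrite tt'.
Qed.

(** With p and q the laws of the bits, the difference is sum_w h(w) (p(w) - q(w))
    with h bounded by th; the inequality 2 y <= 1/N + N y^2 with N = 2^n bounds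
    it by th / 2 times one plus the chi-square distance. *)
Lemma mean_answer_chi2 : 8 * n%:R * s ^+ 2 = 1 ->
  mean_answer s - mean_answer (- s) <= th.
Proof.
have sp := s_gt0; have su := s_le1.
have s1 : -1 <= s <= 1 by apply/andP; split; lra.
have sN1 : -1 <= - s <= 1 by apply/andP; split; lra.
move=> hs; rewrite !mean_answer_sum //.
rewrite -sumrB.
have th0 : 0 <= th by rewrite (le_trans _ (Mth point)).
pose D (w : {ffun 'I_n -> bool}) := \prod_i bit_weight s (w i) - \prod_i bit_weight (- s) (w i).
have N0 : 0 < 2 ^+ n :> R by rewrite exprn_gt0.
have le_w w : (\int[P]_t answer (dat t w)) * \prod_i bit_weight s (w i) -
    (\int[P]_t answer (dat t w)) * \prod_i bit_weight (- s) (w i) <=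
    th / 2 * ((2 ^+ n)^-1 + 2 ^+ n * D w ^+ 2).
  rewrite -mulrBr -/(D w); set h := (\int[P]_t _).
  have hth : `|h| <= th.
    apply: Rintegral_norm_le; first exact: measurable_answer (measurable_two_point_data_cst w).
    by move=> t; exact: answer_le.
  apply: (le_trans (ler_norm _)); rewrite normrM.
  apply: (@le_trans _ _ (th * `|D w|)); first exact: ler_wpM2r.
  rewrite -mulrA ler_wpM2l //; rewrite -[D w ^+ 2]real_normK ?num_real //.
  exact: young.
apply: (le_trans (ler_sum _ (fun w _ => le_w w))).
rewrite -mulr_sumr big_split /= sum_bit_weight_sqr sumr_const card_ffun card_bool card_ord.
have -> : (2 ^+ n)^-1 *+ (2 ^ n)%N = 1 :> R.
  by rewrite -[LHS]mulr_natr natrX mulVf // gt_eqF.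
have n0 : 0 < n%:R :> R by rewrite lt_neqAle ler0n andbT eq_sym; apply/eqP => n0; move: hs; rewrite n0; lra.
have sn : n%:R * s ^+ 2 = 8^-1 by lra.
have up : (1 + s ^+ 2) ^+ n <= 8 / 7.
  apply: (@le_trans _ _ (expR (s ^+ 2) ^+ n)).
    by rewrite lerXn2r ?nnegrE ?expR_ge0 ?expR_ge1Dx // addr_ge0 // sqr_ge0.
  rewrite -expRM_natr mulrC sn.
  have := expR_ge1Dx (- 8^-1 : R); rewrite expRN => h.
  have e0 := expR_gt0 (8^-1 : R).
  have : 7 / 8 * expR 8^-1 <= 1 :> R.
    by rewrite -ler_pdivlMr // div1r; apply: le_trans h; lra.
  lra.
have dn : 7 / 8 <= (1 - s ^+ 2) ^+ n.
  have bern k : 1 - k%:R * s ^+ 2 <= (1 - s ^+ 2) ^+ k.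
    elim: k => [|k IH]; first by rewrite mul0r subr0.
    have s2 := sqr_ge0 s; have s21 : 0 <= 1 - s ^+ 2 by rewrite subr_ge0 expr_le1 // ltW.
    rewrite [leRHS]exprS; apply: (le_trans _ (ler_wpM2l s21 IH)).
    have k0 : 0 <= k%:R :> R by [].
    have -> : k.+1%:R = k%:R + 1 :> R by rewrite natr1.
    have := mulr_ge0 k0 (mulr_ge0 s2 s2); lra.
  by apply: le_trans (bern n); rewrite sn; lra.
have : 0 <= th / 2 by lra.
nra.
Qed.

(** The bits of one sign are turned into those of the other one user at a time.
    Each change costs exp eps - 1 + 2 delta by privacy and is needed with
    probability s only. *)
Lemma mean_answer_privacy (eps delta : R) : is_CDP eps delta Q -> 0 <= eps -> 0 <= delta ->
  n%:R * s * (expR eps - 1 + 2 * delta) <= 1 ->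
  mean_answer s - mean_answer (- s) <= th.
Proof.
move=> hQ eps0 delta0 hs.
have [s1 sN1] : -1 <= s <= 1 /\ -1 <= - s <= 1.
  by have sp := s_gt0; have su := s_le1; split; apply/andP; split; lra.
have th0 : 0 <= th by rewrite (le_trans _ (Mth point)).
pose c := th * (expR eps - 1 + 2 * delta).
have e1 : 1 <= expR eps by rewrite -expR0 ler_expR.
have c0 : 0 <= c by rewrite mulr_ge0 // addr_ge0 // ?subr_ge0 // mulr_ge0.
have valid (t : T) w : valid_dataset (dat t w).
  by move=> i j; rewrite !tnth_mktuple; exact: clip01_itv.
have step (t : T) (w w' : {ffun 'I_n -> bool}) k : (forall i, i != k -> w i = w' i) ->
    answer (dat t w) - answer (dat t w') <= c * (w k != w' k)%:R.
  move=> ww'; have [eqk|nk] := eqVneq (w k) (w' k).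
    have -> : w = w' by apply/ffunP => i; have [->//|/ww'] := eqVneq i k.
    by rewrite subrr mulr0.
  have adj (v v' : {ffun 'I_n -> bool}) : (forall i, i != k -> v i = v' i) -> adjacent (dat t v) (dat t v').
    move=> vv'; rewrite /adjacent -(cards1 k); apply: subset_leq_card.
    apply/fintype.subsetP => i; rewrite !inE; apply: contraR => /vv' vi.
    by apply/eqP; rewrite !tnth_mktuple vi.
  rewrite mulr1 lerBlDl.
  have dp := @dp_Rintegral _ _ _ (kprob Q (dat t w)) (kprob Q (dat t w')) _ _ _ _ e1 delta0 th0
    (hQ _ _ (valid t w) (valid t w') (adj _ _ ww'))
    (hQ _ _ (valid t w') (valid t w) (adj _ _ (fun i ik => esym (ww' i ik)))) mM Mth.
  apply: (le_trans dp); rewrite -/(answer _) -!addrA lerD2l.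
  have le1 : \int[kprob Q (dat t w')]_z `|M z| <= th.
    apply: (le_trans (ler_norm _)); apply: Rintegral_norm_le.
      exact: measurableT_comp.
    by move=> z; rewrite normr_id.
  apply: (@le_trans _ _ ((expR eps - 1) * th + 2 * (delta * th))).
    by rewrite lerD2r ler_wpM2l // subr_ge0.
  by rewrite /c; lra.
have hyb (t : T) (w w' : {ffun 'I_n -> bool}) :
    answer (dat t w) - answer (dat t w') <= \sum_k c * (w k != w' k)%:R.
  (* the first k users already have their new bit *)
  pose H k : {ffun 'I_n -> bool} := [ffun i : 'I_n => if (i < k)%N then w i else w' i].
  have Hn : H n = w by apply/ffunP => i; rewrite ffunE ltn_ord.
  have H0 : H 0%N = w' by apply/ffunP => i; rewrite ffunE.
  rewrite -{1}Hn -{1}H0 -(telescope_sumr (fun k => answer (dat t (H k)))) // big_mkord.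
  apply: ler_sum => k _; apply: (le_trans (step t _ _ k _)).
    move=> i ik; rewrite !ffunE ltnS leq_eqVlt; case: eqP => //= eik.
    by move: ik; rewrite (val_inj eik) eqxx.
  by rewrite !ffunE ltnS leqnn ltnn.
have mD sg : measurable_fun setT (fun t : T => answer (dat t (bits sg t))).
  by apply: measurable_answer; exact: measurable_two_point_data.
have iD sg : rint P (fun t : T => answer (dat t (bits sg t))).
  by apply: (integrable_bounded (mD sg)) => t; exact: answer_le.
pose dif (u : R) : R := ((u < (1 + s) / 2)%R)%:R - ((u < (1 + - s) / 2)%R)%:R.
have difE (t : T) k : (bits s t k != bits (- s) t k)%:R = dif (co t (inr k)).
  rewrite !ffunE /bit /dif; case: ltP => h1; case: ltP => h2 /=; rewrite ?subrr ?subr0 //.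
  by move: h2; rewrite ltNge (le_trans _ h1) //; have := s_gt0; lra.
have mdif : measurable_fun setT dif by apply: measurable_funB; exact: measurable_indic_lt.
have difB u : `|dif u| <= 1.
  by rewrite /dif; do 2 case: (_ < _)%R => /=; rewrite ?subrr ?subr0 ?sub0r ?normrN ?normr1 ?normr0.
have Edif : \int[U01]_u dif u = s.
  have ilt (x : R) : rint U01 (fun u => ((u < x)%R)%:R : R).
    apply: (integrable_bounded (B := 1)); first exact: measurable_indic_lt.
    by move=> u; case: (_ < _)%R; rewrite ?normr1 ?normr0.
  rewrite RintegralB // !Rintegral_unif01_lt ?half_itv //; by field.
have idif k : rint P (fun t : T => c * dif (co t (inr k))).
  apply: rintZ; apply: (integrable_bounded (B := 1)) => //.
  exact: (measurableT_comp mdif (measurable_co _)).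
rewrite /mean_answer -RintegralB //.
apply: (@le_trans _ _ (\int[P]_t \sum_k c * dif (co t (inr k)))).
  apply: le_Rintegral => //; first exact: rintB.
    by apply: rint_sum => k _; exact: idif.
  move=> t _; apply: (le_trans (hyb t _ _)); apply: ler_sum => k _.
  by rewrite difE.
rewrite Rintegral_sum; last by move=> k _; exact: idif.
rewrite (eq_bigr (fun _ => c * s)); last first.
  move=> k _; rewrite RintegralZl //; last first.
    apply: (integrable_bounded (B := 1)) => //.
    exact: (measurableT_comp mdif (measurable_co _)).
  by rewrite (@Rintegral_co R J (fun _ => U01) (inr k) dif mdif) Edif.
rewrite sumr_const card_ord -mulr_natl.
have := ler_wpM2l th0 hs; rewrite /c; lra.
Qed.

End bounded_test.

(** The two bounds on the risk, at the signs s and -s, add up to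
    2 r >= 3/2 (s b)^2 - s b * (difference of the mean answers). *)
Lemma two_point_lower (alpha Calpha L CU Cxi r : R) mut :
  0 <= alpha -> 1 < L -> 0 < CU -> 0 < Cxi -> 1 <= Calpha ^+ 2 / pi `^ (2 * alpha) ->
  2 * b <= 1 -> 2 * (2 * b) ^+ 2 <= CU ^+ 2 ->
  estimator mut -> (worst_risk alpha Calpha L CU Cxi Q mut <= r%:E)%E ->
  (forall M : Z -> R, measurable_fun setT M -> (forall z, `|M z| <= s * b) ->
     mean_answer M s - mean_answer M (- s) <= s * b) ->
  (s * b) ^+ 2 / 4 <= r.
Proof.
move=> al0 L1 CU0 Cxi0 hC b1 bCU mmut hr close.
have [s1 sN1] : -1 <= s <= 1 /\ -1 <= - s <= 1.
  by have sp := s_gt0; have su := s_le1; split; apply/andP; split; lra.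
have sb0 : 0 <= s * b by rewrite mulr_ge0 // ltW.
have [M [mM Mth hM]] := estimator_coefficients 1 mmut sb0.
have arm (sg : R) : -1 <= sg <= 1 -> `|sg * b| = s * b ->
    3 / 4 * (sg * b) ^+ 2 - sg * b * mean_answer (M ord0) sg <= r.
  move=> sg1 sgb; apply: (mean_answer_risk (mM ord0) (Mth ord0)).
  have [hS hA] := two_point_assumptions n m b_gt0 sg1 al0 L1 CU0 Cxi0 hC b1 bCU.
  have := worst_risk_ge hS hA hr.
  rewrite [X in risk _ X _ _ _](_ : _ = fun t : T => dat t (bits sg t)); last first.
    by apply/funext => t; exact: two_point_data_eq.
  move=> h; have thb : forall l : 'I_1, `|(fun _ : 'I_1 => sg * b) l| <= s * b by move=> l; rewrite sgb.
  have := risk_trig_ge mmut (@measurable_two_point_data R n m b sg) mM Mth thb (hM _ thb) h.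
  apply: le_trans; rewrite le_eqVlt; apply/orP; left; apply/eqP.
  apply: eq_Rintegral => t _; apply: eq_Rintegral => z _.
  by rewrite big_ord1.
have h1 := arm _ s1 (ger0_norm sb0).
have h2 := arm _ sN1; rewrite mulNr normrN ger0_norm // in h2.
have := h2 erefl; move: h1 (ler_wpM2l sb0 (close _ (mM ord0) (Mth ord0))).
move: (mean_answer _ _) (mean_answer _ _) => x y; rewrite sqrrN; lra.
Qed.

End two_point_risk.

(** * Gaussian moments, shifts and the van Trees identity *)

(** Cauchy-Schwarz, in the form |f| <= (V + f^2 / V) / 2. *)
Lemma Rintegral_abs_le d (T : measurableType d) (R : realType) (P : probability T R)
    (f : T -> R) (V : R) :
  0 < V -> measurable_fun setT f -> rint P (fun t => f t ^+ 2) ->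
  \int[P]_t (f t ^+ 2) <= V ^+ 2 ->
  rint P f /\ \int[P]_t `|f t| <= V.
Proof.
move=> V0 mf f2 fV; have V0' : 0 <= V by exact: ltW.
pose g t := 2^-1 * V + (2 * V)^-1 * f t ^+ 2.
have ig : rint P g.
  apply: rintD; last exact: rintZ.
  by apply: (integrable_bounded (B := `|2^-1 * V|)).
have fg t : `|f t| <= g t.
  rewrite /g -[f t ^+ 2]real_normK ?num_real //; move: `|f t| => x.
  have -> : 2^-1 * V + (2 * V)^-1 * x ^+ 2 = (2 * V)^-1 * (V ^+ 2 + x ^+ 2).
    by field; lra.
  by rewrite -ler_pdivrMl ?invr_gt0 ?mulr_gt0 // invrK; have := sqr_ge0 (V - x); lra.
have if_ : rint P f by apply: rint_le ig _.
split => //; apply: (@le_trans _ _ (\int[P]_t g t)).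
  by apply: le_Rintegral => //; exact: rint_norm.
rewrite /g RintegralD //; last exact: rintZ.
  rewrite Rintegral_prob_cst RintegralZl //.
  have : (2 * V)^-1 * \int[P]_t (f t ^+ 2) <= (2 * V)^-1 * V ^+ 2.
    by rewrite ler_wpM2l // invr_ge0 mulr_ge0.
  have -> : (2 * V)^-1 * V ^+ 2 = 2^-1 * V by field; lra.
  lra.
by apply: (integrable_bounded (B := `|2^-1 * V|)).
Qed.

Section coordinate_reflection.
Context {R : realType} (J : finType) (p : J -> probability R R).
Local Notation P := (prodP p).
Local Notation T := (tup R J).

Lemma dep_on_upd j V (f : T -> V) t u : dep_on (predC1 j) f -> f (upd t j u) = f t.
Proof. by apply=> k kj; rewrite updE (negbTE kj). Qed.

Definition reflect_at j (t : T) : T := upd t j (- co t j).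

Lemma reflect_atE j t k : co (reflect_at j t) k = if k == j then - co t k else co t k.
Proof. by rewrite updE; case: eqP => [->|]. Qed.

Lemma measurable_reflect_at j : measurable_fun setT (reflect_at j).
Proof.
apply: (@measurable_mk _ _ _ _ (fun t k => if k == j then - co t j else co t k)).
move=> k /=; case: (k == j); last exact: measurable_co.
by apply: measurableT_comp => //; exact: measurable_co.
Qed.

Variable j : J.
Hypothesis p_sym : forall A, measurable A -> p j ((fun x : R => - x) @^-1` A) = p j A.

Lemma reflect_at_law B : measurable B -> P (reflect_at j @^-1` B) = P B.
Proof.
apply: prodP_unique; first exact: measurable_reflect_at.
move=> A mA.
pose A' k := if k == j then (fun x : R => - x) @^-1` A k else A k.
have mA' k : measurable (A' k).
  have mN : measurable_fun setT (fun x : R => - x) by exact: measurableT_comp.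
  by rewrite /A'; case: (k == j) => //; rewrite -[X in measurable X]setTI; exact: mN.
have -> : reflect_at j @^-1` rect A = rect A'.
  by apply/seteqP; split=> t h k; have := h k; rewrite reflect_atE /A'; case: (k == j).
rewrite prodP_rect //; apply: eq_bigr => k _; rewrite /A'.
by have [->|//] := eqVneq k j; exact: p_sym.
Qed.

(** Symmetry is what makes scores centered and uncorrelated; it is used through
    the reflection of a single coordinate. *)
Lemma Rintegral_odd (F : T -> R) : rint P F ->
  (forall t, F (reflect_at j t) = - F t) -> \int[P]_t F t = 0.
Proof.
move=> iF odd.
have : \int[P]_t F t = - \int[P]_t F t.
  rewrite -[RHS]mulN1r -RintegralZl //.
  transitivity (\int[P]_t F (reflect_at j t)).
    congr fine; symmetry.
    apply: (integral_law (measurable_reflect_at j) reflect_at_law (f := EFin \o F)).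
    exact: measurable_int iF.
  by apply: eq_Rintegral => t _; rewrite odd mulN1r.
lra.
Qed.

End coordinate_reflection.

Section gaussian_coordinates.
Context {R : realType} (J : finType) (p : J -> probability R R) (s : R).
Hypothesis s_gt0 : 0 < s.
Local Notation N := (real_prob (normal_prob 0 s)).
Local Notation P := (prodP p).
Local Notation T := (tup R J).
Variables (I : finType) (pos : I -> J).
Hypotheses (pos_inj : injective pos) (p_pos : forall i, p (pos i) = N).
Local Notation g i t := (co t (pos i)).

Let mg i : measurable_fun setT (fun t : T => g i t).
Proof. exact: measurable_co. Qed.

Lemma rint_gauss_sqr i : rint P (fun t => g i t ^+ 2).
Proof.
apply/rintP; split; first exact: measurable_funX.
have -> : (\int[P]_t `|g i t ^+ 2|%:E = \int[N]_x (x ^+ 2)%:E)%E.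
  rewrite -(p_pos i) -(ge0_integral_co p (pos i) (F := fun x => (x ^+ 2)%:E)).
  - by apply: eq_integral => t _; rewrite ger0_norm // sqr_ge0.
  - by apply/measurable_EFinP; exact: measurable_funX.
  - by move=> x; rewrite lee_fin sqr_ge0.
by apply: (le_lt_trans (integral_sqr_normal_le s_gt0)); rewrite ltry.
Qed.

Lemma rint_gauss_mul (c : T -> R) (B : R) i k : measurable_fun setT c ->
  (forall t, `|c t| <= B) -> rint P (fun t => c t * (g i t * g k t)).
Proof.
move=> mc cB; apply: (@rint_le _ _ _ _ _ (fun t => B * (g i t ^+ 2 + g k t ^+ 2))).
- by apply: measurable_funM => //; exact: measurable_funM.
- by apply: rintZ; apply: rintD; exact: rint_gauss_sqr.
move=> t; rewrite normrM ler_pM // normrM.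
rewrite -[g i t ^+ 2]real_normK ?num_real // -[g k t ^+ 2]real_normK ?num_real //.
have := sqr_ge0 (`|g i t| - `|g k t|); have := sqr_ge0 `|g i t|; have := sqr_ge0 `|g k t|.
lra.
Qed.

Lemma rint_gauss (c : T -> R) (B : R) i : measurable_fun setT c ->
  (forall t, `|c t| <= B) -> rint P (fun t => c t * g i t).
Proof.
move=> mc cB; apply: (@rint_le _ _ _ _ _ (fun t => B * (1 + g i t ^+ 2))).
- exact: measurable_funM.
- apply: rintZ; apply: rintD; last exact: rint_gauss_sqr.
  by apply: (integrable_bounded (B := 1)) => // t; rewrite normr1.
move=> t; rewrite normrM ler_pM // -[g i t ^+ 2]real_normK ?num_real //.
have := sqr_ge0 (1 - `|g i t|); have := sqr_ge0 `|g i t|; lra.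
Qed.

Lemma gauss_sqr_le (c : T -> R) (B : R) i : measurable_fun setT c ->
  (forall t, `|c t| <= B) -> dep_on (predC1 (pos i)) c ->
  \int[P]_t (c t ^+ 2 * g i t ^+ 2) <= 6 * s ^+ 2 * \int[P]_t (c t ^+ 2).
Proof.
move=> mc cB dc.
have mc2 : measurable_fun setT (fun t => c t ^+ 2) by exact: measurable_funX.
have c2B t : `|c t ^+ 2| <= B ^+ 2.
  by rewrite normrX lerXn2r ?nnegrE // (le_trans _ (cB t)).
have ic : rint P (fun t => c t ^+ 2) := integrable_bounded mc2 c2B.
rewrite -RintegralZl // -lee_fin !fineK_Rintegral; last 2 first.
- exact: rintZ.
- by apply: (rint_gauss_mul i i mc2 c2B).
rewrite (ge0_integral_upd p (pos i)); last 2 first.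
- by apply/measurable_EFinP; apply: measurable_funM => //; exact: measurable_funX.
- by move=> t; rewrite lee_fin mulr_ge0 // sqr_ge0.
apply: ge0_le_integral => //.
- by move=> t _; apply: integral_ge0 => u _; rewrite lee_fin mulr_ge0 // sqr_ge0.
- have h : measurable_fun setT (fun tu : T * R =>
      (c (upd tu.1 (pos i) tu.2) ^+ 2 * g i (upd tu.1 (pos i) tu.2) ^+ 2)%:E).
    apply/measurable_EFinP; apply: measurable_funM.
      exact: (measurableT_comp mc2 (measurable_upd _)).
    by apply: measurable_funX; exact: (measurableT_comp (mg i) (measurable_upd _)).
  apply: (measurable_fun_fubini_tonelli_F (m2 := p (pos i)) _ h).
  by move=> tu; rewrite lee_fin mulr_ge0 // sqr_ge0.
- apply/measurable_EFinP; exact: measurable_funM.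
move=> t _; rewrite p_pos.
apply: (@le_trans _ _ ((c t ^+ 2)%:E * (6 * s ^+ 2)%:E)%E); last by rewrite -EFinM lee_fin mulrC.
apply: le_trans (lee_wpmul2l _ (integral_sqr_normal_le s_gt0)); last by rewrite lee_fin sqr_ge0.
rewrite -ge0_integralZl //; last 3 first.
- by apply/measurable_EFinP; exact: measurable_funX.
- by move=> x _; rewrite lee_fin sqr_ge0.
- by rewrite lee_fin sqr_ge0.
rewrite le_eqVlt; apply/orP; left; apply/eqP; apply: eq_integral => u _.
by rewrite (dep_on_upd _ _ dc) updE eqxx EFinM.
Qed.

(** The cross terms are odd in one of the two Gaussian coordinates, which none of
    the coefficients reads. *)
Lemma gauss_sum_sqr (c : I -> T -> R) (B : R) :
  (forall i, measurable_fun setT (c i)) -> (forall i t, `|c i t| <= B) ->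
  (forall i k, dep_on (predC1 (pos k)) (c i)) ->
  rint P (fun t => (\sum_i c i t * g i t) ^+ 2) /\
  \int[P]_t ((\sum_i c i t * g i t) ^+ 2) <= 6 * s ^+ 2 * \sum_i \int[P]_t (c i t ^+ 2).
Proof.
move=> mc cB dc.
pose f i k t := (c i t * c k t) * (g i t * g k t).
have if_ i k : rint P (f i k).
  apply: (@rint_gauss_mul _ (B * B)); first exact: measurable_funM.
  by move=> t; rewrite normrM ler_pM.
have sqE t : (\sum_i c i t * g i t) ^+ 2 = \sum_i \sum_k f i k t.
  rewrite expr2 mulr_suml; apply: eq_bigr => i _; rewrite mulr_sumr.
  by apply: eq_bigr => k _; rewrite /f; ring.
have isum : rint P (fun t => \sum_i \sum_k f i k t).
  by apply: rint_sum => i _; apply: rint_sum => k _; exact: if_.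
split; first by under [X in rint P X]eq_fun do rewrite sqE.
rewrite (eq_Rintegral _ (fun t _ => sqE t)).
rewrite Rintegral_sum; last by move=> i _; apply: rint_sum => k _; exact: if_.
rewrite mulr_sumr; apply: ler_sum => i _.
rewrite Rintegral_sum; last by move=> k _; exact: if_.
rewrite (bigD1 i) //= big1 ?addr0.
  apply: le_trans (gauss_sqr_le (mc i) (cB i) (dc i i)).
  rewrite le_eqVlt; apply/orP; left; apply/eqP; apply: eq_Rintegral => t _.
  by rewrite /f -!expr2.
move=> k ki; apply: (@Rintegral_odd _ _ _ (pos i)) => //.
  by move=> A mA; rewrite p_pos; exact: normal_symmetric.
move=> t; rewrite /f !(dep_on_upd _ _ (dc _ i)) !reflect_atE eqxx (inj_eq pos_inj) (negbTE ki).
ring.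
Qed.

End gaussian_coordinates.

Section gaussian_shift.
Context {R : realType} (J : finType) (p : J -> probability R R) (s : R).
Hypothesis s_gt0 : 0 < s.
Local Notation N := (real_prob (normal_prob 0 s)).
Local Notation P := (prodP p).
Local Notation T := (tup R J).
Variables (I : finType) (pos : I -> J).
Hypotheses (pos_inj : injective pos) (p_pos : forall i, p (pos i) = N).
Local Notation g i t := (co t (pos i)).
Definition noiseless : pred J := fun j => j \notin codom pos.

Lemma noiseless_pos V (f : T -> V) i : dep_on noiseless f -> dep_on (predC1 (pos i)) f.
Proof.
by apply: dep_onS => j; apply: contraNneq => ->; exact: codom_f.
Qed.

Lemma noiseless_upd (V : Type) (f : T -> V) (i : I) (t : T) (u : R) :
  dep_on noiseless f -> f (upd t (pos i) u) = f t.
Proof. by move=> df; apply: dep_on_upd; exact: noiseless_pos. Qed.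

Variable v : I -> T -> R.
Hypotheses (mv : forall i, measurable_fun setT (v i))
  (dv : forall i, dep_on noiseless (v i)).

Definition shift (r : seq I) (t : T) : T :=
  mk (fun j => co t j + \sum_(i <- r | pos i == j) v i t).

(** Density of the law of the shifted noise with respect to the original one. *)
Definition likelihood (r : seq I) (t : T) : R :=
  \prod_(i <- r) expR (v i t * g i t / s ^+ 2 - v i t ^+ 2 / (s ^+ 2 *+ 2)).

Lemma shift_noiseless r V (f : T -> V) t : dep_on noiseless f -> f (shift r t) = f t.
Proof.
apply=> j jn; rewrite coK big1_seq ?addr0 // => i /andP[/eqP ij _].
by move: jn; rewrite /noiseless -ij codom_f.
Qed.

Lemma co_shift r t i : uniq r -> g i (shift r t) = g i t + (if i \in r then v i t else 0).
Proof.
move=> ur; rewrite coK; congr (_ + _).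
under eq_bigl do rewrite (inj_eq pos_inj).
case: ifPn => ir; first by rewrite big_mkcond (bigD1_seq i) //= eqxx big1 ?addr0 // => k /negbTE ->.
by rewrite big1_seq // => k /andP[/eqP -> kr]; rewrite kr in ir.
Qed.

Lemma measurable_shift r : measurable_fun setT (shift r).
Proof.
apply: (@measurable_mk _ _ _ _ (fun t j => co t j + \sum_(i <- r | pos i == j) v i t)).
move=> j; apply: measurable_funD; first exact: measurable_co.
rewrite (_ : (fun t => _) = fun t => \sum_(i <- r) (if pos i == j then v i t else 0)).
  by apply: measurable_sum => i; case: (pos i == j).
by apply/funext => t; rewrite big_mkcond.
Qed.

Lemma measurable_likelihood r : measurable_fun setT (likelihood r).
Proof.
apply: measurable_prod => i _; apply: measurableT_comp => //.
apply: measurable_funB; apply: measurable_funM => //.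
  by apply: measurable_funM => //; exact: measurable_co.
exact: measurable_funX.
Qed.

Lemma likelihood_ge0 r t : 0 <= likelihood r t.
Proof. by apply: prodr_ge0 => i _; exact: expR_ge0. Qed.

(** Girsanov formula, one Gaussian coordinate after the other; the drift does not
    read the noise, so the steps do not interact. *)
Lemma ge0_integral_shift r (F : T -> \bar R) : uniq r -> measurable_fun setT F ->
  (forall t, 0 <= F t)%E ->
  (\int[P]_t F (shift r t) = \int[P]_t (F t * (likelihood r t)%:E))%E.
Proof.
elim: r F => [|i r IH] F.
  move=> _ mF F0; apply: eq_integral => t _.
  rewrite /likelihood big_nil mule1; congr F.
  by apply: co_inj => j; rewrite coK big_nil addr0.
move=> /= /andP[ir ur] mF F0.
pose F1 t := F (upd t (pos i) (g i t + v i t)).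
have mF1 : measurable_fun setT F1.
  have m1 : measurable_fun setT (fun t : T => (t, g i t + v i t)).
    by apply: measurable_fun_pair => //; apply: measurable_funD => //; exact: measurable_co.
  exact: (measurableT_comp mF (measurableT_comp (measurable_upd (pos i)) m1)).
transitivity (\int[P]_t F1 (shift r t))%E.
  apply: eq_integral => t _; congr F; apply: co_inj => j.
  rewrite updE !coK big_cons; case: (eqVneq j (pos i)) => [->|ji].
    by rewrite (shift_noiseless _ _ (dv i)) addrA addrAC.
  by [].
rewrite IH //; last by move=> t; exact: F0.
have lrE t u : likelihood r (upd t (pos i) u) = likelihood r t.
  rewrite /likelihood; apply: eq_big_seq => k kr.
  rewrite (noiseless_upd _ _ _ (dv k)) updE (inj_eq pos_inj).
  by case: eqP => // ki; rewrite -ki kr in ir.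
have mL r' : measurable_fun setT (fun t => (likelihood r' t)%:E).
  by apply/measurable_EFinP; exact: measurable_likelihood.
rewrite (ge0_integral_upd p (pos i)); last 2 first.
- by apply: emeasurable_funM.
- by move=> t; rewrite mule_ge0 // ?lee_fin ?likelihood_ge0 //; exact: F0.
rewrite [RHS](ge0_integral_upd p (pos i)); last 2 first.
- by apply: emeasurable_funM.
- by move=> t; rewrite mule_ge0 // ?lee_fin ?likelihood_ge0.
apply: eq_integral => t _; rewrite p_pos.
have mFu : measurable_fun setT (fun u => F (upd t (pos i) u)).
  have m1 : measurable_fun setT (fun u : R => (t, u)) by exact: measurable_fun_pair.
  exact: (measurableT_comp mF (measurableT_comp (measurable_upd (pos i)) m1)).
transitivity (\int[N]_u (F (upd t (pos i) (u + v i t)) * (likelihood r t)%:E))%E.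
  apply: eq_integral => u _; rewrite lrE /F1; congr (F _ * _)%E.
  apply: co_inj => j; rewrite !updE eqxx; case: (j == _) => //.
  by rewrite (noiseless_upd _ _ _ (dv i)).
rewrite (ge0_integral_normal_shift s_gt0 (v i t)
  (f := fun x => (F (upd t (pos i) x) * (likelihood r t)%:E)%E)).
- apply: eq_integral => u _; rewrite [in RHS]/likelihood big_cons
    -/(likelihood r (upd t (pos i) u)) lrE.
  rewrite -muleA -EFinM (noiseless_upd _ _ _ (dv i)) updE eqxx.
  by rewrite mulrC.
- by apply: emeasurable_funM.
- by move=> x; rewrite mule_ge0 // lee_fin likelihood_ge0.
Qed.

Lemma Rintegral_shift r (F : T -> R) : uniq r -> measurable_fun setT F ->
  rint P (fun t => F (shift r t)) ->
  rint P (fun t => F t * likelihood r t) /\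
  \int[P]_t F (shift r t) = \int[P]_t (F t * likelihood r t).
Proof.
move=> ur mF iF; have mL := measurable_likelihood r; have mS := measurable_shift r.
have part (G : T -> R) : measurable_fun setT G -> (forall t, 0 <= G t <= `|F t|) ->
    rint P (fun t => G t * likelihood r t) /\
    rint P (fun t => G (shift r t)) /\
    \int[P]_t G (shift r t) = \int[P]_t (G t * likelihood r t).
  move=> mG GF.
  have h : (\int[P]_t (G (shift r t))%:E = \int[P]_t (G t * likelihood r t)%:E)%E.
    rewrite (ge0_integral_shift ur (F := EFin \o G)) //.
      by apply/measurable_EFinP.
    by move=> t; rewrite lee_fin; case/andP: (GF t).
  have G0 t : 0 <= G t by case/andP: (GF t).
  have iG : rint P (fun t => G (shift r t)).
    apply: rint_le (rint_norm iF) _; first exact: measurableT_comp.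
    by move=> t; rewrite (ger0_norm (G0 _)); case/andP: (GF (shift r t)).
  split; last by split => //; congr fine.
  apply/rintP; split; first exact: measurable_funM.
  under eq_integral do rewrite ger0_norm ?mulr_ge0 ?likelihood_ge0 //.
  by rewrite -h; case/integrableP: iG => _; under eq_integral do rewrite /= ger0_norm //.
(* the nonnegative case applies to both parts of F *)
pose Fp t := Num.max (F t) 0; pose Fn t := Num.max (- F t) 0.
have FE t : F t = Fp t - Fn t.
  by rewrite /Fp /Fn /Num.max; do 2 case: ltP => ?; lra.
have [||ip [jp hp]] := part Fp.
- exact: measurable_maxr.
- by move=> t; rewrite /Fp le_max lexx orbT ge_max ler_norm normr_ge0.
have [||im [jn hn]] := part Fn.
- by apply: measurable_maxr => //; exact: measurableT_comp.
- by move=> t; rewrite /Fn le_max lexx orbT ge_max -normrN ler_norm normr_ge0.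
have e1 t : F t * likelihood r t = Fp t * likelihood r t - Fn t * likelihood r t.
  by rewrite -mulrBl -FE.
split; first by under [X in rint P X]eq_fun do rewrite e1; exact: rintB.
under eq_Rintegral do rewrite FE.
by rewrite RintegralB // hp hn -RintegralB //; apply: eq_Rintegral => t _; rewrite e1.
Qed.

End gaussian_shift.

Section van_trees.
Context {R : realType}.
Local Notation leb := (@lebesgue_measure R).

Lemma lt_oppr_id (a : R) : 0 < a -> - a < a.
Proof. by move=> a0; rewrite gtrN. Qed.

Definition prior (a : R) (a0 : 0 < a) : probability R R := unif (lt_oppr_id a0).

(** Likelihood of a shift by u times a fixed direction, S and Q being the linear
    and quadratic statistics of the noise. *)
Definition tilt (S Q u : R) : R := expR (u * S - u ^+ 2 * (2^-1 * Q)).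

Definition tilted_score (a S Q u : R) : R :=
  ((a ^+ 2 - u ^+ 2) * (S - u * Q) - 2 * u) * tilt S Q u.

(** The factor k lets the integral below be used with a coefficient that is
    constant in u, without an integrability argument. *)
Lemma is_derive_tilt (k a S Q u : R) :
  is_derive u 1 (fun u => k * ((a ^+ 2 - u ^+ 2) * tilt S Q u)) (k * tilted_score a S Q u).
Proof.
rewrite /tilt; apply: is_derive_eq.
rewrite /tilted_score /tilt /GRing.scale /=; by field.
Qed.

Lemma continuous_tilted_score (k a S Q : R) : continuous (fun u => k * tilted_score a S Q u).
Proof.
move=> u; apply: cvgM; first exact: cvg_cst.
rewrite /tilted_score /tilt.
have cu : (fun x : R => x) @ u --> u by exact: cvg_id.
have cu2 : (fun x : R => x ^+ 2) @ u --> u ^+ 2 by exact: exprn_continuous.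
apply: cvgM; first apply: cvgB.
- apply: cvgM; apply: cvgB => //; try exact: cvg_cst.
  by apply: cvgM => //; exact: cvg_cst.
- by apply: cvgM => //; exact: cvg_cst.
have c : (fun x : R => x * S - x ^+ 2 * (2^-1 * Q)) @ u --> u * S - u ^+ 2 * (2^-1 * Q).
  by apply: cvgB; apply: cvgM => //; exact: cvg_cst.
exact: (cvg_comp _ _ c (@continuous_expR R _)).
Qed.

(** The integrand is the derivative of a function that vanishes at -a and a, thanks
    to the weight a^2 - u^2. *)
Lemma integral_tilted_score (k a S Q : R) (a0 : 0 < a) :
  (\int[prior a0]_u (k * tilted_score a S Q (clip a u))%:E = 0)%E.
Proof.
have cf : continuous (fun u => k * tilted_score a S Q u) by exact: continuous_tilted_score.
have clipE (u : R) : u \in `[- a, a]%classic -> clip a u = u.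
  rewrite inE /= in_itv /= => /andP[h1 h2]; apply: clip_id; rewrite ler_norml h1 //.
have mf : measurable_fun setT (fun u => k * tilted_score a S Q u) by exact: continuous_measurable_fun.
have ifc : leb.-integrable `[- a, a] (fun u => (k * tilted_score a S Q (clip a u))%:E).
  have i0 : leb.-integrable `[- a, a] (EFin \o (fun u => k * tilted_score a S Q u)).
    apply: continuous_compact_integrable; first exact: segment_compact.
    exact: continuous_subspaceT.
  move: i0; apply: eq_integrable; first by [].
  by move=> u ua; rewrite /= clipE.
rewrite integral_unif //; last first.
  by apply/measurable_EFinP; exact: (measurableT_comp mf (@measurable_clip R a)).
rewrite (_ : (\int[leb]_(x in _) _ = 0)%E) ?mule0 //.
transitivity (\int[leb]_(u in `[(- a)%R, a]) (k * tilted_score a S Q u)%:E)%E.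
  by apply: eq_integral => u ua; rewrite clipE.
rewrite (integral_derive (lt_oppr_id a0) (is_derive_tilt k a S Q) cf).
by rewrite sqrrN subrr !mul0r !mulr0 subrr.
Qed.

Lemma Rintegral_prior_sqr (a : R) (a0 : 0 < a) : \int[prior a0]_u (clip a u ^+ 2) = a ^+ 2 / 3.
Proof.
have clipE (u : R) : u \in `[- a, a]%classic -> clip a u = u.
  by rewrite inE /= in_itv /= => /andP[h1 h2]; apply: clip_id; rewrite ler_norml h1.
have dF (u : R) : is_derive u 1 (fun u : R => u ^+ 3 / 3) (u ^+ 2).
  by apply: is_derive_eq; rewrite /GRing.scale /=; field.
have cf : continuous (fun u : R => u ^+ 2) by exact: exprn_continuous.
have i0 : leb.-integrable `[- a, a] (EFin \o (fun u : R => u ^+ 2)).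
  apply: continuous_compact_integrable; first exact: segment_compact.
  exact: continuous_subspaceT.
rewrite /Rintegral integral_unif; last 2 first.
- by apply/measurable_EFinP; apply: measurable_funX; exact: measurable_clip.
- move: i0; apply: eq_integrable; first by [].
  by move=> u ua; rewrite /= clipE.
transitivity (fine ((a - - a)^-1%:E * \int[leb]_(u in `[(- a)%R, a]) (u ^+ 2)%:E)%E).
  by congr (fine (_ * _)%E); apply: eq_integral => u ua; rewrite clipE.
rewrite (integral_derive (lt_oppr_id a0) dF cf) -EFinM /=.
by field; lra.
Qed.

End van_trees.

Section score_identity.
Context {R : realType} (J : finType) (p : J -> probability R R) (s a : R).
Hypotheses (s_gt0 : 0 < s) (a_gt0 : 0 < a).
Local Notation P := (prodP p).
Local Notation T := (tup R J).
Variables (I : finType) (pos : I -> J) (jl : J).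
Hypotheses (pos_inj : injective pos)
  (p_pos : forall i, p (pos i) = real_prob (normal_prob 0 s))
  (jl_noiseless : noiseless pos jl) (p_jl : p jl = prior a_gt0).
Variables (psi : I -> T -> R) (B : R).
Hypotheses (mpsi : forall i, measurable_fun setT (psi i)) (psiB : forall i t, `|psi i t| <= B)
  (dpsi : forall i, dep_on (predI (noiseless pos) (predC1 jl)) (psi i)).
Local Notation g i t := (co t (pos i)).

Definition param t : R := clip a (co t jl).
Definition drift i t : R := param t * psi i t.
Definition score t : R := \sum_i psi i t * g i t / s ^+ 2.
Definition info t : R := \sum_i psi i t ^+ 2 / s ^+ 2.

Lemma measurable_param : measurable_fun setT param.
Proof. by apply: measurableT_comp; [exact: measurable_clip|exact: measurable_co]. Qed.

Lemma param_le t : `|param t| <= a.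
Proof. by apply: clip_le; exact: ltW. Qed.

Let dpsi_noiseless i : dep_on (noiseless pos) (psi i).
Proof. by apply: dep_onS (dpsi i) => j /andP[]. Qed.

Let dpsi_jl i t u : psi i (upd t jl u) = psi i t.
Proof. by apply: dep_on_upd; apply: dep_onS (dpsi i) => j /andP[]. Qed.

Let d_param : dep_on (noiseless pos) param.
Proof. by move=> t t' tt'; rewrite /param tt'. Qed.

Let d_drift i : dep_on (noiseless pos) (drift i).
Proof. by move=> t t' tt'; rewrite /drift (d_param tt') (dpsi_noiseless i tt'). Qed.

Let m_drift i : measurable_fun setT (drift i).
Proof. by apply: measurable_funM => //; exact: measurable_param. Qed.

Let sh := shift pos drift (enum I).

Lemma drifted_co i t : g i (sh t) = g i t + param t * psi i t.
Proof. by rewrite (co_shift pos_inj) ?enum_uniq // mem_enum. Qed.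

Let likelihoodE t : likelihood s pos drift (enum I) t = tilt (score t) (info t) (param t).
Proof.
rewrite /likelihood /tilt -expR_sum big_enum /=; congr expR.
rewrite /score /info !mulr_sumr -sumrB; apply: eq_bigr => i _; rewrite /drift.
have s0 : s != 0 by rewrite gt_eqF.
by field.
Qed.

Lemma measurable_score : measurable_fun setT score.
Proof.
apply: measurable_sum => i; apply: measurable_funM => //.
by apply: measurable_funM => //; exact: measurable_co.
Qed.

Lemma rint_score (c : T -> R) (C : R) : measurable_fun setT c -> (forall t, `|c t| <= C) ->
  rint P (fun t => c t * score t).
Proof.
move=> mc cC; under [X in rint P X]eq_fun do rewrite /score mulr_sumr.
apply: rint_sum => i _.
rewrite (_ : (fun t => _) = fun t => (c t * psi i t / s ^+ 2) * g i t); last first.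
  by apply/funext => t; ring.
apply: (@rint_gauss _ _ _ _ s_gt0 _ _ p_pos _ (C * B * `|(s ^+ 2)^-1|)).
  by apply: measurable_funM => //; exact: measurable_funM.
by move=> t; rewrite !normrM !ler_pM // mulr_ge0.
Qed.

(** Shifting back the noise moves the parameter from the data f to the likelihood,
    in which the integral over the parameter is that of an exact derivative. *)
Lemma score_by_parts (f : T -> R) (C : R) : measurable_fun setT f ->
  (forall t, `|f t| <= C) -> dep_on (predC1 jl) f ->
  \int[P]_t (f (sh t) * (a ^+ 2 - param t ^+ 2) * score t) =
  \int[P]_t (2 * (param t * f (sh t))).
Proof.
move=> mf fC df.
have msh : measurable_fun setT sh by exact: measurable_shift.
have mfs : measurable_fun setT (fun t => f (sh t)) by exact: measurableT_comp.
have minfo : measurable_fun setT info.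
  by apply: measurable_sum => i; apply: measurable_funM => //; exact: measurable_funX.
have mp := measurable_param; have ms := measurable_score.
have mw : measurable_fun setT (fun t => a ^+ 2 - param t ^+ 2).
  by apply: measurable_funB => //; exact: measurable_funX.
have wa t : `|a ^+ 2 - param t ^+ 2| <= a ^+ 2.
  have h : 0 <= param t ^+ 2 <= a ^+ 2.
    by rewrite sqr_ge0 -[param t ^+ 2]real_normK ?num_real // lerXn2r ?nnegrE ?param_le // ltW.
  by case/andP: h => h1 h2; rewrite ger0_norm; lra.
have parE t : param (sh t) = param t by apply: shift_noiseless; exact: d_param.
have psiE i t : psi i (sh t) = psi i t by apply: shift_noiseless; exact: dpsi_noiseless.
pose F t := f t * ((a ^+ 2 - param t ^+ 2) * (score t - param t * info t) - 2 * param t).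
have Fsh t : F (sh t) = f (sh t) * (a ^+ 2 - param t ^+ 2) * score t - 2 * (param t * f (sh t)).
  rewrite /F parE.
  have -> : score (sh t) = score t + param t * info t.
    rewrite /score /info mulr_sumr -big_split /=; apply: eq_bigr => i _.
    by rewrite drifted_co psiE; ring.
  have -> : info (sh t) = info t.
    by apply: eq_bigr => i _; rewrite psiE.
  ring.
have i1 : rint P (fun t => f (sh t) * (a ^+ 2 - param t ^+ 2) * score t).
  apply: (@rint_score _ (C * a ^+ 2)); first exact: measurable_funM.
  by move=> t; rewrite normrM ler_pM.
have i2 : rint P (fun t => 2 * (param t * f (sh t))).
  apply: rintZ; apply: (integrable_bounded (B := a * C)); first exact: measurable_funM.
  by move=> t; rewrite normrM ler_pM // param_le.
have mF : measurable_fun setT F.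
  apply: measurable_funM => //; apply: measurable_funB; last exact: measurable_funM.
  by apply: measurable_funM => //; apply: measurable_funB => //; exact: measurable_funM.
have iF : rint P (fun t => F (sh t)).
  by under [X in rint P X]eq_fun do rewrite Fsh; exact: rintB.
have [iL eL] := Rintegral_shift s_gt0 pos_inj p_pos m_drift d_drift (enum_uniq I) mF iF.
apply/eqP; rewrite -subr_eq0 -RintegralB //; apply/eqP.
transitivity (\int[P]_t F (sh t)); first by apply: eq_Rintegral => t _; rewrite Fsh.
rewrite eL /Rintegral (integral_upd jl iL) integral0_eq // => t _.
rewrite -[RHS](integral_tilted_score (f t) (score t) (info t) a_gt0) p_jl.
apply: eq_integral => u _; congr (_%:E); rewrite likelihoodE /F (dep_on_upd _ _ df).
have -> : param (upd t jl u) = clip a u by rewrite /param updE eqxx.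
have -> : score (upd t jl u) = score t.
  apply: eq_bigr => i _; rewrite dpsi_jl updE.
  case: eqP => // e; move: jl_noiseless; rewrite /noiseless -e codom_f //.
have -> : info (upd t jl u) = info t.
  by apply: eq_bigr => i _; rewrite dpsi_jl.
by rewrite /tilted_score; ring.
Qed.

End score_identity.

(** * The Gaussian model and the correlation of an estimator with the score *)

Section uniform_design.
Context {R : realType}.
Local Notation leb := (@lebesgue_measure R).
Local Notation U01 := (@unif R 0 1 ltr01).

Lemma Rintegral_unif01_clip (f : R -> R) : continuous f ->
  \int[U01]_u f (clip01 u) = \int[U01]_u f u.
Proof.
move=> cf; have mf : measurable_fun setT f by exact: continuous_measurable_fun.
have i0 := integrable01 cf.
have clipE (u : R) : u \in `[0, 1]%classic -> clip01 u = u.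
  by rewrite inE /= in_itv /= => /clip01_id.
rewrite [RHS]unif01E // [LHS]unif01E.
- by apply: eq_Rintegral => u u01; rewrite clipE.
- by apply: measurableT_comp => //; exact: measurable_clip01.
- by move: i0; apply: eq_integrable => // u u01; rewrite /= clipE.
Qed.

Lemma Rintegral_trig_sqr K (c : 'I_K -> R) :
  \int[U01]_u (trig c (clip01 u) ^+ 2) = \sum_l c l ^+ 2.
Proof.
have ct : continuous (trig c) by exact: continuous_trig.
rewrite (Rintegral_unif01_clip (f := fun u => trig c u ^+ 2)); last first.
  by move=> u; apply: (cvgM (ct u) (ct u)).
under eq_Rintegral do rewrite expr2.
by rewrite Rintegral_trig_mul; apply: eq_bigr => l _; rewrite expr2.
Qed.

End uniform_design.

(** Noise (true) and design (false) variables of each observation, and the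
    coefficients of the curve, put in the same space so that the prior is just
    another block of independent coordinates. *)
Definition gauss_index (n m K : nat) : finType := ('I_n * 'I_m * bool + 'I_K)%type.

Section gaussian_model.
Context {R : realType} (n m K : nat) (s a : R).
Hypotheses (s_gt0 : 0 < s) (a_gt0 : 0 < a).
Local Notation U01 := (@unif R 0 1 ltr01).
Local Notation N := (real_prob (normal_prob 0 s)).
Local Notation J := (gauss_index n m K).
Local Notation T := (tup R J).
Local Notation dataset := (n.-tuple (m.-tuple (R * R)%type)).

Definition gauss_dist (j : J) : probability R R :=
  match j with
  | inl (_, b) => if b then N else U01
  | inr _ => prior a_gt0
  end.
Local Notation P := (prodP gauss_dist).

Definition noise_pos (ij : 'I_n * 'I_m) : J := inl (ij, true).
Definition design_pos (ij : 'I_n * 'I_m) : J := inl (ij, false).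
Definition site ij (t : T) : R := clip01 (co t (design_pos ij)).
Local Notation g ij t := (co t (noise_pos ij)).
Local Notation th t := (fun l : 'I_K => param a (inr l : J) t).

Lemma noise_pos_inj : injective noise_pos. Proof. by move=> x y []. Qed.
Lemma design_pos_inj : injective design_pos. Proof. by move=> x y []. Qed.

(** The users outside keep are replaced by the constant entry (0, 0), and thus
    carry no information. *)
Definition gauss_data (keep : pred 'I_n) (v : 'I_K -> R) (t : T) : dataset :=
  [tuple [tuple if keep i then (site (i, j) t, trig v (site (i, j) t) + g (i, j) t)
                else (0, 0) | j < m] | i < n].

Lemma measurable_site ij : measurable_fun setT (site ij).
Proof. exact: measurable_design. Qed.

Lemma measurable_gauss_data keep (v : T -> 'I_K -> R) :
  (forall l, measurable_fun setT (fun t => v t l)) ->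
  measurable_fun setT (fun t => gauss_data keep (v t) t).
Proof.
move=> mv; apply/measurable_fun_tnthP => i; apply/measurable_fun_tnthP => j.
have mx := measurable_site (i, j).
rewrite (_ : _ \o _ = fun t => if keep i then
    (site (i, j) t, trig (v t) (site (i, j) t) + g (i, j) t) else (0, 0)); last first.
  by apply/funext => t /=; rewrite !tnth_mktuple.
case: (keep i); last exact: measurable_cst.
apply: measurable_fun_pair => //; apply: measurable_funD; last exact: measurable_co.
apply: measurable_sum => l; apply: measurable_funM => //.
exact: (measurableT_comp (measurable_fourier _) mx).
Qed.

Lemma gauss_data_valid keep v t : valid_dataset (gauss_data keep v t).
Proof.
move=> i j; rewrite !tnth_mktuple; case: ifP => _ /=; first exact: clip01_itv.
by rewrite lexx ler01.
Qed.

Lemma gauss_data_adjacent i v t :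
  adjacent (gauss_data predT v t) (gauss_data (predC1 i) v t).
Proof.
rewrite /adjacent -(cards1 i); apply: subset_leq_card.
apply/fintype.subsetP => k; rewrite !inE; apply: contraR => ki; apply/eqP.
by rewrite !tnth_mktuple; apply: eq_from_tnth => j; rewrite !tnth_mktuple /= ki.
Qed.

Let U (i : 'I_n) (x : R) (t : T) : R := 0.
Let X := design gauss_dist design_pos.
Let xi (i : 'I_n) (j : 'I_m) : {RV P >-> R} := mfun_of (measurable_co (R := R) (noise_pos (i, j))).

Lemma gauss_data_eq v t : data X (trig v) U xi t = gauss_data predT v t.
Proof.
apply: eq_from_tnth => i; rewrite !tnth_mktuple; apply: eq_from_tnth => j.
by rewrite !tnth_mktuple /=; congr pair; rewrite /response /U addr0.
Qed.

(** The coefficients v are fixed here; the coordinates that carry the prior are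
    ignored by the observations. *)
Lemma gauss_assumptions (alpha Calpha L CU Cxi : R) (v : 'I_K -> R) :
  0 <= alpha -> 1 < L -> 0 < CU -> 0 < Cxi -> 1 <= Calpha ^+ 2 / pi `^ (2 * alpha) ->
  (0 < K)%N -> K%:R `^ (2 * alpha + 1) * a ^+ 2 <= 1 -> (forall l, `|v l| <= a) ->
  8 * s ^+ 2 = 3 * Cxi ^+ 2 ->
  assumptionS alpha Calpha L X /\ assumptionM alpha Calpha CU Cxi X (trig v) U xi.
Proof.
move=> al0 L1 CU0 Cxi0 hC K0 Ka va hs; split.
  apply: assumptionS_design => //; first exact: design_pos_inj.
  exact: sampling_density_cst1.
have allp (f : T -> R) : dep_on (predC pred0) f.
  by move=> t t' tt'; rewrite (co_inj (t := t) (t' := t')) // => j; exact: tt'.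
have mU i x : measurable_fun setT (U i x) by exact: measurable_cst.
split.
- exact: (sobolev_trig_bounded (a := a)).
- by move=> i; exact: measurable_cst.
- by move=> i x _; rewrite unlock integral0_eq.
- by [].
- apply: (@mutually_indep_prodP _ _ _ _ (fun _ : J => None)).
  by move=> i f [x _ <-]; split.
- by move=> i x _; apply: psi2_norm0.
- by move=> i; apply: aeW => w; apply: sobolev_cst => //; rewrite normr0.
- apply: (@indep2_prodP _ _ _ pred0).
    by move=> f [i [x _ <-]]; split.
  by move=> f [i [j ->]]; split => //; exact: measurable_design.
- move=> i j; rewrite unlock.
  have ig : rint P (fun t => g (i, j) t).
    under [X in rint P X]eq_fun do rewrite -[co _ _]mul1r.
    apply: (@rint_gauss _ _ _ _ s_gt0 _ noise_pos _ _ 1) => //.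
    by move=> t; rewrite normr1.
  rewrite -(fineK_Rintegral ig) (@Rintegral_odd _ _ _ (noise_pos (i, j))) //.
    by move=> A mA; exact: normal_symmetric.
  by move=> t; rewrite reflect_atE eqxx.
- apply: (@mutually_indep_prodP _ _ _ _
    (fun j : J => if j is inl (ij, true) then Some ij else None)) => -[i j] f ->; split.
    exact: measurable_co.
  by move=> t t' tt'; rewrite /xi /= /mfun_of /= tt'.
- move=> i j; apply: psi2_norm_le => //.
  rewrite -(integral_expR_sqr_normal s_gt0).
  rewrite (ge0_integral_co gauss_dist (noise_pos (i, j)) (F := fun x => (expR (x ^+ 2 / Cxi ^+ 2))%:E)).
  + rewrite le_eqVlt; apply/orP; left; apply/eqP; apply: eq_integral => x _.
    congr (expR _)%:E; rewrite hs; field.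
    by rewrite gt_eqF.
  + apply/measurable_EFinP; apply: measurableT_comp => //; exact: measurable_funM.
  + by move=> x; rewrite lee_fin expR_ge0.
- apply: (@indep2_prodP _ _ _ (fun j : J => if j is inl (_, true) then true else false)).
    move=> f [i [j ->]]; split; first exact: measurable_co.
    by move=> t t' tt'; rewrite /xi /= /mfun_of /= tt'.
  move=> f [[i [x _ <-]]|[i [j ->]]]; split => //.
  by move=> t t' tt'; rewrite /X /design /= /mfun_of /= tt'.
Qed.

End gaussian_model.

Section gaussian_risk.
Context {R : realType} (n m K : nat) (s a : R).
Hypotheses (s_gt0 : 0 < s) (a_gt0 : 0 < a).
Local Notation J := (gauss_index n m K).
Local Notation T := (tup R J).
Local Notation dataset := (n.-tuple (m.-tuple (R * R)%type)).
Local Notation P := (prodP (@gauss_dist R n m K s a a_gt0)).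
Local Notation npos := (@noise_pos n m K).
Local Notation g ij t := (co t (npos ij)).
Context dZ (Z : measurableType dZ) (Q : R.-pker dataset ~> Z).
Variable M : 'I_K -> Z -> R.
Hypotheses (mM : forall l, measurable_fun setT (M l)) (Ma : forall l z, `|M l z| <= a).

Definition coefs (t : T) (l : 'I_K) : R := param a (inr l : J) t.
Definition slack (l : 'I_K) (t : T) : R := a ^+ 2 - coefs t l ^+ 2.
Definition wave (l : 'I_K) (ij : 'I_n * 'I_m) (t : T) : R := fourier l.+1 (site ij t).
Definition reply (l : 'I_K) (t : T) : R := answer Q (M l) (gauss_data predT (coefs t) t).

Lemma p_noise ij : @gauss_dist R n m K s a a_gt0 (npos ij) = real_prob (normal_prob 0 s).
Proof. by []. Qed.

Lemma measurable_coefs l : measurable_fun setT (fun t => coefs t l).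
Proof. exact: measurable_param. Qed.

Lemma coefs_le t l : `|coefs t l| <= a.
Proof. exact: param_le. Qed.

Lemma measurable_slack l : measurable_fun setT (slack l).
Proof. by apply: measurable_funB => //; apply: measurable_funX; exact: measurable_coefs. Qed.

Lemma slack_le l t : `|slack l t| <= a ^+ 2.
Proof.
have h1 := sqr_ge0 (coefs t l).
have h2 : coefs t l ^+ 2 <= a ^+ 2.
  by rewrite -[leLHS]real_normK ?num_real // lerXn2r ?nnegrE ?coefs_le // ltW.
rewrite /slack ger0_norm; lra.
Qed.

Lemma measurable_wave l ij : measurable_fun setT (wave l ij).
Proof. exact: (measurableT_comp (measurable_fourier _) (measurable_site ij)). Qed.

Lemma wave_le l ij t : `|wave l ij t| <= 2.
Proof. exact: fourier_le. Qed.

Lemma measurable_reply l : measurable_fun setT (reply l).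
Proof.
apply: (measurable_answer _ (mM l) (Ma l)); apply: measurable_gauss_data.
exact: measurable_coefs.
Qed.

Lemma reply_le l t : `|reply l t| <= a.
Proof. exact: answer_le (mM l) (Ma l) _. Qed.

Definition loss (v : 'I_K -> R) (z : Z) : R := \sum_l (M l z - v l) ^+ 2.

Lemma loss_ge0 v z : 0 <= loss v z.
Proof. by apply: sumr_ge0 => l _; exact: sqr_ge0. Qed.

Lemma loss_le v z : (forall l, `|v l| <= a) -> `|loss v z| <= \sum_(l < K) (a + a) ^+ 2.
Proof.
have a0 := ltW a_gt0.
move=> va; apply: (le_trans (ler_norm_sum _ _ _)); apply: ler_sum => l _.
rewrite normrX lerXn2r ?nnegrE ?addr_ge0 //.
by rewrite (le_trans (ler_normB _ _)) // lerD.
Qed.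

Definition mean_loss (t : T) : R := \int[kprob Q (gauss_data predT (coefs t) t)]_z loss (coefs t) z.

Lemma measurable_loss : measurable_fun setT (fun tz : T * Z => loss (coefs tz.1) tz.2).
Proof.
apply: measurable_sum => l; apply: measurable_funX; apply: measurable_funB.
  exact: (measurableT_comp (mM l) measurable_snd).
exact: (measurableT_comp (measurable_coefs l) measurable_fst).
Qed.

Lemma measurable_mean_loss : measurable_fun setT mean_loss.
Proof.
apply: (measurable_kernel_Rintegral Q _ (f := fun t z => loss (coefs t) z) measurable_loss).
  by apply: measurable_gauss_data; exact: measurable_coefs.
by move=> t z; apply: loss_le; exact: coefs_le.
Qed.

Lemma measurable_loss_cst v : measurable_fun setT (loss v).
Proof.
by apply: measurable_sum => l; apply: measurable_funX; exact: measurable_funB.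
Qed.

Lemma mean_loss_le t : `|mean_loss t| <= \sum_(l < K) (a + a) ^+ 2.
Proof.
apply: Rintegral_norm_le; first exact: measurable_loss_cst.
by move=> z; apply: loss_le; exact: coefs_le.
Qed.

Lemma mean_loss_ge0 t : 0 <= mean_loss t.
Proof. by apply: Rintegral_ge0 => z _; exact: loss_ge0. Qed.

Definition is_sample (j : J) : bool := if j is inl _ then true else false.

Lemma site_eq (t t' : T) ij : co t (design_pos K ij) = co t' (design_pos K ij) ->
  site ij t = site ij t'.
Proof. by rewrite /site => ->. Qed.

Lemma gauss_data_dep (keep : pred 'I_n) v (t t' : T) :
  (forall i j b, keep i -> co t (inl ((i, j), b)) = co t' (inl ((i, j), b))) ->
  gauss_data keep v t = gauss_data keep v t'.
Proof.
move=> tt'; apply: eq_from_tnth => i; rewrite !tnth_mktuple; apply: eq_from_tnth => j.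
rewrite !tnth_mktuple; case: ifPn => // ki.
by rewrite (@site_eq t t' (i, j)) ?tt' // /noise_pos tt'.
Qed.

(** The risk is at most r at each value of the coefficients, hence on average over
    the prior. *)
Lemma average_loss (r : R) :
  (forall v, (forall l, `|v l| <= a) ->
     \int[P]_t \int[kprob Q (gauss_data predT v t)]_z loss v z <= r) ->
  \int[P]_t mean_loss t <= r.
Proof.
move=> hr; rewrite -lee_fin fineK_Rintegral; last first.
  exact: (integrable_bounded measurable_mean_loss mean_loss_le).
have mE : measurable_fun setT (fun t => (mean_loss t)%:E).
  by apply/measurable_EFinP; exact: measurable_mean_loss.
rewrite (ge0_integral_merge _ is_sample) //; last first.
  by move=> t; rewrite lee_fin mean_loss_ge0.
rewrite -(integral_prob_cst P r).
have mm : measurable_fun setT (fun ts : T * T => (mean_loss (merge is_sample ts.1 ts.2))%:E).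
  exact: (measurableT_comp mE (measurable_merge _)).
apply: ge0_le_integral => //.
- by move=> t _; apply: integral_ge0 => u _; rewrite lee_fin mean_loss_ge0.
- apply: (measurable_fun_fubini_tonelli_F (m2 := P) _ mm).
  by move=> ts; rewrite lee_fin mean_loss_ge0.
move=> t _.
have e u : mean_loss (merge is_sample t u) =
    \int[kprob Q (gauss_data predT (coefs t) u)]_z loss (coefs t) z.
  have -> : mean_loss (merge is_sample t u) =
    \int[kprob Q (gauss_data predT (coefs t) (merge is_sample t u))]_z loss (coefs t) z.
    have <- : coefs (merge is_sample t u) = coefs t.
      by apply/funext => l; rewrite /coefs /param mergeE.
    by [].
  have -> // : gauss_data predT (coefs t) (merge is_sample t u) = gauss_data predT (coefs t) u.
  by apply: gauss_data_dep => i j b _; rewrite mergeE.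
under eq_integral do rewrite e.
rewrite -fineK_Rintegral ?lee_fin ?hr //.
  by move=> l; exact: coefs_le.
apply: (integrable_bounded (B := \sum_(l < K) (a + a) ^+ 2)).
  apply: (measurable_kernel_Rintegral Q _ (f := fun _ z => loss (coefs t) z)).
  - by apply: measurable_gauss_data => l; exact: measurable_cst.
  - exact: (measurableT_comp (measurable_loss_cst _) measurable_snd).
  - by move=> _ z; apply: loss_le; exact: coefs_le.
move=> u; apply: Rintegral_norm_le; first exact: measurable_loss_cst.
by move=> z; apply: loss_le; exact: coefs_le.
Qed.

(** Curve with the coefficient l removed; the drift of the shift puts it back. *)
Definition others (l : 'I_K) (t : T) (k : 'I_K) : R := if k == l then 0 else coefs t k.

Lemma measurable_others l k : measurable_fun setT (fun t => others l t k).
Proof.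
by rewrite /others; case: (k == l); [exact: measurable_cst|exact: measurable_coefs].
Qed.

Lemma reply_shift l t :
  let sh := shift npos (drift a (inr l : J) (wave l)) (enum (('I_n * 'I_m)%type : finType)) t in
  answer Q (M l) (gauss_data predT (others l sh) sh) = reply l t.
Proof.
move=> sh; rewrite /reply; congr answer.
have coE (j : J) : noiseless npos j -> co sh j = co t j.
  by move=> jn; apply: (@shift_noiseless _ _ _ npos _ _ _ (fun t => co t j)) => u u' uu'; exact: uu'.
have siteE ij : site ij sh = site ij t.
  by apply: site_eq; apply: coE; apply/negP => /codomP[].
have coefE k : coefs sh k = coefs t k.
  by rewrite /coefs /param coE //; apply/negP => /codomP[].
apply: eq_from_tnth => i; rewrite !tnth_mktuple; apply: eq_from_tnth => j.
rewrite !tnth_mktuple /= siteE; congr pair.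
rewrite (drifted_co _ _ (@noise_pos_inj n m K)) -/(coefs t l).
have -> : trig (coefs t) (site (i, j) t) =
    trig (others l sh) (site (i, j) t) + coefs t l * wave l (i, j) t.
  rewrite /trig (bigD1 l) //= [in RHS](bigD1 l) //= /others eqxx mul0r add0r addrC.
  congr (_ + _); apply: eq_bigr => k kl; by rewrite (negbTE kl) coefE.
by ring.
Qed.

(** Integration by parts in each coefficient, then 2 th M >= th^2 - (M - th)^2 and
    the second moment a^2 / 3 of the uniform prior. *)
Lemma trace_lower (r : R) : \int[P]_t mean_loss t <= r ->
  K%:R * (a ^+ 2 / 3) - r <=
  \sum_l \int[P]_t (reply l t * slack l t * score s npos (wave l) t).
Proof.
move=> hr.
have byparts l : \int[P]_t (reply l t * slack l t * score s npos (wave l) t) =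
    \int[P]_t (2 * (coefs t l * reply l t)).
  have md : measurable_fun setT (fun t : T => answer Q (M l) (gauss_data predT (others l t) t)).
    apply: (measurable_answer _ (mM l) (Ma l)); apply: measurable_gauss_data.
    exact: measurable_others.
  have nl : noiseless npos (inr l) by apply/negP => /codomP[].
  have dw ij : dep_on (predI (noiseless npos) (predC1 (inr l : J))) (wave l ij).
    move=> t t' tt'; rewrite /wave; congr fourier; apply: site_eq; apply: tt'.
    by apply/andP; split => //; apply/negP => /codomP[].
  have df : dep_on (predC1 (inr l : J))
      (fun t : T => answer Q (M l) (gauss_data predT (others l t) t)).
    move=> t t' tt'; congr answer.
    have -> : others l t = others l t'.
      apply/funext => k; rewrite /others; case: eqP => // /eqP kl.
      by rewrite /coefs /param tt' //; apply: contraNneq kl => -[->].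
    by apply: gauss_data_dep => i j b _; exact: tt'.
  have h := score_by_parts s_gt0 (@noise_pos_inj n m K) p_noise nl erefl (measurable_wave l)
    (wave_le l) dw md (fun t => answer_le Q (mM l) (Ma l) _) df.
  transitivity (\int[P]_t (answer Q (M l) (gauss_data predT
      (others l (shift npos (drift a (inr l : J) (wave l)) (enum (('I_n * 'I_m)%type : finType)) t))
      (shift npos (drift a (inr l : J) (wave l)) (enum (('I_n * 'I_m)%type : finType)) t)) *
      (a ^+ 2 - param a (inr l : J) t ^+ 2) * score s npos (wave l) t)).
    by apply: eq_Rintegral => t _; rewrite reply_shift.
  rewrite h; apply: eq_Rintegral => t _; congr (_ * (_ * _)); exact: reply_shift.
rewrite (eq_bigr _ (fun l _ => byparts l)).
have mc := measurable_coefs; have mr := measurable_reply.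
have i1 l : rint P (fun t => 2 * (coefs t l * reply l t)).
  apply: rintZ; apply: (integrable_bounded (B := a * a)); first exact: measurable_funM.
  by move=> t; rewrite normrM ler_pM // ?coefs_le // reply_le.
have i2 l : rint P (fun t => coefs t l ^+ 2).
  apply: (integrable_bounded (B := a ^+ 2)); first exact: measurable_funX.
  by move=> t; rewrite normrX lerXn2r ?nnegrE ?coefs_le // ltW.
have i3 : rint P mean_loss := integrable_bounded measurable_mean_loss mean_loss_le.
rewrite -Rintegral_sum //.
apply: (@le_trans _ _ (\int[P]_t (\sum_l coefs t l ^+ 2 - mean_loss t))).
  rewrite RintegralB //; last by apply: rint_sum.
  rewrite Rintegral_sum //; apply: lerB => //.
  rewrite (eq_bigr (fun _ => a ^+ 2 / 3)); first by rewrite sumr_const card_ord -[leRHS]mulr_natl.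
  move=> l _; rewrite -(Rintegral_prior_sqr a_gt0).
  apply: (@Rintegral_co _ _ _ (inr l : J) (fun u => clip a u ^+ 2)).
  by apply: measurable_funX; exact: measurable_clip.
apply: le_Rintegral => //; first by apply: rintB => //; apply: rint_sum.
  by apply: rint_sum.
move=> t _; rewrite lerBlDr.
set q := kprob Q (gauss_data predT (coefs t) t).
have iM l : rint q (M l) := integrable_bounded (mM l) (Ma l).
have e l : 2 * (coefs t l * reply l t) = \int[q]_z (2 * coefs t l * M l z).
  by rewrite RintegralZl // mulrA.
have iL : rint q (loss (coefs t)).
  apply: (integrable_bounded (measurable_loss_cst _)) => z; apply: loss_le.
  exact: coefs_le.
rewrite (eq_bigr _ (fun l _ => e l)) -Rintegral_sum; last by move=> l _; exact: rintZ.
rewrite /mean_loss -/q -RintegralD //; last by apply: rint_sum => l _; exact: rintZ.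
rewrite -[leLHS](Rintegral_prob_cst q); apply: le_Rintegral => //.
- exact: (integrable_bounded (B := `|\sum_l coefs t l ^+ 2|)).
- by apply: rintD => //; apply: rint_sum => l _; exact: rintZ.
move=> z _; rewrite /loss -big_split /=; apply: ler_sum => l _.
have := sqr_ge0 (M l z); lra.
Qed.

Section score_moments.
Variables (I : finType) (ij : I -> 'I_n * 'I_m).
Hypothesis ij_inj : injective ij.
Let pos k := npos (ij k).
Let pos_inj : injective pos.
Proof. by move=> x y /noise_pos_inj/ij_inj. Qed.

(** The Cauchy-Schwarz inequality on top of the second moment of a linear statistic
    of the noise; all the bounds on scores are instances. *)
Lemma score_abs_le (c : I -> T -> R) (B V : R) :
  (forall k, measurable_fun setT (c k)) -> (forall k t, `|c k t| <= B) ->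
  (forall k, dep_on (noiseless npos) (c k)) ->
  0 < V -> 6 * (\sum_k \int[P]_t (c k t ^+ 2)) / s ^+ 2 <= V ^+ 2 ->
  rint P (fun t => \sum_k c k t * g (ij k) t / s ^+ 2) /\
  \int[P]_t `|\sum_k c k t * g (ij k) t / s ^+ 2| <= V.
Proof.
move=> mc cB dc V0 hV.
have s0 : s != 0 by rewrite gt_eqF.
have mc' k : measurable_fun setT (fun t => c k t / s ^+ 2) by exact: measurable_funM.
have c'B k t : `|c k t / s ^+ 2| <= B * `|(s ^+ 2)^-1|.
  by rewrite normrM ler_wpM2r.
have dc' k k' : dep_on (predC1 (pos k')) (fun t => c k t / s ^+ 2).
  move=> t t' tt'; congr (_ / _); apply: dc => j jn; apply: tt'.
  by apply: contraNneq jn => ->; exact: codom_f.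
have [h1 h2] := gauss_sum_sqr s_gt0 pos_inj (fun k => p_noise (ij k)) mc' c'B dc'.
have e t : \sum_k c k t * g (ij k) t / s ^+ 2 = \sum_k c k t / s ^+ 2 * co t (pos k).
  by apply: eq_bigr => k _; rewrite mulrAC.
under [X in rint _ X]eq_fun do rewrite e.
under eq_Rintegral do rewrite e.
apply: Rintegral_abs_le => //.
  by apply: measurable_sum => k; apply: measurable_funM => //; exact: measurable_co.
apply: (le_trans h2); apply: le_trans hV; rewrite le_eqVlt; apply/orP; left; apply/eqP.
have -> : \sum_k \int[P]_t ((c k t / s ^+ 2) ^+ 2) =
    (s ^+ 2)^-1 ^+ 2 * \sum_k \int[P]_t (c k t ^+ 2).
  rewrite mulr_sumr; apply: eq_bigr => k _; rewrite -RintegralZl //.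
    by apply: eq_Rintegral => t _; rewrite exprMn mulrC.
  apply: (integrable_bounded (B := B ^+ 2)); first exact: measurable_funX.
  by move=> t; rewrite normrX lerXn2r ?nnegrE // (le_trans _ (cB k t)).
by field.
Qed.

Lemma wave_noiseless l k : dep_on (noiseless npos) (wave l k).
Proof.
move=> t t' tt'; rewrite /wave; congr fourier; apply: site_eq; apply: tt'.
by apply/negP => /codomP[].
Qed.

Lemma wave_score_abs_le l (V : R) : 0 < V -> 24 * #|I|%:R / s ^+ 2 <= V ^+ 2 ->
  rint P (fun t => \sum_k wave l (ij k) t * g (ij k) t / s ^+ 2) /\
  \int[P]_t `|\sum_k wave l (ij k) t * g (ij k) t / s ^+ 2| <= V.
Proof.
move=> V0 hV; apply: (@score_abs_le (fun k => wave l (ij k)) 2) => //.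
- by move=> k; exact: measurable_wave.
- by move=> k t; exact: wave_le.
- by move=> k; exact: wave_noiseless.
apply: le_trans hV; rewrite ler_pM2r ?invr_gt0 ?exprn_gt0 //.
have w2 k t : `|wave l k t ^+ 2| <= 4.
  rewrite normrX; have -> : 4 = 2 ^+ 2 :> R by ring.
  by rewrite lerXn2r ?nnegrE ?wave_le.
have : \sum_k \int[P]_t (wave l (ij k) t ^+ 2) <= \sum_(k : I) 4.
  apply: ler_sum => k _; apply: (le_trans (ler_norm _)); apply: Rintegral_norm_le => //.
  by apply: measurable_funX; exact: measurable_wave.
rewrite sumr_const -[4 *+ _]mulr_natl; lra.
Qed.

End score_moments.

(** The reply and the weight are bounded by a and a^2, so only the first absolute
    moment of the score matters. *)
Lemma nonprivate_lower (r V : R) : \int[P]_t mean_loss t <= r ->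
  0 < V -> 24 * (n * m)%:R / s ^+ 2 <= V ^+ 2 ->
  K%:R * (a ^+ 2 / 3) - r <= K%:R * (a ^+ 3 * V).
Proof.
move=> hr V0 hV; apply: (le_trans (trace_lower hr)).
apply: (@le_trans _ _ (\sum_(l < K) (a ^+ 3 * V))); last first.
  by rewrite sumr_const card_ord -[leLHS]mulr_natl.
apply: ler_sum => l _.
have hV' : 24 * #|(('I_n * 'I_m)%type : finType)|%:R / s ^+ 2 <= V ^+ 2.
  by rewrite card_prod !card_ord.
have [i1 h1] := wave_score_abs_le (@inj_id _) l V0 hV'.
have a0 := ltW a_gt0.
have ir : rint P (fun t => reply l t * slack l t * score s npos (wave l) t).
  apply: (rint_score s_gt0 p_noise (measurable_wave l) (wave_le l) (C := a * a ^+ 2)).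
    by apply: measurable_funM; [exact: measurable_reply|exact: measurable_slack].
  by move=> t; rewrite normrM ler_pM // ?reply_le // slack_le.
apply: (@le_trans _ _ (\int[P]_t (a ^+ 3 * `|score s npos (wave l) t|))).
  apply: le_Rintegral => //; first by apply: rintZ; exact: rint_norm.
  move=> t _; apply: (le_trans (ler_norm _)); rewrite normrM ler_wpM2r // normrM exprS.
  by rewrite ler_pM ?reply_le ?slack_le.
by rewrite RintegralZl //; [rewrite ler_wpM2l ?exprn_ge0|exact: rint_norm].
Qed.

Section one_user.
Variable i : 'I_n.

Definition user_score (l : 'I_K) (t : T) : R := \sum_(j < m) wave l (i, j) t * g (i, j) t / s ^+ 2.
Definition without_user (t : T) : dataset := gauss_data (predC1 i) (coefs t) t.
(** Correlation of the output z with the part of the score due to user i; its mean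
    over the output is the contribution of that user to the trace. *)
Definition correlation (t : T) (z : Z) : R := \sum_l M l z * slack l t * user_score l t.
Definition is_user (j : J) : bool := if j is inl (ij, _) then ij.1 == i else false.

Let pair_inj : injective (fun j : 'I_m => (i, j)).
Proof. by move=> x y []. Qed.

Lemma measurable_user_score l : measurable_fun setT (user_score l).
Proof.
apply: measurable_sum => j; apply: measurable_funM => //; apply: measurable_funM.
  exact: measurable_wave.
exact: measurable_co.
Qed.

Lemma without_user_dep : dep_on (predC is_user) without_user.
Proof.
move=> t t' tt'; rewrite /without_user.
have -> : coefs t = coefs t' by apply/funext => l; rewrite /coefs /param tt'.
by apply: gauss_data_dep => k j b /= ki; rewrite tt'.
Qed.

Lemma user_score_dep l : dep_on is_user (user_score l).
Proof.
move=> t t' tt'; apply: eq_bigr => j _; rewrite tt' /= ?eqxx //; congr (_ * _ / _).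
by rewrite /wave; congr fourier; apply: site_eq; apply: tt'; rewrite /= eqxx.
Qed.

Lemma slack_dep l : dep_on (predC is_user) (slack l).
Proof. by move=> t t' tt'; rewrite /slack /coefs /param tt'. Qed.

Lemma measurable_without_user : measurable_fun setT without_user.
Proof. by apply: measurable_gauss_data; exact: measurable_coefs. Qed.

Lemma measurable_correlation : measurable_fun setT (fun tz : T * Z => correlation tz.1 tz.2).
Proof.
apply: measurable_sum => l; apply: measurable_funM; last first.
  exact: (measurableT_comp (measurable_user_score l) measurable_fst).
apply: measurable_funM; first exact: (measurableT_comp (mM l) measurable_snd).
exact: (measurableT_comp (measurable_slack l) measurable_fst).
Qed.

Lemma measurable_correlation_cst t : measurable_fun setT (correlation t).
Proof. exact: (measurableT_comp measurable_correlation (pair1_measurable t)). Qed.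

Definition correlation_bound (t : T) : R := a ^+ 3 * \sum_l `|user_score l t|.

Lemma correlation_le t z : `|correlation t z| <= correlation_bound t.
Proof.
apply: (le_trans (ler_norm_sum _ _ _)); rewrite /correlation_bound mulr_sumr.
apply: ler_sum => l _; rewrite 2!normrM exprS ler_wpM2r // ler_pM //.
exact: slack_le.
Qed.

(** By Parseval the second moment involves the sum of the squares of the
    coefficients, so K coordinates cost a factor sqrt K rather than K. *)
Lemma contrast_abs_le (c : 'I_K -> R) (V : R) : (forall l, `|c l| <= a ^+ 3) ->
  0 < V -> 6 * (m%:R * (K%:R * a ^+ 6)) / s ^+ 2 <= V ^+ 2 ->
  rint P (fun t => \sum_l c l * user_score l t) /\
  \int[P]_t `|\sum_l c l * user_score l t| <= V.
Proof.
move=> ca V0 hV.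
pose C (j : 'I_m) (t : T) := trig c (site (i, j) t).
have e t : \sum_l c l * user_score l t = \sum_j C j t * g (i, j) t / s ^+ 2.
  under eq_bigr do rewrite mulr_sumr.
  rewrite exchange_big /=; apply: eq_bigr => j _; rewrite /C /trig 2!mulr_suml.
  by apply: eq_bigr => l _; rewrite /wave; ring.
under [X in rint _ X]eq_fun do rewrite e.
under eq_Rintegral do rewrite e.
apply: (@score_abs_le _ _ pair_inj C (a ^+ 3 * 2 * K%:R)) => //.
- by move=> j; exact: (measurableT_comp (measurable_trig c) (measurable_site (i, j))).
- by move=> j t; exact: trig_le.
- move=> j t t' tt'; rewrite /C; congr trig; apply: site_eq; apply: tt'.
  by apply/negP => /codomP[].
apply: le_trans hV; rewrite ler_pM2r ?invr_gt0 ?exprn_gt0 // ler_pM2l //.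
have c2 : \sum_l c l ^+ 2 <= K%:R * a ^+ 6.
  have -> : K%:R * a ^+ 6 = \sum_(l < K) (a ^+ 3) ^+ 2 by rewrite sumr_const card_ord -exprM mulr_natl.
  apply: ler_sum => l _; rewrite -[leLHS]real_normK ?num_real //.
  by rewrite lerXn2r ?nnegrE // exprn_ge0 // ltW.
have C2 j : \int[P]_t (C j t ^+ 2) = \sum_l c l ^+ 2.
  rewrite -Rintegral_trig_sqr.
  apply: (@Rintegral_co _ _ _ (design_pos K (i, j)) (fun u => trig c (clip01 u) ^+ 2)).
  apply: measurable_funX; apply: (measurableT_comp (measurable_trig c)).
  exact: measurable_clip01.
rewrite (eq_bigr _ (fun j _ => C2 j)) sumr_const card_ord -[leLHS]mulr_natl.
by rewrite ler_wpM2l.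
Qed.

(** Once user i is removed, the output ignores the noise of user i, in which the
    score is odd. *)
Lemma correlation_mean0 :
  rint P (fun t => \int[kprob Q (without_user t)]_z correlation t z) /\
  \int[P]_t \int[kprob Q (without_user t)]_z correlation t z = 0.
Proof.
have mq l : measurable_fun setT (fun t => answer Q (M l) (without_user t)).
  exact: (measurable_answer _ (mM l) (Ma l) measurable_without_user).
pose c l j t := answer Q (M l) (without_user t) * slack l t * wave l (i, j) t / s ^+ 2.
have e t : \int[kprob Q (without_user t)]_z correlation t z =
    \sum_l \sum_j c l j t * g (i, j) t.
  have iM l : rint (kprob Q (without_user t)) (M l) := integrable_bounded (mM l) (Ma l).
  transitivity (\int[kprob Q (without_user t)]_z \sum_l slack l t * user_score l t * M l z).
    by apply: eq_Rintegral => z _; apply: eq_bigr => l _; ring.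
  rewrite Rintegral_sum; last by move=> l _; exact: rintZ.
  apply: eq_bigr => l _; rewrite RintegralZl // /user_score mulr_sumr mulr_suml.
  by apply: eq_bigr => j _; rewrite /c /answer; ring.
have ic l j : rint P (fun t => c l j t * g (i, j) t).
  apply: (rint_gauss s_gt0 p_noise (B := a * a ^+ 2 * 2 * `|(s ^+ 2)^-1|)).
    apply: measurable_funM => //; apply: measurable_funM; last exact: measurable_wave.
    by apply: measurable_funM => //; exact: measurable_slack.
  move=> t; rewrite normrM ler_wpM2r // normrM ler_pM ?wave_le // normrM.
  by rewrite ler_pM ?slack_le // (answer_le _ (mM l) (Ma l)).
split.
  under [X in rint _ X]eq_fun do rewrite e.
  by apply: rint_sum => l _; apply: rint_sum => j _; exact: ic.
under eq_Rintegral do rewrite e.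
rewrite Rintegral_sum; last by move=> l _; apply: rint_sum => j _; exact: ic.
rewrite big1 // => l _; rewrite Rintegral_sum; last by move=> j _; exact: ic.
rewrite big1 // => j _; apply: (@Rintegral_odd _ _ _ (npos (i, j))) => //.
  by move=> A mA; exact: normal_symmetric.
move=> t; rewrite reflect_atE eqxx mulrN; congr (- (_ * _)); rewrite /c.
have -> : without_user (reflect_at (npos (i, j)) t) = without_user t.
  by apply: without_user_dep => k ku; rewrite reflect_atE; case: eqP => // kj; move: ku; rewrite kj /= eqxx.
have -> : slack l (reflect_at (npos (i, j)) t) = slack l t.
  by rewrite /slack /coefs /param reflect_atE.
congr (_ * _ / _); rewrite /wave; congr fourier.
by apply: site_eq; rewrite reflect_atE; case: eqP => // -[].
Qed.

(** The sample of user i is resampled with the rest fixed. The output is then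
    integrated last, its coefficients being constants for the user's sample. *)
Lemma correlation_abs_le (V : R) :
  0 < V -> 6 * (m%:R * (K%:R * a ^+ 6)) / s ^+ 2 <= V ^+ 2 ->
  rint P (fun t => \int[kprob Q (without_user t)]_z `|correlation t z|) /\
  \int[P]_t \int[kprob Q (without_user t)]_z `|correlation t z| <= V.
Proof.
move=> V0 hV.
have mabs : measurable_fun setT (fun tz : T * Z => `|correlation tz.1 tz.2|%:E).
  by apply/measurable_EFinP; apply: measurableT_comp => //; exact: measurable_correlation.
pose F t := (\int[kprob Q (without_user t)]_z `|correlation t z|%:E)%E.
have FE t : F t = (\int[kprob Q (without_user t)]_z `|correlation t z|)%:E.
  rewrite fineK_Rintegral //; apply: (integrable_bounded (B := correlation_bound t)).
    by apply: measurableT_comp => //; exact: measurable_correlation_cst.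
  by move=> z; rewrite normr_id correlation_le.
have F0 t : (0 <= F t)%E by apply: integral_ge0 => z _; rewrite lee_fin.
have mF : measurable_fun setT F.
  exact: (measurable_kernel_integral Q measurable_without_user
    (f := fun t z => `|correlation t z|%:E) mabs (fun t z => normr_ge0 _)).
have FV : (\int[P]_t F t <= V%:E)%E.
  rewrite (ge0_integral_merge _ is_user) // -(integral_prob_cst P V).
  have mm : measurable_fun setT (fun ts : T * T => F (merge is_user ts.1 ts.2)).
    exact: (measurableT_comp mF (measurable_merge _)).
  apply: ge0_le_integral => //.
  - by move=> t _; apply: integral_ge0 => u _.
  - by apply: (measurable_fun_fubini_tonelli_F (m2 := P) _ mm) => ts.
  move=> t _; set q := kprob Q (without_user t).
  have e u : F (merge is_user t u) =
      (\int[q]_z `|\sum_l M l z * slack l t * user_score l u|%:E)%E.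
    rewrite /F (without_user_dep (s := t)); last first.
      by move=> j /negbTE ju; rewrite mergeE ju.
    apply: eq_integral => z _; congr (`|_|%:E); apply: eq_bigr => l _.
    congr (_ * _ * _).
      by apply: slack_dep => j /negbTE ju; rewrite mergeE ju.
    by apply: user_score_dep => j ju; rewrite mergeE ju.
  under eq_integral do rewrite e.
  have mG : measurable_fun setT (fun uz : T * Z =>
      `|\sum_l M l uz.2 * slack l t * user_score l uz.1|%:E).
    apply/measurable_EFinP; apply: measurableT_comp => //; apply: measurable_sum => l.
    apply: measurable_funM; last exact: (measurableT_comp (measurable_user_score l) measurable_fst).
    by apply: measurable_funM => //; exact: (measurableT_comp (mM l) measurable_snd).
  rewrite (fubini_tonelli (m1 := P) (m2 := q) _ mG) //=.
  rewrite -(integral_prob_cst q V); apply: ge0_le_integral => //.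
  - by move=> z _; apply: integral_ge0 => u _; rewrite lee_fin.
  - by apply: (measurable_fun_fubini_tonelli_G (m1 := P) _ mG) => uz; rewrite lee_fin.
  move=> z _.
  have [|iz hz] := @contrast_abs_le (fun l => M l z * slack l t) V _ V0 hV.
    by move=> l; rewrite normrM exprS ler_pM // slack_le.
  by rewrite -fineK_Rintegral ?lee_fin //; exact: rint_norm.
have iF : rint P (fun t => \int[kprob Q (without_user t)]_z `|correlation t z|).
  apply/rintP; split.
    by apply/measurable_EFinP; move: mF; apply: eq_measurable_fun => t _; rewrite FE.
  apply: (@le_lt_trans _ _ V%:E); last by rewrite ltry.
  apply: le_trans FV; rewrite le_eqVlt; apply/orP; left; apply/eqP.
  apply: eq_integral => t _; rewrite FE ger0_norm //.
  by apply: Rintegral_ge0 => z _.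
split => //; rewrite -lee_fin fineK_Rintegral //; apply: le_trans FV.
by rewrite le_eqVlt; apply/orP; left; apply/eqP; apply: eq_integral => t _; rewrite FE.
Qed.

End one_user.

(** For each user, privacy replaces the output by the one computed without that
    user, where the correlation has mean zero. *)
Lemma private_lower (r eps delta V W : R) : is_CDP eps delta Q -> 0 <= eps -> 0 <= delta ->
  \int[P]_t mean_loss t <= r ->
  0 < V -> 6 * (m%:R * (K%:R * a ^+ 6)) / s ^+ 2 <= V ^+ 2 ->
  0 < W -> 24 * m%:R / s ^+ 2 <= W ^+ 2 ->
  K%:R * (a ^+ 2 / 3) - r <=
    n%:R * ((expR eps - 1) * V + 2 * (delta * (a ^+ 3 * (K%:R * W)))).
Proof.
move=> hQ eps0 delta0 hr V0 hV W0 hW; apply: (le_trans (trace_lower hr)).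
have a0 := ltW a_gt0; have a30 : 0 <= a ^+ 3 by rewrite exprn_ge0.
have e1 : 1 <= expR eps by rewrite -expR0 ler_expR.
have us i l : rint P (user_score i l) /\ \int[P]_t `|user_score i l t| <= W.
  have pair_inj : injective (fun j : 'I_m => (i, j)) by move=> x y [].
  by apply: (wave_score_abs_le pair_inj l W0); rewrite card_ord.
pose part i l t := reply l t * slack l t * user_score i l t.
have ipart i l : rint P (part i l).
  apply: (@rint_le _ _ _ _ _ (fun t => a ^+ 3 * `|user_score i l t|)).
  - apply: measurable_funM; last exact: measurable_user_score.
    by apply: measurable_funM; [exact: measurable_reply|exact: measurable_slack].
  - by apply: rintZ; apply: rint_norm; case: (us i l).
  - by move=> t; rewrite 2!normrM exprS ler_wpM2r // ler_pM ?reply_le ?slack_le.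
have -> : \sum_l \int[P]_t (reply l t * slack l t * score s npos (wave l) t) =
    \sum_i \int[P]_t \sum_l part i l t.
  transitivity (\sum_l \sum_i \int[P]_t part i l t).
    apply: eq_bigr => l _; rewrite -Rintegral_sum; last by move=> i _; exact: ipart.
    apply: eq_Rintegral => t _; rewrite /part -mulr_sumr; congr (_ * _).
    by rewrite /score /user_score pair_big /=; apply: eq_bigr => -[i j] _.
  rewrite exchange_big; apply: eq_bigr => i _; by rewrite Rintegral_sum.
have -> : n%:R * ((expR eps - 1) * V + 2 * (delta * (a ^+ 3 * (K%:R * W)))) =
    \sum_(i < n) ((expR eps - 1) * V + 2 * (delta * (a ^+ 3 * (K%:R * W)))).
  by rewrite sumr_const card_ord -[RHS]mulr_natl.
apply: ler_sum => i _.
have [ia ha] := correlation_abs_le i V0 hV.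
have ib : rint P (correlation_bound i).
  by apply: rintZ; apply: rint_sum => l _; apply: rint_norm; case: (us i l).
have hb : \int[P]_t correlation_bound i t <= a ^+ 3 * (K%:R * W).
  rewrite RintegralZl //; last by apply: rint_sum => l _; apply: rint_norm; case: (us i l).
  rewrite ler_wpM2l // Rintegral_sum; last by move=> l _; apply: rint_norm; case: (us i l).
  have -> : K%:R * W = \sum_(l < K) W by rewrite sumr_const card_ord -[RHS]mulr_natl.
  by apply: ler_sum => l _; case: (us i l).
pose q0 t := kprob Q (without_user i t).
have pointwise t : \sum_l part i l t <= \int[q0 t]_z correlation i t z +
    (expR eps - 1) * \int[q0 t]_z `|correlation i t z| + 2 * (delta * correlation_bound i t).
  have -> : \sum_l part i l t = \int[kprob Q (gauss_data predT (coefs t) t)]_z correlation i t z.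
    have iM l : rint (kprob Q (gauss_data predT (coefs t) t)) (M l) := integrable_bounded (mM l) (Ma l).
    transitivity (\int[kprob Q (gauss_data predT (coefs t) t)]_z
        \sum_l slack l t * user_score i l t * M l z).
      rewrite Rintegral_sum; last by move=> l _; exact: rintZ.
      by apply: eq_bigr => l _; rewrite RintegralZl // /part /reply /answer; ring.
    by apply: eq_Rintegral => z _; apply: eq_bigr => l _; ring.
  have adj := gauss_data_adjacent i (coefs t) t.
  have adj' : adjacent (gauss_data (predC1 i) (coefs t) t) (gauss_data predT (coefs t) t).
    by move: adj; rewrite /adjacent; congr (_ <= _)%N; apply: eq_card => k; rewrite !inE eq_sym.
  apply: (@dp_Rintegral _ _ _ (kprob Q (gauss_data predT (coefs t) t)) (q0 t)) => //.
  - by rewrite mulr_ge0 // sumr_ge0.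
  - exact: (hQ _ _ (gauss_data_valid _ _ _) (gauss_data_valid _ _ _) adj).
  - exact: (hQ _ _ (gauss_data_valid _ _ _) (gauss_data_valid _ _ _) adj').
  - exact: measurable_correlation_cst.
  - by move=> z; exact: correlation_le.
have [i0 m0] := correlation_mean0 i.
have i1 : rint P (fun t => (expR eps - 1) * \int[q0 t]_z `|correlation i t z|) by exact: rintZ.
have i2 : rint P (fun t => 2 * (delta * correlation_bound i t)) by do 2 apply: rintZ.
apply: (@le_trans _ _ (\int[P]_t (\int[q0 t]_z correlation i t z +
    (expR eps - 1) * \int[q0 t]_z `|correlation i t z| + 2 * (delta * correlation_bound i t)))).
  apply: le_Rintegral => //.
    by apply: rint_sum => l _; exact: ipart.
  by apply: rintD => //; exact: rintD.
rewrite RintegralD //; last exact: rintD.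
rewrite RintegralD // m0 add0r RintegralZl //.
rewrite RintegralZl; [|by []|exact: rintZ].
rewrite RintegralZl // lerD // ?ler_wpM2l ?subr_ge0 //.
Qed.

End gaussian_risk.

(** From exp (x / 2) <= 1 / (1 - x / 2), squared. *)
Lemma expR_le_lin {R : realType} (x : R) : 0 < x -> x <= 1 -> expR x - 1 <= 3 * x.
Proof.
move=> x0 x1; have := expR_ge1Dx (- (x / 2)); rewrite expRN => h.
have e0 := expR_gt0 (x / 2).
have h1 : (1 - x / 2) * expR (x / 2) <= 1.
  by rewrite -ler_pdivlMr // div1r; apply: le_trans h; lra.
have -> : expR x = expR (x / 2) ^+ 2 by rewrite expr2 -expRD; congr expR; field.
set E := expR _ in e0 h1 *.
have h2 : ((1 - x / 2) * E) ^+ 2 <= 1 by rewrite expr_le1 // mulr_ge0 //; lra.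
have h3 : 0 < (1 - x / 2) ^+ 2 by rewrite exprn_gt0 //; lra.
rewrite -(ler_pM2l h3).
have h4 : 0 <= x * (1 - x) by rewrite mulr_ge0 //; lra.
have h5 : 0 <= x * (x * (1 - x)) by rewrite mulr_ge0 // ltW.
nra.
Qed.

Section tuning.
Context {R : realType}.
Variables (n m K eps delta a s : R).
Hypotheses (n_gt0 : 0 < n) (m_gt0 : 0 < m) (K_gt0 : 0 < K) (eps_gt0 : 0 < eps)
  (delta_ge0 : 0 <= delta) (a_gt0 : 0 < a) (s_gt0 : 0 < s).

Lemma private_radius : 7776 * (n ^+ 2 * m * eps ^+ 2) * a ^+ 2 <= K * s ^+ 2 ->
  6 * (m * (K * a ^+ 6)) / s ^+ 2 <= (K * a ^+ 2 / (36 * (n * eps))) ^+ 2.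
Proof.
move=> h; have ne : 0 < 36 * (n * eps) by rewrite !mulr_gt0.
rewrite ler_pdivrMr ?exprn_gt0 // expr_div_n mulrAC ler_pdivlMr ?exprn_gt0 //.
have -> : 6 * (m * (K * a ^+ 6)) * (36 * (n * eps)) ^+ 2 =
  K * a ^+ 4 * (7776 * (n ^+ 2 * m * eps ^+ 2) * a ^+ 2) by ring.
have -> : (K * a ^+ 2) ^+ 2 * s ^+ 2 = K * a ^+ 4 * (K * s ^+ 2) by ring.
by apply: ler_wpM2l h; rewrite mulr_ge0 ?exprn_ge0 // ltW.
Qed.

Lemma private_slack (W : R) : 0 <= W -> W ^+ 2 = 24 * m / s ^+ 2 ->
  13824 * (n ^+ 2 * m * delta ^+ 2) * a ^+ 2 <= s ^+ 2 ->
  24 * (n * delta * a * W) <= 1.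
Proof.
move=> W0 W2 h.
have nd0 : 0 <= 24 * (n * delta * a * W).
  apply: mulr_ge0 => //; apply: mulr_ge0 => //; apply: mulr_ge0; last exact: ltW.
  by apply: mulr_ge0 => //; exact: ltW.
rewrite -(expr_le1 (n := 2)) //.
have -> : (24 * (n * delta * a * W)) ^+ 2 = 576 * (n * delta * a) ^+ 2 * W ^+ 2 by ring.
rewrite W2 mulrA ler_pdivrMr ?exprn_gt0 // mul1r.
by apply: le_trans h; rewrite le_eqVlt; apply/orP; left; apply/eqP; ring.
Qed.

Lemma split_budget (A r X Y : R) : A / 3 - r <= X + Y -> X <= A / 12 -> Y <= A / 12 -> A / 6 <= r.
Proof. by move=> h1 h2 h3; lra. Qed.

End tuning.

Section gaussian_lower_bounds.
Context {R : realType} (n m K : nat) (s a : R).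
Hypotheses (s_gt0 : 0 < s) (a_gt0 : 0 < a) (K_gt0 : (0 < K)%N).
Variables (alpha Calpha L CU Cxi : R).
Hypotheses (alpha_ge0 : 0 <= alpha) (L_gt1 : 1 < L) (CU_gt0 : 0 < CU) (Cxi_gt0 : 0 < Cxi)
  (radius : 1 <= Calpha ^+ 2 / pi `^ (2 * alpha))
  (K_a : K%:R `^ (2 * alpha + 1) * a ^+ 2 <= 1) (s_Cxi : 8 * s ^+ 2 = 3 * Cxi ^+ 2).
Context dZ (Z : measurableType dZ) (Q : R.-pker (n.-tuple (m.-tuple (R * R)%type)) ~> Z)
  (mut : Z -> R -> R) (r : R).
Hypotheses (mmut : estimator mut) (hr : (worst_risk alpha Calpha L CU Cxi Q mut <= r%:E)%E).
Local Notation P := (prodP (@gauss_dist R n m K s a a_gt0)).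

Lemma gauss_mean_loss : exists M : 'I_K -> Z -> R,
  [/\ forall l, measurable_fun setT (M l), forall l z, `|M l z| <= a &
      \int[P]_t mean_loss a Q M t <= r].
Proof.
have [M [mM Ma hM]] := estimator_coefficients K mmut (ltW a_gt0).
exists M; split => //; apply: average_loss => // v va.
have [hS hA] := gauss_assumptions n m s_gt0 a_gt0 alpha_ge0 L_gt1 CU_gt0 Cxi_gt0 radius
  K_gt0 K_a va s_Cxi.
have := worst_risk_ge hS hA hr.
rewrite [X in risk _ X _ _ _](_ : _ = fun t => gauss_data predT v t); last first.
  by apply/funext => t; exact: gauss_data_eq.
apply: (risk_trig_ge mmut _ mM Ma va (hM _ va)).
by apply: measurable_gauss_data => l; exact: measurable_cst.
Qed.

Lemma gauss_nonprivate_risk : 864 * (n * m)%:R * a ^+ 2 <= s ^+ 2 -> K%:R * a ^+ 2 / 6 <= r.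
Proof.
move=> ha; have [M [mM Ma hM]] := gauss_mean_loss.
(* with V = 1 / (6 a) the bound on the trace is K a^2 / 6 *)
have V0 : 0 < (6 * a)^-1 by rewrite invr_gt0 mulr_gt0.
have := nonprivate_lower s_gt0 mM Ma hM V0.
have an0 : a != 0 by rewrite gt_eqF.
have -> : a ^+ 3 * (6 * a)^-1 = a ^+ 2 / 6 by field.
have -> : 24 * (n * m)%:R / s ^+ 2 <= (6 * a)^-1 ^+ 2.
  rewrite ler_pdivrMr ?exprn_gt0 // exprVn [leRHS]mulrC ler_pdivlMr ?exprn_gt0 ?mulr_gt0 //.
  by lra.
by move=> /(_ isT); lra.
Qed.

Lemma gauss_private_risk (eps delta : R) : is_CDP eps delta Q -> 0 < eps <= 1 -> 0 <= delta ->
  (0 < n)%N -> (0 < m)%N ->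
  7776 * (n%:R ^+ 2 * m%:R * eps ^+ 2) * a ^+ 2 <= K%:R * s ^+ 2 ->
  13824 * (n%:R ^+ 2 * m%:R * delta ^+ 2) * a ^+ 2 <= s ^+ 2 ->
  K%:R * a ^+ 2 / 6 <= r.
Proof.
move=> hQ /andP[eps0 eps1] delta0 n0 m0 h1 h2; have [M [mM Ma hM]] := gauss_mean_loss.
have n0' : 0 < n%:R :> R by rewrite ltr0n.
have m0' : 0 < m%:R :> R by rewrite ltr0n.
have K0' : 0 < K%:R :> R by rewrite ltr0n.
(* V and W are chosen so that each error term is at most K a^2 / 12 *)
pose V := K%:R * a ^+ 2 / (36 * (n%:R * eps)).
pose W := Num.sqrt (24 * m%:R / s ^+ 2).
have V0 : 0 < V by rewrite divr_gt0 ?mulr_gt0 ?exprn_gt0.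
have W0 : 0 < W by rewrite sqrtr_gt0 divr_gt0 ?mulr_gt0 ?exprn_gt0.
have hV : 6 * (m%:R * (K%:R * a ^+ 6)) / s ^+ 2 <= V ^+ 2.
  exact: (private_radius n0' K0' eps0 a_gt0 s_gt0 h1).
have W2 : W ^+ 2 = 24 * m%:R / s ^+ 2.
  by rewrite sqr_sqrtr // divr_ge0 ?mulr_ge0 ?exprn_ge0 // ltW.
have hW : 24 * m%:R / s ^+ 2 <= W ^+ 2 by rewrite W2.
have := private_lower s_gt0 mM Ma hQ (ltW eps0) delta0 hM V0 hV W0 hW.
have dW : 24 * (n%:R * delta * a * W) <= 1.
  exact: (private_slack n0' delta0 a_gt0 s_gt0 (ltW W0) W2 h2).
have e3 : expR eps - 1 <= 3 * eps by exact: expR_le_lin.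
have h3 : n%:R * ((expR eps - 1) * V) <= K%:R * a ^+ 2 / 12.
  apply: (@le_trans _ _ (n%:R * (3 * eps * V))).
    by rewrite ler_pM2l // ler_wpM2r // ltW.
  by rewrite /V le_eqVlt; apply/orP; left; apply/eqP; field; rewrite !gt_eqF.
have h4 : n%:R * (2 * (delta * (a ^+ 3 * (K%:R * W)))) <= K%:R * a ^+ 2 / 12.
  have := ler_wpM2l (mulr_ge0 (ltW K0') (exprn_ge0 2 (ltW a_gt0))) dW.
  have -> : n%:R * (2 * (delta * (a ^+ 3 * (K%:R * W)))) =
    K%:R * a ^+ 2 * (24 * (n%:R * delta * a * W)) / 12 by field.
  by rewrite mulr1 ler_pM2r.
by rewrite mulrDr mulrA => /split_budget; exact.
Qed.

End gaussian_lower_bounds.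

(** * Rates *)

Section rates.
Context {R : realType}.

Lemma powR_anti (x y e : R) : 0 < x -> x <= y -> 0 <= e -> y `^ (- e) <= x `^ (- e).
Proof.
move=> x0 xy e0; have y0 := lt_le_trans x0 xy.
rewrite !powRN lef_pV2 ?posrE ?powR_gt0 //.
by apply: ge0_ler_powR; rewrite ?nnegrE // ltW.
Qed.

Lemma powR_addr1 (x e : R) : 0 < x -> x `^ (1 + e) = x * x `^ e.
Proof.
move=> x0; rewrite powRD; last by apply/implyP => _; rewrite gt_eqF.
by rewrite powRr1 // ltW.
Qed.

(** K is y^(1/q) rounded up. The hypothesis on D absorbs the rounding, which matters
    only when y^(1/q) is small. *)
Lemma choose_cutoff (y q D : R) : 0 < y -> 0 < q -> 1 <= (D - 1) * y `^ q^-1 ->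
  exists K : nat, [/\ (0 < K)%N, y <= K%:R `^ q &
    forall e : R, 0 <= e -> D `^ (- e) * y `^ (- (e / q)) <= K%:R `^ (- e)].
Proof.
move=> y0 q0 hD; set x := y `^ q^-1 in hD.
have x0 : 0 < x by exact: powR_gt0.
have D1 : 0 < D - 1 by rewrite -(pmulr_lgt0 _ x0); apply: lt_le_trans hD.
exists (Num.truncn x).+1; have /andP[t1 t2] := truncn_itv (ltW x0).
have xK : x <= (Num.truncn x).+1%:R by exact: ltW.
have KD : (Num.truncn x).+1%:R <= D * x by rewrite -natr1; lra.
split => //.
  rewrite (_ : y = x `^ q); last by rewrite /x -powRrM mulVf ?gt_eqF // powRr1 // ltW.
  by apply: ge0_ler_powR => //; rewrite ?nnegrE // ltW.
move=> e e0; have D0 : 0 < D by lra.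
rewrite (_ : y `^ (- (e / q)) = x `^ (- e)); last first.
  by rewrite /x -powRrM; congr (_ `^ _); rewrite mulrN mulrC.
rewrite -powRM; [|exact: ltW|exact: ltW]; exact: powR_anti.
Qed.

(** As ln (1/delta) >= 1 - delta >= kappa, the logarithm can be dropped from the
    hypothesis on delta; its powers of n and eps combine into n^-1 (n eps)^-p
    with p = 1 / (2 alpha + 2), and its power of m is at most m^(-1/2). *)
Lemma delta_small (n m eps delta alpha C kappa : R) :
  1 <= n -> 1 <= m -> 0 < eps -> 0 < alpha -> 0 < C -> 0 < kappa ->
  0 <= delta <= 1 - kappa -> kappa <= n * eps ->
  delta * Num.sqrt (ln (delta^-1)) <=
    C * (n `^ (- ((2 * alpha + 3) / (2 * alpha + 2)))
       * m `^ (- ((8 * alpha + 9) / (4 * alpha + 4)))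
       * eps `^ (- (1 / (2 * alpha + 2)))) ->
  n ^+ 2 * m * delta ^+ 2 <= (C / Num.sqrt kappa * kappa `^ (- (1 / (2 * alpha + 2)))) ^+ 2.
Proof.
move=> n1 m1 eps0 al0 C0 k0 /andP[d0 d1] kn hd.
have n0 : 0 < n by apply: lt_le_trans n1.
have m0 : 0 < m by apply: lt_le_trans m1.
have sk0 : 0 < Num.sqrt kappa by rewrite sqrtr_gt0.
set X := n `^ _ * _ * _ in hd.
have X0 : 0 <= X by rewrite !mulr_ge0 // powR_ge0.
have dX : delta <= C / Num.sqrt kappa * X.
  move: d0; rewrite le_eqVlt => /predU1P[<-|d0].
    by rewrite mulr_ge0 // divr_ge0 // ltW.
  have : Num.sqrt kappa <= Num.sqrt (ln delta^-1).
    rewrite ler_wsqrtr // lnV ?posrE //.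
    have := le_ln1Dx (x := delta - 1); rewrite [1 + _]addrC subrK => h.
    by have : ln delta <= delta - 1 by [apply: h; lra]; lra.
  move=> hs; rewrite mulrAC ler_pdivlMr //; apply: le_trans hd.
  by rewrite ler_wpM2l // ltW.
set p := 1 / (2 * alpha + 2).
have p0 : 0 < p by rewrite divr_gt0 //; lra.
have XE : X <= n^-1 * kappa `^ (- p) * m `^ (- 2^-1).
  have nE : n `^ (- ((2 * alpha + 3) / (2 * alpha + 2))) = n^-1 * n `^ (- p).
    rewrite -[X in _ = X * _](powR_inv1 (ltW n0)) -powRD; last by apply/implyP => _; rewrite gt_eqF.
    by congr (_ `^ _); rewrite /p; field; lra.
  have -> : X = n^-1 * (n * eps) `^ (- p) * m `^ (- ((8 * alpha + 9) / (4 * alpha + 4))).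
    by rewrite /X nE powRM ?(ltW n0) ?(ltW eps0) // -/p; ring.
  apply: ler_pM.
  - by rewrite mulr_ge0 ?powR_ge0 // invr_ge0 ltW.
  - exact: powR_ge0.
  - by rewrite ler_wpM2l ?invr_ge0 ?(ltW n0) //; apply: powR_anti => //; exact: ltW.
  apply: ler_powR => //; rewrite lerN2 ler_pdivlMr; lra.
have sm : m * (m `^ (- 2^-1)) ^+ 2 = 1.
  rewrite -powR_mulrn ?powR_ge0 // -powRrM mulNr mulVf // powR_inv1 ?(ltW m0) //.
  by rewrite divff // gt_eqF.
set H := C / Num.sqrt kappa in dX *.
have H0 : 0 <= H by rewrite divr_ge0 // ltW.
have dE : delta <= H * (n^-1 * kappa `^ (- p) * m `^ (- 2^-1)).
  by apply: le_trans dX _; rewrite ler_wpM2l.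
have d2 : delta ^+ 2 <= (H * (n^-1 * kappa `^ (- p) * m `^ (- 2^-1))) ^+ 2.
  by rewrite lerXn2r // nnegrE // (le_trans d0).
have := ler_wpM2l (mulr_ge0 (exprn_ge0 2 (ltW n0)) (ltW m0)) d2.
have -> // : n ^+ 2 * m * (H * (n^-1 * kappa `^ (- p) * m `^ (- 2^-1))) ^+ 2 =
  (H * kappa `^ (- p)) ^+ 2.
transitivity ((H * kappa `^ (- p)) ^+ 2 * (m * (m `^ (- 2^-1)) ^+ 2) * (n / n) ^+ 2); first by ring.
by rewrite sm divff ?gt_eqF // expr1n !mulr1.
Qed.

Lemma private_budget (c y k q a A s : R) : 0 <= c -> 0 <= k -> y <= k * q -> q * a ^+ 2 = A ->
  c * A <= s ^+ 2 -> c * y * a ^+ 2 <= k * s ^+ 2.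
Proof.
move=> c0 k0 yk <- hc; apply: (@le_trans _ _ (k * (c * (q * a ^+ 2)))); last exact: ler_wpM2l.
have -> : k * (c * (q * a ^+ 2)) = c * (k * q) * a ^+ 2 by ring.
by apply: ler_wpM2r; [exact: sqr_ge0|exact: ler_wpM2l].
Qed.

Lemma delta_budget (c x G a A s : R) : 0 <= c -> 0 <= x -> x <= G -> a ^+ 2 <= A ->
  c * G * A <= s ^+ 2 -> c * x * a ^+ 2 <= s ^+ 2.
Proof.
move=> c0 x0 xG aA; apply: le_trans; apply: ler_pM => //.
- exact: mulr_ge0.
- exact: sqr_ge0.
- exact: ler_wpM2l.
Qed.

Lemma small_amplitude (u v w B : R) : 0 < B -> 0 <= u -> 0 <= v -> 0 <= w ->
  exists A : R, [/\ 0 < A, A <= 1, u * A <= B & v * A <= B /\ w * A <= B].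
Proof.
move=> B0 u0 v0 w0; have D0 : 0 < B + u + v + w by lra.
exists (B / (B + u + v + w)).
have bd x : 0 <= x -> x <= B + u + v + w -> x * (B / (B + u + v + w)) <= B.
  by move=> x0 xD; rewrite mulrA ler_pdivrMr // mulrC ler_pM2l.
split; first exact: divr_gt0.
- by rewrite ler_pdivrMr // mul1r; lra.
- by apply: bd => //; lra.
- by split; apply: bd => //; lra.
Qed.

End rates.

Section lower_bounds.
Context {R : realType} (alpha Calpha L CU Cxi : R).
Hypotheses (alpha_gt1 : 1 < alpha) (L_gt1 : 1 < L) (CU_gt0 : 0 < CU) (Cxi_gt0 : 0 < Cxi)
  (radius : 1 <= Calpha ^+ 2 / pi `^ (2 * alpha)).
Variables (n m : nat).
Hypotheses (n_gt0 : (0 < n)%N) (m_gt0 : (0 < m)%N).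
Context dZ (Z : measurableType dZ) (Q : R.-pker (n.-tuple (m.-tuple (R * R)%type)) ~> Z)
  (mut : Z -> R -> R) (r : R).
Hypotheses (mmut : estimator mut) (hr : (worst_risk alpha Calpha L CU Cxi Q mut <= r%:E)%E).

Let alpha_ge0 : 0 <= alpha. Proof. by apply: le_trans (ltW alpha_gt1). Qed.

Section curve.
Variables (s A : R).
Hypotheses (s_gt0 : 0 < s) (s_Cxi : 8 * s ^+ 2 = 3 * Cxi ^+ 2) (A_gt0 : 0 < A) (A_le1 : A <= 1).

(** The largest cube, up to the constant A, that fits into the Sobolev ellipsoid. *)
Lemma ex_amplitude (K : nat) : (0 < K)%N -> exists a : R,
  [/\ 0 < a, K%:R `^ (2 * alpha + 1) * a ^+ 2 = A &
      K%:R * a ^+ 2 = A * K%:R `^ (- (2 * alpha))].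
Proof.
move=> K0; have K0' : 0 < K%:R :> R by rewrite ltr0n.
have p0 : 0 < K%:R `^ (- (2 * alpha + 1)) by exact: powR_gt0.
exists (Num.sqrt (A * K%:R `^ (- (2 * alpha + 1)))).
rewrite sqr_sqrtr; last by rewrite ltW // mulr_gt0.
split; first by rewrite sqrtr_gt0 mulr_gt0.
  by rewrite mulrCA powRN divff ?mulr1 // gt_eqF // powR_gt0.
by rewrite mulrCA -powR_addr1 // opprD addrCA subrr addr0.
Qed.

(** K^(2 alpha + 1) is comparable to n m, the sample size at which the bias and the
    variance of K coefficients balance. *)
Lemma rate_curve : 864 * A <= s ^+ 2 ->
  A * 2 `^ (- (2 * alpha)) / 6 * (n * m)%:R `^ (- (2 * alpha / (2 * alpha + 1))) <= r.
Proof.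
move=> hA; have al1 := alpha_gt1.
have y1 : 1 <= (n * m)%:R :> R by rewrite ler1n muln_gt0 n_gt0.
have y0 : 0 < (n * m)%:R :> R by apply: lt_le_trans y1.
have q0 : 0 < 2 * alpha + 1 by lra.
have D1 : 1 <= (2 - 1) * (n * m)%:R `^ (2 * alpha + 1)^-1 :> R.
  rewrite (_ : 2 - 1 = 1 :> R) ?mul1r; last by ring.
  by rewrite -[leLHS](powRr0 ((n * m)%:R : R)) ler_powR // invr_ge0 ltW.
have [K [K0 yK hK]] := choose_cutoff y0 q0 D1.
have [a [a0 aK Ka]] := ex_amplitude K0.
have a1 : K%:R `^ (2 * alpha + 1) * a ^+ 2 <= 1 by rewrite aK.
have h : 864 * (n * m)%:R * a ^+ 2 <= s ^+ 2.
  have step : (n * m)%:R * a ^+ 2 <= A.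
    rewrite -[leRHS]aK; apply: ler_wpM2r => //; exact: sqr_ge0.
  rewrite -mulrA; apply: le_trans hA; apply: ler_wpM2l step; exact: ler0n.
have := gauss_nonprivate_risk s_gt0 a0 K0 alpha_ge0 L_gt1 CU_gt0 Cxi_gt0 radius a1
  s_Cxi mmut hr h.
rewrite Ka; apply: le_trans; rewrite mulrAC; apply: ler_wpM2r; first by rewrite invr_ge0.
rewrite -[leLHS]mulrA; apply: ler_wpM2l; first exact: ltW.
by apply: hK; lra.
Qed.

(** K^(2 alpha + 2) is comparable to n^2 m eps^2. As n eps >= kappa this quantity is
    bounded below, though not by 1, hence the constant in kappa. *)
Lemma rate_curve_private (eps delta kappa G : R) : is_CDP eps delta Q ->
  0 < eps <= 1 -> 0 <= delta -> 0 < kappa -> kappa <= n%:R * eps ->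
  n%:R ^+ 2 * m%:R * delta ^+ 2 <= G ->
  7776 * A <= s ^+ 2 -> 13824 * G * A <= s ^+ 2 ->
  A * (1 + ((kappa ^+ 2) `^ (2 * alpha + 2)^-1)^-1) `^ (- (2 * alpha)) / 6 *
    (n%:R ^+ 2 * m%:R * eps ^+ 2) `^ (- (alpha / (alpha + 1))) <= r.
Proof.
have al1 := alpha_gt1.
have q0 : 0 < 2 * alpha + 2 by lra.
have q1 : 0 <= 2 * alpha + 1 by lra.
have al2 : 0 <= 2 * alpha by lra.
have qE : 2 * alpha + 2 = 1 + (2 * alpha + 1) by ring.
have halfE : alpha / (alpha + 1) = 2 * alpha / (2 * alpha + 2) by field; lra.
move=> hQ eps01 delta0 k0 kn hG hA hGA.
have eps0 : 0 < eps by case/andP: eps01.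
have n1 : 1 <= n%:R :> R by rewrite ler1n.
have m1 : 1 <= m%:R :> R by rewrite ler1n.
set y := n%:R ^+ 2 * m%:R * eps ^+ 2.
have ky : kappa ^+ 2 <= y.
  apply: (@le_trans _ _ ((n%:R * eps) ^+ 2)).
    by rewrite lerXn2r ?nnegrE ?(ltW k0) // (le_trans (ltW k0)).
  rewrite /y exprMn [leRHS]mulrAC ler_peMr // mulr_ge0 // sqr_ge0 //.
have y0 : 0 < y by apply: lt_le_trans ky; rewrite exprn_gt0.
set z := (kappa ^+ 2) `^ _.
have z0 : 0 < z by rewrite powR_gt0 // exprn_gt0.
have D1 : 1 <= (1 + z^-1 - 1) * y `^ (2 * alpha + 2)^-1.
  rewrite addrAC subrr add0r ler_pdivlMl // mulr1.
  apply: ge0_ler_powR => //; rewrite ?nnegrE ?invr_ge0 ?(ltW q0) ?(ltW y0) //.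
  exact: sqr_ge0.
have [K [K0 yK hK]] := choose_cutoff y0 q0 D1.
have K0' : 0 < K%:R :> R by rewrite ltr0n.
have [a [a0 aK Ka]] := ex_amplitude K0.
have a1 : K%:R `^ (2 * alpha + 1) * a ^+ 2 <= 1 by rewrite aK.
have h1 : 7776 * y * a ^+ 2 <= K%:R * s ^+ 2.
  have yK' : y <= K%:R * K%:R `^ (2 * alpha + 1) by rewrite -powR_addr1 // -qE.
  exact: (private_budget (ler0n _ _) (ler0n _ _) yK' aK hA).
have ampA : a ^+ 2 <= A.
  rewrite -[leRHS]aK; apply: ler_peMl; first exact: sqr_ge0.
  by rewrite -[leLHS](powRr0 (K%:R : R)); apply: ler_powR => //; rewrite ler1n.
have h2 : 13824 * (n%:R ^+ 2 * m%:R * delta ^+ 2) * a ^+ 2 <= s ^+ 2.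
  have nd : 0 <= n%:R ^+ 2 * m%:R * delta ^+ 2.
    by apply: mulr_ge0 (sqr_ge0 _); apply: mulr_ge0 (ler0n _ _); exact: sqr_ge0.
  exact: (delta_budget (ler0n _ _) nd hG ampA hGA).
have := gauss_private_risk s_gt0 a0 K0 alpha_ge0 L_gt1 CU_gt0 Cxi_gt0 radius a1
  s_Cxi mmut hr hQ eps01 delta0 n_gt0 m_gt0 h1 h2.
rewrite Ka; apply: le_trans; rewrite mulrAC; apply: ler_wpM2r; first by rewrite invr_ge0.
rewrite -[leLHS]mulrA; apply: ler_wpM2l; first exact: ltW.
by rewrite halfE; exact: hK.
Qed.

End curve.

Section mean.
Variable b : R.
Hypotheses (b_gt0 : 0 < b) (b_half : 2 * b <= 1) (b_CU : 2 * (2 * b) ^+ 2 <= CU ^+ 2).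

(** The sign bias s = (8 n)^(-1/2) keeps the chi-square distance below 1. *)
Lemma rate_mean : b ^+ 2 / 32 * n%:R^-1 <= r.
Proof.
have n0 : 0 < n%:R :> R by rewrite ltr0n.
have n1 : 1 <= n%:R :> R by rewrite ler1n.
pose s : R := Num.sqrt (8 * n%:R)^-1.
have s2 : s ^+ 2 = (8 * n%:R)^-1 by rewrite sqr_sqrtr // invr_ge0 mulr_ge0.
have s0 : 0 < s by rewrite sqrtr_gt0 invr_gt0 mulr_gt0.
have s1 : s <= 1.
  rewrite -(expr_le1 (n := 2)) ?(ltW s0) // s2 invf_le1 ?mulr_gt0 //; lra.
have nn0 : n%:R != 0 :> R by rewrite gt_eqF.
have := two_point_lower b_gt0 s0 s1 alpha_ge0 L_gt1 CU_gt0 Cxi_gt0 radius b_half b_CU mmut hr.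
have -> : (s * b) ^+ 2 / 4 = b ^+ 2 / 32 * n%:R^-1 by rewrite exprMn s2; field.
apply=> M mM Mb; apply: mean_answer_chi2 => //.
by rewrite s2; field.
Qed.

(** The sign bias is of order 1 / (n eps), with a constant that leaves room for
    delta and keeps s below 1. *)
Lemma rate_mean_private (eps delta kappa H : R) : is_CDP eps delta Q ->
  0 < eps <= 1 -> 0 <= delta -> 0 < kappa -> kappa <= n%:R * eps ->
  0 <= H -> n%:R * delta <= H ->
  b ^+ 2 / (4 * (3 + 2 * H / kappa + kappa^-1) ^+ 2) * (n%:R * eps) ^- 2 <= r.
Proof.
move=> hQ eps01 delta0 k0 kn H0 hH; have /andP[eps0 eps1] := eps01.
have n0 : 0 < n%:R :> R by rewrite ltr0n.
have ne0 : 0 < n%:R * eps by exact: mulr_gt0.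
set E := 3 + 2 * H / kappa + kappa^-1.
have ki0 : 0 < kappa^-1 by rewrite invr_gt0.
have Hk0 : 0 <= 2 * H / kappa by rewrite divr_ge0 ?mulr_ge0 // ltW.
have E0 : 0 < E by rewrite /E; lra.
pose s := (E * (n%:R * eps))^-1.
have s0 : 0 < s by rewrite invr_gt0 mulr_gt0.
have s1 : s <= 1.
  rewrite invf_le1 ?mulr_gt0 //; apply: (@le_trans _ _ (kappa^-1 * (n%:R * eps))).
    by rewrite ler_pdivlMl // mulr1.
  by rewrite ler_pM2r // /E; lra.
have := two_point_lower b_gt0 s0 s1 alpha_ge0 L_gt1 CU_gt0 Cxi_gt0 radius b_half b_CU mmut hr.
have -> : (s * b) ^+ 2 / 4 = b ^+ 2 / (4 * E ^+ 2) * (n%:R * eps) ^- 2.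
  by rewrite /s; field; rewrite !gt_eqF.
apply=> M mM Mb; apply: (mean_answer_privacy b s0 s1 mM Mb hQ (ltW eps0) delta0).
have e3 : expR eps - 1 <= 3 * eps by exact: expR_le_lin.
rewrite mulrAC /s ler_pdivrMr ?mulr_gt0 // mul1r.
apply: (@le_trans _ _ (3 * (n%:R * eps) + 2 * H)).
  have := ler_wpM2l (ltW n0) e3; lra.
have : 2 * H <= 2 * H / kappa * (n%:R * eps).
  by rewrite mulrAC ler_pdivlMr // ler_wpM2l // mulr_ge0.
have : 0 <= kappa^-1 * (n%:R * eps) by rewrite mulr_ge0 // ltW.
rewrite /E 2!mulrDl; lra.
Qed.

End mean.
End lower_bounds.

Theorem theorem3 (R : realType) (alpha Calpha L CU Cxi : R)
    (alpha_gt1 : 1 < alpha) (Calpha_gt0 : 0 < Calpha) (L_gt1 : 1 < L)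
    (CU_gt0 : 0 < CU) (Cxi_gt0 : 0 < Cxi)
    (class_nonempty : exists f : R -> R, sampling_density alpha Calpha L f) :
  forall C kappa : R, 0 < C -> 0 < kappa ->
  exists2 c : R, 0 < c &
  forall (n m : nat) (eps delta : R),
    (0 < n)%N -> (0 < m)%N -> 0 < eps < 1 ->
    0 <= delta <= 1 - kappa -> kappa <= n%:R * eps ->
    delta * Num.sqrt (ln (delta^-1)) <=
      C * (n%:R `^ (- ((2 * alpha + 3) / (2 * alpha + 2)))
         * m%:R `^ (- ((8 * alpha + 9) / (4 * alpha + 4)))
         * eps `^ (- (1 / (2 * alpha + 2)))) ->
    ((c * Num.max
           (Num.max ((n * m)%:R `^ (- (2 * alpha / (2 * alpha + 1))))
                    ((n%:R ^+ 2 * m%:R * eps ^+ 2) `^ (- (alpha / (alpha + 1)))))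
           (Num.max (n%:R^-1) ((n%:R * eps) ^- 2)))%:E
      <= minimax_risk alpha Calpha L CU Cxi n m eps delta)%E.
Proof.
move=> C kappa C_gt0 kappa_gt0.
have radius : 1 <= Calpha ^+ 2 / pi `^ (2 * alpha).
  by case: class_nonempty => f; exact: sobolev_radius.
have alpha_gt0 : 0 < alpha by exact: lt_trans alpha_gt1.
(* exp (g^2 / Cxi^2) has Gaussian expectation exactly 2 at this scale *)
pose s : R := Num.sqrt (3 / 8) * Cxi.
have s_gt0 : 0 < s by rewrite mulr_gt0 // sqrtr_gt0 divr_gt0.
have s_Cxi : 8 * s ^+ 2 = 3 * Cxi ^+ 2.
  by rewrite /s exprMn sqr_sqrtr ?divr_ge0 //; field.
(* b <= 1/2 keeps U in the Sobolev ball, b <= CU / 4 controls its psi_2 norm *)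
pose b : R := Num.min 2^-1 (CU / 4).
have b_gt0 : 0 < b by rewrite lt_min invr_gt0 ltr0n divr_gt0.
have b_half : 2 * b <= 1.
  by rewrite -ler_pdivlMl // mulr1 ge_min lexx.
have b_CU : 2 * (2 * b) ^+ 2 <= CU ^+ 2.
  have : b <= CU / 4 by rewrite ge_min lexx orbT.
  move=> h; have : b ^+ 2 <= (CU / 4) ^+ 2 by rewrite lerXn2r // nnegrE ?divr_ge0 // ltW.
  by have := sqr_ge0 CU; rewrite !exprMn; lra.
pose H : R := C / Num.sqrt kappa * kappa `^ (- (1 / (2 * alpha + 2))).
have H_ge0 : 0 <= H by rewrite mulr_ge0 ?powR_ge0 // divr_ge0 ?sqrtr_ge0 // ltW.
have [A [A_gt0 A_le1 hA1 [hA2 hA3]]] : exists A : R, [/\ 0 < A, A <= 1, 864 * A <= s ^+ 2 &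
    7776 * A <= s ^+ 2 /\ 13824 * H ^+ 2 * A <= s ^+ 2].
  apply: small_amplitude (exprn_gt0 2 s_gt0) (ler0n _ _) (ler0n _ _) _.
  by apply: mulr_ge0 (ler0n _ _) _; exact: sqr_ge0.
pose z : R := ((kappa ^+ 2) `^ (2 * alpha + 2)^-1)^-1.
pose E : R := 3 + 2 * H / kappa + kappa^-1.
pose c1 : R := A * 2 `^ (- (2 * alpha)) / 6.
pose c2 : R := A * (1 + z) `^ (- (2 * alpha)) / 6.
pose c3 : R := b ^+ 2 / 32.
pose c4 : R := b ^+ 2 / (4 * E ^+ 2).
have z_gt0 : 0 < z by rewrite invr_gt0 powR_gt0 // exprn_gt0.
have E_gt0 : 0 < E.
  have h1 : 0 < kappa^-1 by rewrite invr_gt0.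
  have h2 : 0 <= 2 * H / kappa by apply: divr_ge0 (ltW kappa_gt0); exact: mulr_ge0.
  by apply: addr_gt0 h1; apply: ltr_wpDr h2 _; rewrite ltr0n.
have c1_gt0 : 0 < c1 by rewrite divr_gt0 // mulr_gt0 // powR_gt0.
have c2_gt0 : 0 < c2 by rewrite divr_gt0 // mulr_gt0 // powR_gt0 // addr_gt0.
have c3_gt0 : 0 < c3 by rewrite divr_gt0 // exprn_gt0.
have c4_gt0 : 0 < c4 by rewrite divr_gt0 ?mulr_gt0 ?exprn_gt0.
exists (Num.min (Num.min c1 c2) (Num.min c3 c4)); first by rewrite !lt_min c1_gt0 c2_gt0 c3_gt0.
move=> n m eps delta n_gt0 m_gt0 /andP[eps_gt0 eps_lt1] hdelta kn hyp.
have delta_ge0 : 0 <= delta by case/andP: hdelta.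
have n1 : 1 <= n%:R :> R by rewrite ler1n.
have m1 : 1 <= m%:R :> R by rewrite ler1n.
have G := delta_small n1 m1 eps_gt0 alpha_gt0 C_gt0 kappa_gt0 hdelta kn hyp.
have ndelta : n%:R * delta <= H.
  have nd0 : 0 <= n%:R * delta by exact: mulr_ge0.
  rewrite -(ler_pXn2r (n := 2)) ?nnegrE //; apply: le_trans G.
  by rewrite exprMn [leRHS]mulrAC ler_peMr // mulr_ge0 // sqr_ge0.
have eps01 : 0 < eps <= 1 by rewrite eps_gt0 ltW.
set T1 := _ `^ _; set T2 := _ `^ _; set T3 := _^-1; set T4 := _ ^- 2.
set c := Num.min _ _.
have c_gt0 : 0 < c by rewrite !lt_min c1_gt0 c2_gt0 c3_gt0.
have T1_ge0 : 0 <= T1 by exact: powR_ge0.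
have T2_ge0 : 0 <= T2 by exact: powR_ge0.
have T3_gt0 : 0 < T3 by rewrite invr_gt0 ltr0n.
have T4_ge0 : 0 <= T4 by rewrite invr_ge0 sqr_ge0.
have main dZ (Z : measurableType dZ) (Q : R.-pker (n.-tuple (m.-tuple (R * R)%type)) ~> Z)
    mut (r : R) : is_CDP eps delta Q -> estimator mut ->
    (worst_risk alpha Calpha L CU Cxi Q mut <= r%:E)%E ->
    c * Num.max (Num.max T1 T2) (Num.max T3 T4) <= r.
  move=> hQ mmut hr.
  rewrite !maxr_pMr ?(ltW c_gt0) // !ge_max; apply/andP; split; apply/andP; split.
  - apply: (le_trans (y := c1 * T1)); first by rewrite ler_wpM2r // !ge_min lexx.
    exact: (rate_curve alpha_gt1 L_gt1 CU_gt0 Cxi_gt0 radius n_gt0 m_gt0 mmut hr s_gt0).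
  - apply: (le_trans (y := c2 * T2)); first by rewrite ler_wpM2r // !ge_min lexx ?orbT.
    exact: (rate_curve_private alpha_gt1 L_gt1 CU_gt0 Cxi_gt0 radius n_gt0 m_gt0 mmut hr s_gt0
      s_Cxi A_gt0 A_le1 hQ eps01 delta_ge0 kappa_gt0 kn G).
  - apply: (le_trans (y := c3 * T3)).
      by rewrite ler_wpM2r ?(ltW T3_gt0) // !ge_min lexx ?orbT.
    exact: (rate_mean alpha_gt1 L_gt1 CU_gt0 Cxi_gt0 radius n_gt0 mmut hr b_gt0).
  - apply: (le_trans (y := c4 * T4)); first by rewrite ler_wpM2r // !ge_min lexx ?orbT.
    exact: (rate_mean_private alpha_gt1 L_gt1 CU_gt0 Cxi_gt0 radius n_gt0 mmut hr b_gt0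
      b_half b_CU hQ eps01 delta_ge0 kappa_gt0 kn H_ge0 ndelta).
apply: le_ereal_inf_tmp => _ [dZ [Z [Q [hQ ->]]]].
apply: le_ereal_inf_tmp => _ [mut mmut <-].
have key (r : R) := main dZ Z Q mut r hQ mmut.
case: (worst_risk _ _ _ _ _ _ _) key => [r| |] key; first by rewrite lee_fin; exact: key.
  exact: leey.
have pos : 0 < c * Num.max (Num.max T1 T2) (Num.max T3 T4).
  by rewrite mulr_gt0 // !lt_max T3_gt0 orbT.
have := lt_le_trans pos (key 0 _); rewrite ltxx => /(_ (leNye _)); exact.
Qed.
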